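(* Let $F(\alpha)=\dfrac{1+e^{-\alpha}}{1+e^{-\alpha}+e^{-2\alpha}}$ for $\alpha\ge 0$. Then, uniformly for all integers $\ell$, as $N\to+\infty$, $$V_d\left(\ell,\,N+\frac{|\ell|(|\ell|+1)}{2}\right)=p(N)\,F\left(\frac{\pi|\ell|}{\sqrt{6N}}\right)\left(1+O\left(N^{-1/10}\right)\right),$$ where the implied constant is absolute (i.e. there are absolute constants $C,N_0$ such that the relative error is at most $CN^{-1/10}$ for all integers $N\ge N_0$ and all $\ell\in\mathbb{Z}$). In particular, if $m=m(N)$ is an integer with $m=o(N^{3/8})$, then as $N\to\infty$ $$\frac{V_d(m,N)}{V_d(N)}\sim \frac{1}{(24N)^{1/4}}\exp\left(-\frac{\pi m^2}{\sqrt{24N}}\right).$$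
   Context: A strongly concave composition of a nonnegative integer $n$ is a finite sequence of nonnegative integers $(a_1,\dots,a_s)$, $s\ge 1$, summing to $n$, such that for some index $k$ with $1\le k\le s$ one has $a_1>a_2>\dots>a_{k-1}>a_k<a_{k+1}<\dots<a_s$; $a_k$ is called the central part. Its rank is $s-2k+1$. $V_d(m,n)$ denotes the number of strongly concave compositions of $n$ with rank $m$, and $V_d(n)$ the total number of strongly concave compositions of $n$. $p(n)$ is the partition function, with $p(n)=0$ for negative integers $n$. *)

(* Defs.v *)
From Stdlib Require Import Reals Lra Lia ZArith Arith List Bool.
Import ListNotations.
Open Scope R_scope.

Fixpoint lists_len (L v : nat) : list (list nat) :=
  match L with
  | O => [[]]
  | S L' => flat_map (fun x => map (cons x) (lists_len L' v)) (seq 0 (S v))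
  end.

(* All lists of length between 1 and n+1 with entries in {0,...,n}.
   Every strongly concave composition of n lies in this finite list:
   entries are <= n since they sum to n, and at most one entry (the central
   one) can be 0, so the length s satisfies s - 1 <= n. *)
Definition cand_scc (n : nat) : list (list nat) :=
  flat_map (fun L => lists_len L n) (seq 1 (S n)).

Definition sumlist (l : list nat) : nat := fold_right Nat.add 0%nat l.

(* Shape condition with central index k = kk+1 (1-based), kk 0-based:
   a_1 > ... > a_k < a_{k+1} < ... < a_s. *)
Definition concave_at (l : list nat) (kk : nat) : bool :=
  forallb (fun i => Nat.ltb (nth (S i) l 0%nat) (nth i l 0%nat)) (seq 0 kk) &&
  forallb (fun i => Nat.ltb (nth i l 0%nat) (nth (S i) l 0%nat))
          (seq kk (length l - 1 - kk)).

(* rank = s - 2k + 1 with k = kk + 1 *)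
Definition rank_at (l : list nat) (kk : nat) : Z :=
  (Z.of_nat (length l) - 2 * Z.of_nat (S kk) + 1)%Z.

Definition is_scc (l : list nat) : bool :=
  Nat.ltb 0 (length l) && existsb (concave_at l) (seq 0 (length l)).

Definition is_scc_rank (m : Z) (l : list nat) : bool :=
  Nat.ltb 0 (length l) &&
  existsb (fun kk => concave_at l kk && Z.eqb (rank_at l kk) m) (seq 0 (length l)).

Definition Vd_rank (m : Z) (n : nat) : nat :=
  length (filter (fun l => Nat.eqb (sumlist l) n && is_scc_rank m l) (cand_scc n)).

Definition Vd (n : nat) : nat :=
  length (filter (fun l => Nat.eqb (sumlist l) n && is_scc l) (cand_scc n)).

(* Partitions of n: nonincreasing lists of positive integers summing to n;
   they have length <= n and entries in {1..n}. *)
Fixpoint nonincr (l : list nat) : bool :=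
  match l with
  | x :: ((y :: _) as t) => Nat.leb y x && nonincr t
  | _ => true
  end.

Definition is_partition_of (n : nat) (l : list nat) : bool :=
  Nat.eqb (sumlist l) n && forallb (fun x => Nat.ltb 0 x) l && nonincr l.

Definition part (n : nat) : nat :=
  length (filter (is_partition_of n)
                 (flat_map (fun L => lists_len L n) (seq 0 (S n)))).

Definition F (alpha : R) : R :=
  (1 + exp (- alpha)) / (1 + exp (- alpha) + exp (- 2 * alpha)).

(* Main.v *)
Require Import Defs.
From Coquelicot Require Import Coquelicot.
From Stdlib Require Import Reals ZArith Arith List.
From Stdlib Require Import Lra Lia Psatz Bool Permutation.
Import ListNotations.

(** Write [V(l,n)] for the number of strongly concave compositions of rank [l] and
    [a(l,n) = V(l, n + l(l+1)/2)]. With [f_c = prod_(a>c) (1+z q^a)(1+q^a/z)], the rank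
    generating function is [W_1], where [W_e = sum_(c>=0) q^(e c) f_c]. Telescoping
    [f_(c-1) - f_c] gives [(z+1/z) W_1 + W_2 = f_(-1) - 1], and the substitution [z -> zq] gives a
    second linear relation between [W_1] and [W_2]; eliminating [W_2] and expanding [f_(-1)] by the
    Jacobi triple product yields
      [a(l,n) = p(n) - p(n-2l-4) + a(l+4, n-3l-8)].
    The formal analogue of this recurrence with [p(N-k)] replaced by [p(N) x^k] and
    [y = x^l] fixed is [F = 1 - y^2 + y^3 F], which is where [F] comes from.

    The only analytic input on [p] is that, for [t = PI / sqrt (6N)], the function
    [k -> p(N-k) e^(kt)] is Lipschitz with constant [O(t^(3/2) p(N))]. This is read off the Fourier
    integral of [prod 1/(1 - e^(-kt) e^(ik theta))], kept in polar form: the first absolute moment of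
    its modulus is [O(t^3)] times its value at [0], while the integral for [p(N)] itself is at least
    [c t^(3/2)] times that value, because the phase is negligible for [theta = O(t^(3/2))]; here
    [zeta(2) = PI^2/6] identifies [t] as an approximate saddle point.

    Feeding this into the recurrence gives [a(l,N-k) = p(N) e^(-kt) (F(tl) + O(k t^(3/2) + sqrt t))]
    uniformly. The choice [k = 0] is the first claim; the second follows with [k = l(l+1)/2], summing
    over [l] with the help of the Gaussian integral. *)

(** * Coefficient identities *)

Open Scope Z_scope.

(** All products are cut off at a largest part, so the generating functions are Laurent polynomials
    and every identity is a relation between integer coefficients; the effects of the cut-off carry
    a power [q^K] and vanish once [K >= n]. The size of p(N) is never computed: one Fourier integral
    is divided by another, and the value of the modulus at 0 cancels. The obstacle is the
    propagation of errors. One step of the recurrence adds a relative error of order [t], caused by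
    the constants 4 and 8 and by the passage from [l] to [l+4], but it contracts the earlier error
    only by [e^(-(3l+8)t)]. For [l] of order [t^(-1/2)] or more the contraction absorbs the new
    error and leaves [O(sqrt t)]. For smaller [l] it is too weak; there one uses that [l] grows by
    four, so that only [O(t^(-1/2))] such steps occur. An exponential term in the potential keeps
    this account. The final error [sqrt t] has order [N^(-1/4)], inside the required [N^(-1/10)];
    the term [k t^(3/2)] with [k] near [m^2/2] is the origin of the range [m = o(N^(3/8))]. *)

Definition delta (l n : Z) : Z := if (l =? 0) && (n =? 0) then 1 else 0.

(* [fprod c len l n] is the coefficient of [z^l q^n] in
   [prod_(c < a <= c+len) (1 + z q^a)(1 + q^a/z)]. *)
Fixpoint fprod (c : Z) (len : nat) (l n : Z) : Z :=
  match len with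
  | O => delta l n
  | S len' =>
      fprod (c + 1) len' l n + fprod (c + 1) len' (l - 1) (n - c - 1)
      + fprod (c + 1) len' (l + 1) (n - c - 1)
      + fprod (c + 1) len' l (n - 2 * c - 2)
  end.

(* Coefficients of [sum_(c <= c' <= c+len) q^(e c') f_c'], with [f_c'] cut off at parts [c+len]. *)
Fixpoint Wsum (e c : Z) (len : nat) (l n : Z) : Z :=
  match len with
  | O => delta l (n - e * c)
  | S len' => fprod c len l (n - e * c) + Wsum e (c + 1) len' l n
  end.

(** Values of [f] at arguments that agree up to [ring] become one variable; after that a coefficient
    identity is linear and [lia] can close it. *)
Ltac merge_terms f :=
  repeat match goal with
  | |- context [f ?a ?b] =>
    let v := fresh "v" in let E := fresh "E" in
    remember (f a b) as v eqn:E;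
    repeat match goal with
    | |- context [f ?a' ?b'] =>
      replace (f a' b') with v by (rewrite E; apply f_equal2; ring)
    end;
    clear E
  end.

Lemma delta_shift c l n :
  delta l (n - l) + delta (l - 1) (n - c - l)
  + delta (l + 1) (n - c - l - 1) + delta l (n - c - 1 - c - l)
  = delta l n + delta (l + 1) (n - c) + delta (l - 1) (n - c - 1)
    + delta l (n - c - c - 1).
Proof.
  unfold delta.
  repeat match goal with |- context [?a =? ?b] => destruct (Z.eqb_spec a b) end; simpl; lia.
Qed.

(* With [z -> zq] every factor of the truncated product moves one step, so only the end factors change. *)
Lemma fprod_shift len : forall c l n,
  let K := c + Z.of_nat len in
  fprod c len l (n - l) + fprod c len (l - 1) (n - c - l)
  + fprod c len (l + 1) (n - K - l - 1) + fprod c len l (n - c - 1 - K - l)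
  = fprod c len l n + fprod c len (l + 1) (n - c)
    + fprod c len (l - 1) (n - K - 1) + fprod c len l (n - c - K - 1).
Proof.
  induction len as [|len IH]; intros c l n K.
  - subst K. replace (c + Z.of_nat 0) with c by lia. apply delta_shift.
  - cbn [fprod].
    set (g := fprod (c + 1) len) in *.
    assert (HK : K = (c + 1) + Z.of_nat len) by (subst K; lia).
    pose proof (IH (c + 1) l n) as H1.
    pose proof (IH (c + 1) (l + 1) (n - c)) as H2.
    pose proof (IH (c + 1) (l - 1) (n - c - 1)) as H3.
    pose proof (IH (c + 1) l (n - 2 * c - 1)) as H4.
    cbv zeta in H1, H2, H3, H4. fold g in H1, H2, H3, H4.
    rewrite <- HK in *. clearbody K. clear IH HK.
    revert H1 H2 H3 H4. clearbody g.
    merge_terms g.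
    intros. lia.
Qed.

(** Since [f_(c-1) = (1 + z q^c)(1 + q^c/z) f_c], the difference is [(z q^c + q^c/z + q^(2c)) f_c],
    one term for each sum on the right. The telescope ends at the empty product, whence [delta]. *)
Lemma Wsum_telescope len : forall c l n,
  fprod (c - 1) (S len) l n - delta l n
  = Wsum 1 c len (l - 1) n + Wsum 1 c len (l + 1) n + Wsum 2 c len l n.
Proof.
  induction len as [|len IH]; intros c l n.
  - cbn [fprod Wsum]. merge_terms delta. lia.
  - change (fprod (c - 1) (S (S len)) l n) with
     (fprod (c - 1 + 1) (S len) l n + fprod (c - 1 + 1) (S len) (l - 1) (n - (c - 1) - 1)
      + fprod (c - 1 + 1) (S len) (l + 1) (n - (c - 1) - 1)
      + fprod (c - 1 + 1) (S len) l (n - 2 * (c - 1) - 2)).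
    replace (c - 1 + 1) with c by lia.
    change (Wsum 1 c (S len) (l - 1) n) with (fprod c (S len) (l - 1) (n - 1 * c) + Wsum 1 (c + 1) len (l - 1) n).
    change (Wsum 1 c (S len) (l + 1) n) with (fprod c (S len) (l + 1) (n - 1 * c) + Wsum 1 (c + 1) len (l + 1) n).
    change (Wsum 2 c (S len) l n) with (fprod c (S len) l (n - 2 * c) + Wsum 2 (c + 1) len l n).
    specialize (IH (c + 1) l n). replace (c + 1 - 1) with c in IH by lia.
    revert IH. set (g := fprod c (S len)). clearbody g. merge_terms g. lia.
Qed.

Lemma Wsum_unfold e c len l n :
  Wsum e c (S len) l n = fprod c (S len) l (n - e * c) + Wsum e (c + 1) len l n.
Proof. reflexivity. Qed.

(** The relation [fprod_shift] is multiplied by [q^c] and summed over [c]. The factors at the lower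
    end contribute another [q^c], which turns [W_1] into [W_2]; the four terms involving [K] come
    from the upper end. *)
Lemma Wsum_shift len : forall c l n,
  let K := c + Z.of_nat len in
  Wsum 1 c len l (n - l) + Wsum 2 c len (l - 1) (n - l)
  + Wsum 1 c len (l + 1) (n - K - l - 1) + Wsum 2 c len l (n - 1 - K - l)
  = Wsum 1 c len l n + Wsum 2 c len (l + 1) n
    + Wsum 1 c len (l - 1) (n - K - 1) + Wsum 2 c len l (n - K - 1).
Proof.
  induction len as [|len IH]; intros c l n K.
  - subst K. cbn [Wsum]. pose proof (delta_shift c l (n - c)) as H. revert H.
    replace (c + Z.of_nat 0) with c by lia. merge_terms delta. lia.
  - rewrite !Wsum_unfold.
    pose proof (fprod_shift (S len) c l (n - c)) as H. cbv zeta in H.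
    fold K in H. specialize (IH (c + 1) l n). cbv zeta in IH.
    replace (c + 1 + Z.of_nat len) with K in IH by (subst K; lia).
    clearbody K. revert H IH.
    set (g := fprod c (S len)). clearbody g.
    set (w1 := Wsum 1 (c + 1) len). set (w2 := Wsum 2 (c + 1) len).
    clearbody w1 w2. merge_terms g. intros. lia.
Qed.

Lemma fprod_neg len : forall c l n, -1 <= c -> n < 0 -> fprod c len l n = 0.
Proof.
  induction len as [|len IH]; intros c l n Hc Hn; cbn [fprod].
  - unfold delta. destruct (l =? 0); simpl; auto. destruct (Z.eqb_spec n 0); auto; lia.
  - rewrite !IH by lia. lia.
Qed.

Lemma Wsum_neg len : forall e c l n, 0 <= e -> 0 <= c -> n < 0 -> Wsum e c len l n = 0.
Proof.
  induction len as [|len IH]; intros e c l n He Hc Hn.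
  - cbn [Wsum]. apply (fprod_neg 0 0); nia.
  - rewrite Wsum_unfold, IH, fprod_neg by nia. lia.
Qed.

Lemma fprod_sym len : forall c l n, fprod c len (- l) n = fprod c len l n.
Proof.
  induction len as [|len IH]; intros c l n; cbn [fprod].
  - unfold delta. destruct (Z.eqb_spec l 0), (Z.eqb_spec (-l) 0); simpl; auto; lia.
  - rewrite <- (IH _ (l - 1)), <- (IH _ (l + 1)), (IH _ l), (IH _ l).
    replace (- (l - 1)) with (- l + 1) by lia. replace (- (l + 1)) with (- l - 1) by lia. lia.
Qed.

Lemma Wsum_sym len : forall e c l n, Wsum e c len (- l) n = Wsum e c len l n.
Proof.
  induction len as [|len IH]; intros e c l n.
  - apply (fprod_sym 0 0).
  - rewrite !Wsum_unfold, IH, fprod_sym. reflexivity.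
Qed.

(** For [n <= K] the terms from the upper end sit at negative exponents. Replacing both remaining
    [W_2] terms by the telescoped relation also cancels the [W_1] terms of rank [l], and only the
    ranks [l - 2] and [l + 2] survive: hence the steps of four in the recurrence. *)
Lemma Wsum_four_step K l n :
  2 <= l -> 0 <= n <= Z.of_nat K ->
  Wsum 1 0 K (l + 2) n
  = Wsum 1 0 K (l - 2) (n - l) + fprod (-1) (S K) (l + 1) n - fprod (-1) (S K) (l - 1) (n - l).
Proof.
  intros Hl Hn.
  pose proof (Wsum_shift K 0 l n) as H. cbv zeta in H.
  rewrite (Wsum_neg K 1 0 (l + 1)), (Wsum_neg K 2 0 l (n - 1 - _ - l)),
    (Wsum_neg K 1 0 (l - 1) (n - _ - 1)), (Wsum_neg K 2 0 l (n - _ - 1)) in H by lia.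
  pose proof (Wsum_telescope K 0 (l - 1) (n - l)) as H1.
  pose proof (Wsum_telescope K 0 (l + 1) n) as H2.
  change (0 - 1) with (-1) in *.
  replace (delta (l - 1) (n - l)) with 0 in H1
    by (unfold delta; destruct (Z.eqb_spec (l - 1) 0); simpl; lia).
  replace (delta (l + 1) n) with 0 in H2
    by (unfold delta; destruct (Z.eqb_spec (l + 1) 0); simpl; lia).
  replace (l - 1 - 1) with (l - 2) in H1 by lia. replace (l - 1 + 1) with l in H1 by lia.
  replace (l + 1 - 1) with l in H2 by lia. replace (l + 1 + 1) with (l + 2) in H2 by lia.
  lia.
Qed.

(** * One-sided products and the finite form of the triple product *)

Definition tri (x : Z) : Z := x * (x + 1) / 2.

Lemma tri_spec x : 2 * tri x = x * (x + 1).
Proof.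
  unfold tri. destruct (Z.Even_or_Odd x) as [[y ->]|[y ->]].
  - replace (2 * y * (2 * y + 1)) with ((y * (2 * y + 1)) * 2) by lia. rewrite Z.div_mul; lia.
  - replace ((2 * y + 1) * (2 * y + 1 + 1)) with (((2 * y + 1) * (y + 1)) * 2) by lia.
    rewrite Z.div_mul; lia.
Qed.

(* Coefficients of [prod_(1 <= a <= L) (1 + z q^a)]. *)
Fixpoint Eprod (L : nat) (k n : Z) : Z :=
  match L with
  | O => delta k n
  | S L' => Eprod L' k n + Eprod L' (k - 1) (n - Z.of_nat L)
  end.

Lemma Eprod_unfold L k n :
  Eprod (S L) k n = Eprod L k n + Eprod L (k - 1) (n - Z.of_nat (S L)).
Proof. reflexivity. Qed.

(** With the factor [1 + z q] split off, the remaining factors are those of the shorter product at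
    [zq]. *)
Lemma Eprod_bottom L : forall k n,
  Eprod (S L) k n = Eprod L k (n - k) + Eprod L (k - 1) (n - k).
Proof.
  induction L as [|L IH]; intros k n.
  - cbn [Eprod]. unfold delta. change (Z.of_nat 1) with 1.
    repeat match goal with |- context [?a =? ?b] => destruct (Z.eqb_spec a b) end; simpl; lia.
  - rewrite Eprod_unfold, (IH k n), (IH (k - 1)), (Eprod_unfold L k (n - k)), (Eprod_unfold L (k - 1) (n - k)).
    rewrite !Nat2Z.inj_succ. set (g := Eprod L). clearbody g. merge_terms g. lia.
Qed.

(** [fprod] recurses on its lowest factor, which suits the telescoping; the range in [fprod_Eprod]
    grows at its highest one. *)
Lemma fprod_top len : forall c l n,
  let K := c + Z.of_nat len + 1 in
  fprod c (S len) l n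
  = fprod c len l n + fprod c len (l - 1) (n - K)
    + fprod c len (l + 1) (n - K) + fprod c len l (n - 2 * K).
Proof.
  induction len as [|len IH]; intros c l n K.
  - subst K. cbn [fprod]. merge_terms delta. lia.
  - pose proof (IH (c + 1)) as H. cbv zeta in H.
    replace (c + 1 + Z.of_nat len + 1) with K in H by (subst K; lia).
    change (fprod c (S (S len)) l n) with
      (fprod (c + 1) (S len) l n + fprod (c + 1) (S len) (l - 1) (n - c - 1)
      + fprod (c + 1) (S len) (l + 1) (n - c - 1)
      + fprod (c + 1) (S len) l (n - 2 * c - 2)).
    rewrite !H. cbn [fprod]. clearbody K.
    set (g := fprod (c + 1) len). clearbody g. merge_terms g. lia.
Qed.

(* [(1 + q^a/z) = q^a z^-1 (1 + z q^-a)] turns the two-sided product into a one-sided one. *)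
Lemma fprod_Eprod K : forall l n,
  fprod 0 K l n + fprod 0 K (l - 1) n
  = Eprod (2 * K + 1) (l + Z.of_nat K)
      (n - tri (Z.of_nat K) + (l + Z.of_nat K) * (Z.of_nat K + 1)).
Proof.
  induction K as [|K IH]; intros l n.
  - cbn [fprod Nat.mul Nat.add Eprod]. change (tri (Z.of_nat 0)) with 0.
    unfold delta. change (Z.of_nat 0) with 0. change (Z.of_nat 1) with 1.
    repeat match goal with |- context [?a =? ?b] => destruct (Z.eqb_spec a b) end; simpl; lia.
  - rewrite !fprod_top. rewrite Z.add_0_l.
    (* The one-sided product has the factors [-K <= a <= K], renumbered from 1 to [2K + 1], so
       raising [K] adds one factor at each end. *)
    replace (2 * S K + 1)%nat with (S (S (2 * K + 1))) by lia.
    rewrite Eprod_bottom, !Eprod_unfold.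
    pose proof (IH l n) as H1.
    pose proof (IH (l - 1) (n - (Z.of_nat K + 1))) as H2.
    pose proof (IH (l + 1) (n - (Z.of_nat K + 1))) as H3.
    pose proof (IH l (n - 2 * (Z.of_nat K + 1))) as H4.
    replace (Z.of_nat (S (2 * K + 1))) with (2 * Z.of_nat K + 2) by lia.
    assert (HT : tri (Z.of_nat (S K)) = tri (Z.of_nat K) + Z.of_nat K + 1).
    { pose proof (tri_spec (Z.of_nat (S K))). pose proof (tri_spec (Z.of_nat K)). nia. }
    rewrite HT. replace (Z.of_nat (S K)) with (Z.of_nat K + 1) by lia.
    revert H1 H2 H3 H4. clear IH HT.
    set (f := fprod 0 K). set (g := Eprod (2 * K + 1)). clearbody f g.
    generalize (tri (Z.of_nat K)); intro T. generalize (Z.of_nat K); intro k.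
    clear K.
    merge_terms f. merge_terms g. intros. lia.
Qed.

(** * Enumeration of partitions and compositions *)

Open Scope nat_scope.

Lemma length_NoDup_same {A : Type} (l l' : list A) :
  NoDup l -> NoDup l' -> (forall x, In x l <-> In x l') -> length l = length l'.
Proof. intros. now apply Permutation_length, NoDup_Permutation. Qed.

Lemma NoDup_flat_map_disjoint {A B : Type} (f : A -> list B) (l : list A) :
  NoDup l -> (forall x, In x l -> NoDup (f x)) ->
  (forall x y b, In x l -> In y l -> In b (f x) -> In b (f y) -> x = y) ->
  NoDup (flat_map f l).
Proof.
  induction l as [|a l IH]; intros Hl Hf Hd; simpl; [constructor|].
  inversion Hl; subst. apply NoDup_app.
  - apply Hf; now left.
  - apply IH; auto; [intros; apply Hf; now right | intros x y b ? ?; apply Hd; now right].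
  - intros b Hb Hb'. apply in_flat_map in Hb' as [y [Hy Hby]].
    assert (a = y) by (apply (Hd a y b); auto; [now left | now right]).
    now subst.
Qed.

Lemma NoDup_map_inj {A B : Type} (f : A -> B) (l : list A) :
  (forall x y, In x l -> In y l -> f x = f y -> x = y) -> NoDup l -> NoDup (map f l).
Proof. apply FinFun.Injective_map_NoDup_in. Qed.

Lemma in_lists_len L v : forall l,
  In l (lists_len L v) <-> length l = L /\ Forall (fun x => x <= v) l.
Proof.
  induction L as [|L IH]; intros l; cbn [lists_len].
  - split.
    + intros [<-|[]]. split; auto.
    + intros [H _]. apply length_zero_iff_nil in H. subst. now left.
  - rewrite in_flat_map. split.
    + intros (x & Hx & Hl). apply in_map_iff in Hl as (l' & <- & Hl').
      apply IH in Hl' as [H1 H2]. apply in_seq in Hx. split; simpl; auto.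
      constructor; auto; lia.
    + intros [H1 H2]. destruct l as [|x l]; [discriminate|].
      inversion H2; subst. exists x. split; [apply in_seq; lia|].
      apply in_map, IH. split; auto.
Qed.

Lemma NoDup_lists_len L v : NoDup (lists_len L v).
Proof.
  induction L as [|L IH]; cbn [lists_len].
  - repeat constructor; intros [].
  - apply NoDup_flat_map_disjoint.
    + apply seq_NoDup.
    + intros x _. apply NoDup_map_inj; auto. intros a b _ _ H; now inversion H.
    + intros x y b _ _ H1 H2. apply in_map_iff in H1 as (? & <- & _).
      apply in_map_iff in H2 as (? & H2 & _). now inversion H2.
Qed.

Lemma in_lists_upto v a b : forall l,
  In l (flat_map (fun L => lists_len L v) (seq a b))
  <-> a <= length l < a + b /\ Forall (fun x => x <= v) l.
Proof.
  intros l. rewrite in_flat_map. split.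
  - intros (L & HL & Hl). apply in_lists_len in Hl as [<- H]. now apply in_seq in HL.
  - intros [H1 H2]. exists (length l). split; [now apply in_seq | now apply in_lists_len].
Qed.

Lemma NoDup_lists_upto v a b : NoDup (flat_map (fun L => lists_len L v) (seq a b)).
Proof.
  apply NoDup_flat_map_disjoint.
  - apply seq_NoDup.
  - intros; apply NoDup_lists_len.
  - intros x y l _ _ H1 H2. apply in_lists_len in H1, H2. destruct H1, H2; congruence.
Qed.

Lemma le_sumlist l : Forall (fun x => x <= sumlist l) l.
Proof.
  induction l as [|x l IH]; constructor; cbn; try lia.
  eapply Forall_impl; [|exact IH]. simpl; unfold sumlist; intros; lia.
Qed.

(* [fuel > M + n] is needed for the enumeration to be complete. *)
Fixpoint plist (fuel M n : nat) : list (list nat) :=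
  match fuel with
  | O => []
  | S f =>
    match n with
    | O => [[]]
    | _ => match M with
           | O => []
           | S M' => plist f M' n
                     ++ (if Nat.leb M n then map (cons M) (plist f M (n - M)) else [])
           end
    end
  end.

Definition bounded_partition (M n : nat) (l : list nat) : Prop :=
  sumlist l = n /\ forallb (fun x => Nat.ltb 0 x) l = true /\ nonincr l = true
  /\ Forall (fun x => x <= M) l.

Lemma nonincr_bound x l : nonincr (x :: l) = true -> Forall (fun y => y <= x) l /\ nonincr l = true.
Proof.
  revert x. induction l as [|y l IH]; intros x H; [split; auto|].
  change (Nat.leb y x && nonincr (y :: l) = true) in H.
  apply andb_true_iff in H as [H1 H2]. apply Nat.leb_le in H1. split; auto.
  apply IH in H2 as [H2 _]. constructor; auto.
  eapply Forall_impl; [|exact H2]. simpl; intros; lia.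
Qed.

Lemma nonincr_cons x l :
  Forall (fun y => y <= x) l -> nonincr l = true -> nonincr (x :: l) = true.
Proof.
  intros H1 H2. destruct l as [|y l]; auto.
  change (Nat.leb y x && nonincr (y :: l) = true). apply andb_true_iff. split; auto.
  inversion H1; now apply Nat.leb_le.
Qed.

Lemma in_plist fuel : forall M n l, M + n < fuel ->
  (In l (plist fuel M n) <-> bounded_partition M n l).
Proof.
  induction fuel as [|f IH]; intros M n l Hf; [lia|].
  cbn [plist]. destruct n as [|n].
  { split.
    - intros [<-|[]]. repeat split; auto.
    - intros (H1 & H2 & _). destruct l as [|x l]; [now left|].
      simpl in H2. apply andb_true_iff in H2 as [H2 _]. apply Nat.ltb_lt in H2.
      cbn in H1. lia. }
  destruct M as [|M].
  { split; [intros []|]. intros (H1 & H2 & _ & H4). destruct l as [|x l]; [discriminate|].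
    simpl in H2. apply andb_true_iff in H2 as [H2 _]. apply Nat.ltb_lt in H2.
    inversion H4; lia. }
  rewrite in_app_iff, IH by lia. split.
  - intros [(H1 & H2 & H3 & H4)|H].
    + repeat split; auto. eapply Forall_impl; [|exact H4]. simpl; lia.
    + destruct (Nat.leb_spec (S M) (S n)); [|destruct H].
      apply in_map_iff in H as (l' & <- & H). apply IH in H as (H1 & H2 & H3 & H4); [|lia].
      repeat split.
      * cbn. unfold sumlist in H1. lia.
      * simpl. auto.
      * now apply nonincr_cons.
      * constructor; auto.
  - intros (H1 & H2 & H3 & H4). destruct l as [|x l]; [discriminate|].
    inversion H4; subst. destruct (Nat.eq_dec x (S M)) as [->|Hx].
    + right. cbn in H1. destruct (Nat.leb_spec (S M) (S n)); [|lia].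
      apply in_map, IH; [lia|]. apply nonincr_bound in H3 as [_ H3].
      simpl in H2. repeat split; auto. unfold sumlist; lia.
    + left. repeat split; auto. apply nonincr_bound in H3 as [H3 _].
      constructor; [lia|]. eapply Forall_impl; [|exact H3]. simpl; lia.
Qed.

Lemma NoDup_plist fuel : forall M n, M + n < fuel -> NoDup (plist fuel M n).
Proof.
  induction fuel as [|f IH]; intros M n Hf; [lia|].
  cbn [plist]. destruct n as [|n]; [repeat constructor; intros []|].
  destruct M as [|M]; [constructor|].
  apply NoDup_app.
  - apply IH; lia.
  - destruct (Nat.leb_spec (S M) (S n)); [|constructor].
    apply NoDup_map_inj; [intros x y _ _ E; now inversion E | apply IH; lia].
  - intros l H1 H2. apply in_plist in H1 as (_ & _ & _ & H1); [|lia].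
    destruct (Nat.leb_spec (S M) (S n)); [|destruct H2].
    apply in_map_iff in H2 as (l' & <- & _). inversion H1; lia.
Qed.

(* Partitions of [n] into parts at most [M]; [0] for negative [n]. *)
Definition pm (M : nat) (n : Z) : Z :=
  if (n <? 0)%Z then 0%Z
  else Z.of_nat (length (plist (S (M + Z.to_nat n)) M (Z.to_nat n))).

Lemma pm_neg M n : (n < 0)%Z -> pm M n = 0%Z.
Proof. intros. unfold pm. destruct (Z.ltb_spec n 0); lia. Qed.

Lemma length_plist fuel fuel' M n : M + n < fuel -> M + n < fuel' ->
  length (plist fuel M n) = length (plist fuel' M n).
Proof.
  intros H H'. apply length_NoDup_same; try now apply NoDup_plist.
  intros l. now rewrite !in_plist.
Qed.

Lemma pm_0 n : pm 0 n = if (n =? 0)%Z then 1%Z else 0%Z.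
Proof.
  unfold pm. destruct (Z.ltb_spec n 0), (Z.eqb_spec n 0); try lia; auto.
  - subst; reflexivity.
  - destruct (Z.to_nat n) eqn:E; [lia|]. reflexivity.
Qed.

(** Valid for every integer [n] because [pm] is 0 at negative ones. [Eprod_pm] and [fourier_pm]
    identify their quantities with [pm] through this recurrence. *)
Lemma pm_S M n : pm (S M) n = (pm M n + pm (S M) (n - Z.of_nat (S M)))%Z.
Proof.
  destruct (Z.ltb_spec n 0) as [H|H]; [rewrite !pm_neg by lia; lia|].
  destruct (Z.eqb_spec n 0) as [->|Hn].
  { rewrite (pm_neg _ (0 - _)) by lia. reflexivity. }
  unfold pm at 1 2. destruct (Z.ltb_spec n 0); [lia|].
  destruct (Z.to_nat n) as [|k] eqn:E; [lia|].
  change (plist (S (S M + S k)) (S M) (S k)) with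
    (plist (S M + S k) M (S k)
     ++ (if Nat.leb (S M) (S k) then map (cons (S M)) (plist (S M + S k) (S M) (S k - S M)) else [])).
  rewrite length_app, Nat2Z.inj_add. apply f_equal2.
  - apply f_equal, length_plist; lia.
  - destruct (Nat.leb_spec (S M) (S k)).
    + rewrite length_map. unfold pm. destruct (Z.ltb_spec (n - Z.of_nat (S M)) 0); [lia|].
      f_equal. replace (Z.to_nat (n - Z.of_nat (S M))) with (S k - S M) by lia.
      apply length_plist; lia.
    + rewrite pm_neg by lia. reflexivity.
Qed.

Lemma forallb_pos_length l : forallb (fun x => Nat.ltb 0 x) l = true -> length l <= sumlist l.
Proof.
  induction l as [|x l IH]; intros H; cbn; [lia|].
  simpl in H. apply andb_true_iff in H as [H1 H2]. apply Nat.ltb_lt in H1.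
  apply IH in H2. unfold sumlist in H2. lia.
Qed.

Lemma pm_part M n : n <= M -> pm M (Z.of_nat n) = Z.of_nat (part n).
Proof.
  intros H. unfold pm. destruct (Z.ltb_spec (Z.of_nat n) 0); [lia|].
  f_equal. rewrite Nat2Z.id. apply length_NoDup_same.
  - apply NoDup_plist; lia.
  - apply NoDup_filter, NoDup_lists_upto.
  - intros l. rewrite in_plist by lia. rewrite filter_In, in_lists_upto.
    unfold is_partition_of, bounded_partition. rewrite !andb_true_iff, Nat.eqb_eq.
    split.
    + intros (H1 & H2 & H3 & _). repeat split; auto.
      * lia.
      * apply forallb_pos_length in H2. lia.
      * rewrite <- H1. apply le_sumlist.
    + intros [[_ H1] [[H2 H3] H4]]. repeat split; auto.
      eapply Forall_impl; [|exact H1]. simpl; lia.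
Qed.

(** * Strongly concave compositions as a centre with two increasing lists *)

Fixpoint pairs (c len : nat) : list (list nat * list nat) :=
  match len with
  | O => [([], [])]
  | S len' =>
      flat_map (fun p => [p; (fst p, S c :: snd p); (S c :: fst p, snd p);
                          (S c :: fst p, S c :: snd p)]) (pairs (S c) len')
  end.

Definition excess (p : list nat * list nat) : Z :=
  (Z.of_nat (length (snd p)) - Z.of_nat (length (fst p)))%Z.

Definition weight (p : list nat * list nat) : Z :=
  (Z.of_nat (sumlist (fst p)) + Z.of_nat (sumlist (snd p)))%Z.

Definition count {A : Type} (P : A -> bool) (l : list A) : Z :=
  Z.of_nat (length (filter P l)).

Lemma count_app {A : Type} (P : A -> bool) l l' :
  count P (l ++ l') = (count P l + count P l')%Z.
Proof. unfold count. rewrite filter_app, length_app. lia. Qed.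

Lemma count_cons {A : Type} (P : A -> bool) a l :
  count P (a :: l) = ((if P a then 1 else 0) + count P l)%Z.
Proof. unfold count. simpl. destruct (P a); simpl length; lia. Qed.

(** The four choices for the part [S c] in [pairs] (neither list, right, left, both) are the four
    terms of [(1 + z q^a)(1 + q^a/z)]; the exponent of [z] records right minus left parts, which is
    the rank. *)
Lemma count_pairs len : forall c l n,
  count (fun p => ((excess p =? l) && (weight p =? n))%Z) (pairs c len)
  = fprod (Z.of_nat c) len l n.
Proof.
  induction len as [|len IH]; intros c l n; cbn [pairs fprod].
  - unfold count, delta, excess, weight. cbn [filter fst snd].
    repeat match goal with |- context [(?a =? ?b)%Z] => destruct (Z.eqb_spec a b) end;
      cbn in *; lia.
  - replace (Z.of_nat c + 1)%Z with (Z.of_nat (S c)) by lia.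
    rewrite <- !IH. clear IH.
    generalize (pairs (S c) len). intros ps.
    induction ps as [|p ps IH]; [reflexivity|].
    cbn [flat_map app]. rewrite !count_cons, IH. clear IH.
    destruct p as [L R]. unfold excess, weight. cbn [fst snd].
    replace (Z.of_nat (length (S c :: R))) with (Z.of_nat (length R) + 1)%Z by (simpl length; lia).
    replace (Z.of_nat (length (S c :: L))) with (Z.of_nat (length L) + 1)%Z by (simpl length; lia).
    replace (Z.of_nat (sumlist (S c :: R))) with (Z.of_nat (sumlist R) + Z.of_nat c + 1)%Z
      by (cbn; unfold sumlist; lia).
    replace (Z.of_nat (sumlist (S c :: L))) with (Z.of_nat (sumlist L) + Z.of_nat c + 1)%Z
      by (cbn; unfold sumlist; lia).
    generalize (Z.of_nat (length R)) (Z.of_nat (length L)) (Z.of_nat (sumlist R)) (Z.of_nat (sumlist L)).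
    intros a b u v.
    assert (Hb : forall x y x' y' : Z, (x - y = x' - y' -> (x =? y) = (x' =? y'))%Z).
    { intros x y x' y' E. destruct (Z.eqb_spec x y), (Z.eqb_spec x' y'); auto; lia. }
    rewrite (Hb (a + 1 - b) l (a - b) (l - 1))%Z by lia.
    rewrite (Hb (a - (b + 1)) l (a - b) (l + 1))%Z by lia.
    rewrite (Hb (a + 1 - (b + 1)) l (a - b) l)%Z by lia.
    rewrite (Hb (v + (u + Z.of_nat c + 1)) n (v + u) (n - Z.of_nat c - 1))%Z by lia.
    rewrite (Hb (v + Z.of_nat c + 1 + u) n (v + u) (n - Z.of_nat c - 1))%Z by lia.
    rewrite (Hb (v + Z.of_nat c + 1 + (u + Z.of_nat c + 1)) n (v + u) (n - 2 * Z.of_nat c - 2))%Z by lia.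
    lia.
Qed.

(** Raising [c] while lowering [len] keeps the bound [c + len] on all parts fixed, as in [Wsum]. *)
Fixpoint comps (c len : nat) : list (nat * (list nat * list nat)) :=
  map (pair c) (pairs c len) ++ match len with O => [] | S len' => comps (S c) len' end.

Definition comp_of_rank (m n : Z) (x : nat * (list nat * list nat)) : bool :=
  ((excess (snd x) =? m) && (Z.of_nat (fst x) + weight (snd x) =? n))%Z.

Lemma count_map_pair c m n ps :
  count (comp_of_rank m n) (map (pair c) ps)
  = count (fun p => ((excess p =? m) && (weight p =? n - 1 * Z.of_nat c))%Z) ps.
Proof.
  induction ps as [|p ps IH]; [reflexivity|]. cbn [map]. rewrite !count_cons, IH.
  unfold comp_of_rank at 1. cbn [fst snd]. do 2 f_equal.
  destruct (Z.eqb_spec (Z.of_nat c + weight p) n),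
    (Z.eqb_spec (weight p) (n - 1 * Z.of_nat c)); auto; lia.
Qed.

Lemma count_comps len : forall c m n,
  count (comp_of_rank m n) (comps c len) = Wsum 1 (Z.of_nat c) len m n.
Proof.
  induction len as [|len IH]; intros c m n; cbn [comps];
    rewrite count_app, count_map_pair, count_pairs.
  - cbn [fprod Wsum]. unfold count. cbn [filter length]. lia.
  - rewrite IH, Wsum_unfold. replace (Z.of_nat (S c)) with (Z.of_nat c + 1)%Z by lia. reflexivity.
Qed.

Fixpoint incr_from (c : nat) (l : list nat) : Prop :=
  match l with
  | [] => True
  | x :: l' => c < x /\ incr_from x l'
  end.

Lemma incr_from_weaken c c' l : c <= c' -> incr_from c' l -> incr_from c l.
Proof. destruct l; simpl; auto. intros H [H1 H2]. split; auto; lia. Qed.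

Lemma incr_from_gt c l : incr_from c l -> Forall (fun x => c < x) l.
Proof.
  revert c. induction l as [|x l IH]; intros c H; constructor; destruct H; auto.
  apply IH in H0. eapply Forall_impl; [|exact H0]. simpl; lia.
Qed.

Lemma incr_from_cases c K l :
  incr_from c l /\ Forall (fun x => x <= K) l <->
  (exists l', l = S c :: l' /\ S c <= K /\ incr_from (S c) l' /\ Forall (fun x => x <= K) l')
  \/ (incr_from (S c) l /\ Forall (fun x => x <= K) l).
Proof.
  split.
  - intros [H1 H2]. destruct l as [|x l]; [right; split; simpl; auto|].
    destruct H1. inversion H2; subst. destruct (Nat.eq_dec x (S c)) as [->|].
    + left. exists l. auto.
    + right. repeat split; auto; lia.
  - intros [(l' & -> & H0 & H1 & H2)|[H1 H2]].
    + repeat split; auto.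
    + split; auto. eapply incr_from_weaken; [|exact H1]; lia.
Qed.

Lemma in_pairs len : forall c L R,
  In (L, R) (pairs c len) <->
  (incr_from c L /\ Forall (fun x => x <= c + len) L) /\
  (incr_from c R /\ Forall (fun x => x <= c + len) R).
Proof.
  induction len as [|len IH]; intros c L R.
  - assert (Hnil : forall l, incr_from c l /\ Forall (fun x => x <= c + 0) l <-> l = []).
    { intros l. split; [|intros ->; split; simpl; auto].
      intros [H1 H2]. destruct l as [|x l]; auto. destruct H1. inversion H2. lia. }
    rewrite !Hnil. cbn [pairs In]. split; [intros [E|[]]; inversion E; auto|].
    intros [-> ->]; auto.
  - rewrite (incr_from_cases c (c + S len) L), (incr_from_cases c (c + S len) R).
    cbn [pairs]. rewrite in_flat_map. replace (c + S len) with (S c + len) by lia.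
    split.
    + intros ([L' R'] & H & Hin). apply IH in H. cbn [fst snd In] in Hin.
      destruct Hin as [E|[E|[E|[E|[]]]]]; inversion E; subst; clear E;
        (split; [(right; tauto) || (left; exists L'; split; [reflexivity|split; [lia|tauto]])
                |(right; tauto) || (left; exists R'; split; [reflexivity|split; [lia|tauto]])]).
    + intros [[(L' & -> & _ & HL)|HL] [(R' & -> & _ & HR)|HR]].
      * exists (L', R'). split; [apply IH; tauto|]. cbn. auto.
      * exists (L', R). split; [apply IH; tauto|]. cbn. auto.
      * exists (L, R'). split; [apply IH; tauto|]. cbn. auto.
      * exists (L, R). split; [apply IH; tauto|]. cbn. auto.
Qed.

Lemma NoDup_pairs len : forall c, NoDup (pairs c len).
Proof.
  induction len as [|len IH]; intros c; cbn [pairs].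
  - repeat constructor; intros [].
  - assert (Hne : forall L R, In (L, R) (pairs (S c) len) ->
       (forall L', L <> S c :: L') /\ (forall R', R <> S c :: R')).
    { intros L R H. apply in_pairs in H as [[H1 _] [H2 _]].
      apply incr_from_gt in H1, H2. split; intros l' ->.
      - inversion H1; lia.
      - inversion H2; lia. }
    apply NoDup_flat_map_disjoint; auto.
    + intros [L R] H. destruct (Hne _ _ H) as [H1 H2]. cbn [fst snd].
      assert (HL : forall l : list nat, l <> S c :: l).
      { intros l E. apply (f_equal (@length nat)) in E. simpl in E. lia. }
      repeat constructor; cbn [In]; intuition;
        match goal with H : (_, _) = (_, _) |- _ => injection H; intros end;
        try (now eapply HL); try (now eapply HL; symmetry; eauto).
    + intros [L R] [L' R'] [A B] H H' Hi Hi'.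
      destruct (Hne _ _ H) as [H1 H2]. destruct (Hne _ _ H') as [H1' H2'].
      cbn [fst snd In] in Hi, Hi'.
      destruct Hi as [E|[E|[E|[E|[]]]]]; injection E; intros; subst; clear E;
      destruct Hi' as [E|[E|[E|[E|[]]]]]; injection E; intros; subst; try reflexivity;
        try (exfalso; (now eapply H1; reflexivity) || (now eapply H2; reflexivity)
           || (now eapply H1'; reflexivity) || (now eapply H2'; reflexivity)
           || (now eapply H1; eauto) || (now eapply H2; eauto)).
Qed.

Lemma in_comps len : forall c d L R,
  In (d, (L, R)) (comps c len) <->
  c <= d <= c + len /\
  (incr_from d L /\ Forall (fun x => x <= c + len) L) /\
  (incr_from d R /\ Forall (fun x => x <= c + len) R).
Proof.
  induction len as [|len IH]; intros c d L R; cbn [comps]; rewrite in_app_iff, in_map_iff.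
  - split.
    + intros [([L' R'] & E & H)|[]]. injection E; intros; subst.
      apply in_pairs in H. split; [lia|auto].
    + intros [H1 H2]. left. exists (L, R). assert (d = c) by lia. subst.
      split; auto. now apply in_pairs.
  - rewrite IH. replace (S c + len) with (c + S len) by lia. split.
    + intros [([L' R'] & E & H)|[H1 H2]].
      * injection E; intros; subst. apply in_pairs in H. split; [lia|auto].
      * split; auto; lia.
    + intros [H1 H2]. destruct (Nat.eq_dec d c) as [->|].
      * left. exists (L, R). split; auto. now apply in_pairs.
      * right. split; auto; lia.
Qed.

Lemma NoDup_comps len : forall c, NoDup (comps c len).
Proof.
  induction len as [|len IH]; intros c; cbn [comps].
  - rewrite app_nil_r. apply NoDup_map_inj; [intros x y _ _ E; now injection E | apply NoDup_pairs].
  - apply NoDup_app; auto.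
    + apply NoDup_map_inj; [intros x y _ _ E; now injection E | apply NoDup_pairs].
    + intros [d [L R]] H1 H2. apply in_map_iff in H1 as (p & E & _).
      injection E; intros; subst. apply in_comps in H2. lia.
Qed.

(* [(c, (L, R))] stands for the composition with central part [c]; [L] lists the parts to its left
   from the centre outwards. *)
Definition tolist (x : nat * (list nat * list nat)) : list nat :=
  rev (fst (snd x)) ++ fst x :: snd (snd x).

Lemma incr_from_nth c l :
  incr_from c l <-> forall i, i < length l -> nth i (c :: l) 0 < nth (S i) (c :: l) 0.
Proof.
  revert c. induction l as [|x l IH]; intros c.
  - split; simpl; auto. intros; lia.
  - cbn [incr_from]. rewrite IH. split.
    + intros [H1 H2] [|i] Hi; [exact H1|]. simpl in Hi. apply (H2 i). lia.
    + intros H. split; [apply (H 0); simpl; lia|].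
      intros i Hi. apply (H (S i)). simpl; lia.
Qed.

Lemma nth_tolist_left c L R i :
  i <= length L -> nth i (rev L ++ c :: R) 0 = nth (length L - i) (c :: L) 0.
Proof.
  intros H. destruct (Nat.eq_dec i (length L)) as [->|Hi].
  - rewrite app_nth2 by (rewrite length_rev; lia). rewrite length_rev, Nat.sub_diag. reflexivity.
  - rewrite app_nth1 by (rewrite length_rev; lia). rewrite rev_nth by lia.
    replace (length L - i) with (S (length L - S i)) by lia. reflexivity.
Qed.

Lemma nth_tolist_right c L R i :
  nth (length L + i) (rev L ++ c :: R) 0 = nth i (c :: R) 0.
Proof.
  rewrite app_nth2 by (rewrite length_rev; lia). rewrite length_rev. f_equal. lia.
Qed.

Lemma length_tolist (c : nat) L R : length (rev L ++ c :: R) = length L + S (length R).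
Proof. rewrite length_app, length_rev. reflexivity. Qed.

Lemma concave_at_iff c L R :
  concave_at (rev L ++ c :: R) (length L) = true <-> incr_from c L /\ incr_from c R.
Proof.
  unfold concave_at. rewrite andb_true_iff, !forallb_forall, length_tolist, !incr_from_nth.
  split; intros [H1 H2]; split.
  - intros i Hi. assert (Hin : In (length L - S i) (seq 0 (length L))) by (apply in_seq; lia).
    specialize (H1 _ Hin). apply Nat.ltb_lt in H1.
    rewrite !nth_tolist_left in H1 by lia.
    replace (length L - S (length L - S i)) with i in H1 by lia.
    replace (length L - (length L - S i)) with (S i) in H1 by lia. exact H1.
  - intros i Hi.
    assert (Hin : In (length L + i) (seq (length L) (length L + S (length R) - 1 - length L)))
      by (apply in_seq; lia).
    specialize (H2 _ Hin). apply Nat.ltb_lt in H2. rewrite <- Nat.add_succ_r in H2.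
    now rewrite !nth_tolist_right in H2.
  - intros i Hi. apply in_seq in Hi. apply Nat.ltb_lt.
    rewrite !nth_tolist_left by lia.
    replace (length L - i) with (S (length L - S i)) by lia. apply H1. lia.
  - intros i Hi. apply in_seq in Hi. apply Nat.ltb_lt.
    replace i with (length L + (i - length L)) by lia.
    rewrite <- Nat.add_succ_r, !nth_tolist_right. apply H2. lia.
Qed.

Lemma split_at (l : list nat) kk : kk < length l ->
  exists c L R, l = rev L ++ c :: R /\ length L = kk.
Proof.
  intros H. destruct (nth_split l 0 H) as (l1 & l2 & E & Hl).
  exists (nth kk l 0), (rev l1), l2. rewrite rev_involutive, length_rev. auto.
Qed.

(** At the smaller of two central indices the list would both rise and fall. This makes the rank
    well defined and the encoding [tolist] injective, so that the rank counts add up to the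
    total. *)
Lemma concave_at_unique l kk kk' : kk < length l -> kk' < length l ->
  concave_at l kk = true -> concave_at l kk' = true -> kk = kk'.
Proof.
  assert (W : forall a b, a < b -> a < length l -> b < length l ->
    concave_at l a = true -> concave_at l b = true -> False).
  { intros a b Hab Ha Hb H1 H2. unfold concave_at in *.
    apply andb_true_iff in H1 as [_ H1]. apply andb_true_iff in H2 as [H2 _].
    rewrite forallb_forall in H1, H2.
    specialize (H1 a). specialize (H2 a). rewrite in_seq, Nat.ltb_lt in H1, H2. lia. }
  intros. destruct (lt_eq_lt_dec kk kk') as [[]|]; auto; exfalso; eauto.
Qed.

Definition valid (x : nat * (list nat * list nat)) : Prop :=
  incr_from (fst x) (fst (snd x)) /\ incr_from (fst x) (snd (snd x)).

Lemma tolist_inj x y : valid x -> valid y -> tolist x = tolist y -> x = y.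
Proof.
  destruct x as [c [L R]], y as [c' [L' R']]. unfold valid, tolist. cbn [fst snd].
  intros Hx Hy E. apply concave_at_iff in Hx, Hy. rewrite E in Hx.
  assert (HL : length L = length L').
  { eapply concave_at_unique; [| |exact Hx|exact Hy]; [rewrite <- E|]; rewrite length_tolist; lia. }
  assert (E' : rev L = rev L' /\ c :: R = c' :: R').
  { assert (Hr : length (rev L) = length (rev L')) by (rewrite !length_rev; auto).
    revert E Hr. generalize (rev L) (rev L'). induction l as [|a l IH]; intros [|a' l'] E Hr;
      try discriminate; auto.
    simpl in E. injection E; intros E2 ->. injection Hr; intros Hr'.
    destruct (IH _ E2 Hr') as [-> ?]. auto. }
  destruct E' as [E1 E2]. injection E2; intros; subst.
  apply (f_equal (@rev nat)) in E1. rewrite !rev_involutive in E1. now subst.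
Qed.

Lemma sumlist_app l l' : sumlist (l ++ l') = sumlist l + sumlist l'.
Proof. induction l; cbn; auto. unfold sumlist in *. lia. Qed.

Lemma sumlist_rev l : sumlist (rev l) = sumlist l.
Proof. induction l; cbn; auto. rewrite sumlist_app, IHl. cbn. unfold sumlist. lia. Qed.

Lemma sumlist_tolist x :
  Z.of_nat (sumlist (tolist x)) = (Z.of_nat (fst x) + weight (snd x))%Z.
Proof.
  unfold tolist, weight. rewrite sumlist_app, sumlist_rev. cbn. unfold sumlist. lia.
Qed.

Lemma rank_at_tolist x :
  rank_at (tolist x) (length (fst (snd x))) = excess (snd x).
Proof. unfold rank_at, tolist, excess. rewrite length_tolist. lia. Qed.

Lemma incr_from_length c l : incr_from c l -> length l <= sumlist l.
Proof.
  intros H. apply incr_from_gt in H. apply forallb_pos_length, forallb_forall.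
  intros x Hx. rewrite Forall_forall in H. apply H in Hx. apply Nat.ltb_lt. lia.
Qed.

Lemma valid_in_comps K x : valid x -> sumlist (tolist x) <= K -> In x (comps 0 K).
Proof.
  destruct x as [c [L R]]. intros [H1 H2] HK. cbn [fst snd] in *.
  unfold tolist in HK. cbn [fst snd] in HK.
  assert (Hall : Forall (fun a => a <= K) (rev L ++ c :: R)).
  { eapply Forall_impl; [|apply le_sumlist]. simpl; intros; lia. }
  apply Forall_app in Hall as [Ha Hb]. inversion Hb; subst. apply Forall_rev in Ha.
  rewrite rev_involutive in Ha. apply in_comps. repeat split; auto; lia.
Qed.

Lemma valid_in_cand n x : valid x -> sumlist (tolist x) = n -> In (tolist x) (cand_scc n).
Proof.
  intros [H1 H2] Hn. apply in_lists_upto. split.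
  - unfold tolist. rewrite length_tolist.
    apply incr_from_length in H1, H2. unfold tolist in Hn.
    rewrite sumlist_app, sumlist_rev in Hn. cbn in Hn. unfold sumlist in *. lia.
  - eapply Forall_impl; [|apply le_sumlist]. simpl; intros; lia.
Qed.

Lemma in_comps_valid K x : In x (comps 0 K) -> valid x.
Proof. destruct x as [c [L R]]. intros H. apply in_comps in H. split; simpl; tauto. Qed.

(** No part exceeds [n], so the cut-off at [K] loses nothing; with [K] free, a single [K] can serve
    both counts in the recurrence. *)
Lemma Vd_rank_Wsum K n m : n <= K ->
  Z.of_nat (Vd_rank m n) = Wsum 1 0 K m (Z.of_nat n).
Proof.
  intros HK. change 0%Z with (Z.of_nat 0). rewrite <- count_comps. unfold count, Vd_rank.
  f_equal. rewrite <- (length_map tolist). apply length_NoDup_same.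
  - apply NoDup_filter, NoDup_lists_upto.
  - apply NoDup_map_inj; [|apply NoDup_filter, NoDup_comps].
    intros x y Hx Hy. apply filter_In in Hx as [Hx _]. apply filter_In in Hy as [Hy _].
    apply tolist_inj; eapply in_comps_valid; eassumption.
  - intros l. rewrite filter_In, in_map_iff. unfold is_scc_rank.
    rewrite !andb_true_iff, Nat.eqb_eq, existsb_exists. split.
    + intros (Hl & Hs & _ & kk & Hkk & Hc). apply andb_true_iff in Hc as [Hc Hr].
      apply in_seq in Hkk. destruct (split_at l kk) as (c & L & R & E & HL); [lia|].
      subst kk. exists (c, (L, R)). split; auto.
      assert (Hv : valid (c, (L, R))) by (apply concave_at_iff; cbn [fst snd]; now rewrite <- E).
      assert (E' : l = tolist (c, (L, R))) by exact E.
      apply filter_In. split.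
      * apply valid_in_comps; auto. rewrite <- E'. lia.
      * unfold comp_of_rank. rewrite <- sumlist_tolist, <- E', <- rank_at_tolist, <- E'.
        cbn [fst snd]. rewrite Hr. apply Z.eqb_eq. lia.
    + intros (x & <- & Hx). apply filter_In in Hx as [Hx Hp].
      unfold comp_of_rank in Hp. rewrite <- sumlist_tolist in Hp.
      apply andb_true_iff in Hp as [Hp Hs]. apply Z.eqb_eq in Hs. apply Nat2Z.inj in Hs.
      apply in_comps_valid in Hx.
      split; [now apply valid_in_cand|]. split; auto.
      split; [apply Nat.ltb_lt; unfold tolist; rewrite length_tolist; lia|].
      exists (length (fst (snd x))). split.
      * apply in_seq. unfold tolist. rewrite length_tolist. lia.
      * rewrite rank_at_tolist, Hp, andb_true_r. now apply concave_at_iff.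
Qed.

Lemma Vd_count n :
  Vd n = length (filter (fun x => (Z.of_nat (fst x) + weight (snd x) =? Z.of_nat n)%Z) (comps 0 n)).
Proof.
  unfold Vd. rewrite <- (length_map tolist (filter _ (comps 0 n))). apply length_NoDup_same.
  - apply NoDup_filter, NoDup_lists_upto.
  - apply NoDup_map_inj; [|apply NoDup_filter, NoDup_comps].
    intros x y Hx Hy. apply filter_In in Hx as [Hx _]. apply filter_In in Hy as [Hy _].
    apply tolist_inj; eapply in_comps_valid; eassumption.
  - intros l. rewrite filter_In, in_map_iff. unfold is_scc.
    rewrite !andb_true_iff, Nat.eqb_eq, existsb_exists. split.
    + intros (Hl & Hs & _ & kk & Hkk & Hc).
      apply in_seq in Hkk. destruct (split_at l kk) as (c & L & R & E & HL); [lia|].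
      subst kk. exists (c, (L, R)). split; auto.
      assert (Hv : valid (c, (L, R))) by (apply concave_at_iff; cbn [fst snd]; now rewrite <- E).
      assert (E' : l = tolist (c, (L, R))) by exact E.
      apply filter_In. split.
      * apply valid_in_comps; auto. rewrite <- E'. lia.
      * rewrite <- sumlist_tolist, <- E'. apply Z.eqb_eq. lia.
    + intros (x & <- & Hx). apply filter_In in Hx as [Hx Hs].
      rewrite <- sumlist_tolist in Hs. apply Z.eqb_eq in Hs. apply Nat2Z.inj in Hs.
      apply in_comps_valid in Hx.
      split; [now apply valid_in_cand|]. split; auto.
      split; [apply Nat.ltb_lt; unfold tolist; rewrite length_tolist; lia|].
      exists (length (fst (snd x))). split.
      * apply in_seq. unfold tolist. rewrite length_tolist. lia.
      * now apply concave_at_iff.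
Qed.

Fixpoint zsum (f : nat -> Z) (n : nat) : Z :=
  match n with O => 0%Z | S n' => (zsum f n' + f n')%Z end.

Lemma zsum_plus f g n : zsum (fun i => f i + g i)%Z n = (zsum f n + zsum g n)%Z.
Proof. induction n; simpl; lia. Qed.

Lemma zsum_zero n : zsum (fun _ => 0%Z) n = 0%Z.
Proof. induction n; simpl; lia. Qed.

Lemma zsum_indicator (k : Z) (a : Z) n : (a <= k < a + Z.of_nat n)%Z ->
  zsum (fun i => if (k =? a + Z.of_nat i)%Z then 1%Z else 0%Z) n = 1%Z.
Proof.
  intros H. assert (G : forall n, zsum (fun i => if (k =? a + Z.of_nat i)%Z then 1%Z else 0%Z) n
     = if (a <=? k)%Z && (k <? a + Z.of_nat n)%Z then 1%Z else 0%Z).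
  { clear. induction n; cbn [zsum]; [|rewrite IHn];
    repeat match goal with
    | |- context [(?x <=? ?y)%Z] => destruct (Z.leb_spec x y)
    | |- context [(?x <? ?y)%Z] => destruct (Z.ltb_spec x y)
    | |- context [(?x =? ?y)%Z] => destruct (Z.eqb_spec x y)
    end; simpl; lia. }
  rewrite G. destruct (Z.leb_spec a k), (Z.ltb_spec k (a + Z.of_nat n)); simpl; lia.
Qed.

Lemma zsum_ext f g n : (forall i, i < n -> f i = g i) -> zsum f n = zsum g n.
Proof.
  induction n; intros H; cbn [zsum]; auto. rewrite IHn, H by (auto; intros; apply H; lia). auto.
Qed.

Lemma Vd_sum_ranks n :
  Z.of_nat (Vd n)
  = zsum (fun i => Z.of_nat (Vd_rank (Z.of_nat i - Z.of_nat n) n)) (2 * n + 1).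
Proof.
  rewrite Vd_count.
  rewrite (zsum_ext _ (fun i => count (comp_of_rank (Z.of_nat i - Z.of_nat n) (Z.of_nat n)) (comps 0 n)))
    by (intros; rewrite count_comps, (Vd_rank_Wsum n); auto).
  (* All parts except the centre are positive, so there are at most [n] of them and the rank lies
     between [-n] and [n]. *)
  assert (Hb : forall x, In x (comps 0 n) ->
    (Z.of_nat (fst x) + weight (snd x) = Z.of_nat n)%Z ->
    (- Z.of_nat n <= excess (snd x) < - Z.of_nat n + Z.of_nat (2 * n + 1))%Z).
  { intros [c [L R]] Hx Hw. apply in_comps_valid in Hx as [H1 H2]. cbn [fst snd] in *.
    apply incr_from_length in H1, H2. unfold weight, excess in *. cbn [fst snd] in *. lia. }
  change (count (fun x => (Z.of_nat (fst x) + weight (snd x) =? Z.of_nat n)%Z) (comps 0 n)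
    = zsum (fun i => count (comp_of_rank (Z.of_nat i - Z.of_nat n) (Z.of_nat n)) (comps 0 n)) (2 * n + 1)).
  revert Hb. generalize (comps 0 n). intros ps Hb. induction ps as [|x ps IH].
  - symmetry. apply zsum_zero.
  - rewrite count_cons, IH by (intros; apply Hb; auto; now right).
    rewrite (zsum_ext (fun i => count (comp_of_rank (Z.of_nat i - Z.of_nat n) (Z.of_nat n)) (x :: ps))
      (fun i => (if comp_of_rank (Z.of_nat i - Z.of_nat n) (Z.of_nat n) x then 1 else 0)
       + count (comp_of_rank (Z.of_nat i - Z.of_nat n) (Z.of_nat n)) ps)%Z) by (intros; apply count_cons).
    rewrite zsum_plus. f_equal. unfold comp_of_rank.
    destruct (Z.eqb_spec (Z.of_nat (fst x) + weight (snd x)) (Z.of_nat n)) as [E|E].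
    + etransitivity; [symmetry; apply (zsum_indicator (excess (snd x)) (- Z.of_nat n) (2 * n + 1));
        apply Hb; auto; now left|].
      apply zsum_ext. intros i _. rewrite andb_true_r.
      replace (Z.of_nat i - Z.of_nat n)%Z with (- Z.of_nat n + Z.of_nat i)%Z by lia. reflexivity.
    + rewrite (zsum_ext _ (fun _ => 0%Z)) by (intros; now rewrite andb_false_r).
      symmetry. apply zsum_zero.
Qed.

(** * The coefficients of the triple product and the rank recurrence *)

Open Scope Z_scope.

Lemma Eprod_gt L : forall k n, Z.of_nat L < k -> Eprod L k n = 0.
Proof.
  induction L as [|L IH]; intros k n H.
  - cbn [Eprod]. unfold delta. destruct (Z.eqb_spec k 0); simpl; lia.
  - rewrite Eprod_unfold, !IH by lia. lia.
Qed.

Lemma Eprod_neg L : forall k n, k < 0 -> Eprod L k n = 0.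
Proof.
  induction L as [|L IH]; intros k n H.
  - cbn [Eprod]. unfold delta. destruct (Z.eqb_spec k 0); simpl; lia.
  - rewrite Eprod_unfold, !IH by lia. lia.
Qed.

Lemma tri_succ x : tri (x + 1) = tri x + x + 1.
Proof. pose proof (tri_spec x). pose proof (tri_spec (x + 1)). lia. Qed.

(** Only taking [z q^a] from every factor reaches the top degree in [z], and it has exponent
    [tri k]. *)
Lemma Eprod_full k : forall n, Eprod k (Z.of_nat k) (n + tri (Z.of_nat k)) = pm 0 n.
Proof.
  induction k as [|k IH]; intros n.
  - rewrite pm_0. cbn [Eprod]. change (tri (Z.of_nat 0)) with 0. unfold delta. simpl.
    rewrite Z.add_0_r. reflexivity.
  - rewrite Eprod_unfold, Eprod_gt by lia. rewrite <- IH, Z.add_0_l.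
    replace (Z.of_nat (S k)) with (Z.of_nat k + 1) by lia. rewrite tri_succ.
    f_equal; lia.
Qed.

(* A k-subset of {1,...,M+k} is a staircase plus a partition in a k x M box, and the
   box height is no restriction once k >= n. *)
Lemma Eprod_pm M : forall k n, n <= Z.of_nat k ->
  Eprod (M + k) (Z.of_nat k) (n + tri (Z.of_nat k)) = pm M n.
Proof.
  induction M as [|M IHM]; [intros; apply Eprod_full|].
  induction k as [|k IHk]; intros n Hn.
  - rewrite Nat.add_0_r, Eprod_unfold, (Eprod_neg M (Z.of_nat 0 - 1)) by lia.
    specialize (IHM 0%nat n Hn). rewrite Nat.add_0_r in IHM. rewrite IHM, pm_S.
    rewrite (pm_neg _ (n - _)) by lia. reflexivity.
  - replace (S M + S k)%nat with (S (M + S k)) by lia.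
    rewrite Eprod_unfold, IHM by auto. rewrite pm_S. f_equal.
    rewrite <- IHk by lia. replace (S M + k)%nat with (M + S k)%nat by lia.
    replace (Z.of_nat (S k) - 1) with (Z.of_nat k) by lia. f_equal.
    replace (Z.of_nat (S k)) with (Z.of_nat k + 1) by lia. rewrite tri_succ. lia.
Qed.

Definition pz (n : Z) : Z := if n <? 0 then 0 else Z.of_nat (part (Z.to_nat n)).

Lemma pm_pz M n : n <= Z.of_nat M -> pm M n = pz n.
Proof.
  intros H. unfold pz. destruct (Z.ltb_spec n 0); [now apply pm_neg|].
  rewrite <- (pm_part M) by lia. f_equal. lia.
Qed.

(** This is the coefficient of [(1 + z) f_0], a single partition number. The box of [Eprod_pm] has
    sides [k = K + l] and [M = K + 1 - l], and the bound on [n + |l|] ensures that neither side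
    restricts the partitions. *)
Lemma fprod_half K l n : n + Z.abs l <= Z.of_nat K -> 0 <= tri (l - 1) ->
  fprod 0 K l n + fprod 0 K (l - 1) n = pz (n - tri (l - 1)).
Proof.
  intros H Ht. destruct (Z.ltb_spec n 0).
  { rewrite !fprod_neg by lia. unfold pz. destruct (Z.ltb_spec (n - tri (l - 1)) 0); lia. }
  rewrite fprod_Eprod.
  set (k := Z.to_nat (l + Z.of_nat K)). set (M := Z.to_nat (Z.of_nat K + 1 - l)).
  replace (2 * K + 1)%nat with (M + k)%nat by (subst k M; lia).
  replace (l + Z.of_nat K) with (Z.of_nat k) by (subst k; lia).
  rewrite <- (pm_pz M) by (subst M; lia).
  rewrite <- (Eprod_pm M k) by (subst k; lia). f_equal.
  assert (Hl : l = Z.of_nat k - Z.of_nat K) by (subst k; lia). rewrite Hl.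
  pose proof (tri_spec (Z.of_nat k - Z.of_nat K - 1)). pose proof (tri_spec (Z.of_nat K)).
  pose proof (tri_spec (Z.of_nat k)). lia.
Qed.

(** The factor of [f_(-1)] at [a = 0] is [(1 + z)(1 + 1/z)], so the coefficient is the sum of those
    of [(1 + z) f_0] at [l] and at [l + 1]. *)
Lemma jacobi_triple_coefficient K l n : n + Z.abs l + 1 <= Z.of_nat K ->
  fprod (-1) (S K) l n = pz (n - tri l) + pz (n - tri (l - 1)).
Proof.
  intros H.
  assert (Ht : forall x, 0 <= tri x) by (intros x; pose proof (tri_spec x); nia).
  cbn [fprod]. change (-1 + 1) with 0.
  pose proof (fprod_half K l n ltac:(lia) (Ht _)) as H1.
  pose proof (fprod_half K (l + 1) n ltac:(lia) (Ht _)) as H2.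
  replace (l + 1 - 1) with l in H2 by lia.
  replace (n - -1 - 1) with n by lia. replace (n - 2 * -1 - 2) with n by lia. lia.
Qed.

(* [az l n] is [V(l, n + l(l+1)/2)], and [0] for negative [n]. *)
Definition az (l : nat) (n : Z) : Z :=
  if n <? 0 then 0
  else Z.of_nat (Vd_rank (Z.of_nat l) (Z.to_nat (n + tri (Z.of_nat l)))).

Lemma tri_nonneg x : 0 <= tri x.
Proof. pose proof (tri_spec x). nia. Qed.

(** Rank [l] requires at least [|l|] distinct parts above [c] on one side, and the lightest choice
    weighs [|l| c + tri |l|]. *)
Lemma fprod_min len : forall c l n, 0 <= c -> n < Z.abs l * c + tri (Z.abs l) ->
  fprod c len l n = 0.
Proof.
  induction len as [|len IH]; intros c l n Hc Hn; cbn [fprod].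
  - unfold delta. destruct (Z.eqb_spec l 0), (Z.eqb_spec n 0); simpl; auto. subst.
    change (tri (Z.abs 0)) with 0 in Hn. lia.
  - pose proof (tri_spec (Z.abs l)). pose proof (tri_nonneg (Z.abs l)).
    assert (Hstep : forall x, Z.abs l - 1 <= Z.abs x -> fprod (c + 1) len x (n - c - 1) = 0).
    { intros x Hx. apply IH; [lia|]. pose proof (tri_spec (Z.abs x)). nia. }
    rewrite (IH _ l n), (IH _ l (n - 2 * c - 2)), !Hstep by nia. lia.
Qed.

(** This justifies the value 0 of [az] at negative arguments: no composition of that rank is so
    light. *)
Lemma Wsum_min len : forall c l n, 0 <= c -> n < tri (Z.abs l) -> Wsum 1 c len l n = 0.
Proof.
  induction len as [|len IH]; intros c l n Hc Hn.
  - cbn [Wsum]. apply (fprod_min 0 0); lia.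
  - rewrite Wsum_unfold, IH, fprod_min by nia. lia.
Qed.

Lemma az_recurrence l n : 0 <= n ->
  az l n = pz n - pz (n - 2 * Z.of_nat l - 4) + az (l + 4) (n - 3 * Z.of_nat l - 8).
Proof.
  intros Hn. set (L := Z.of_nat l).
  (* The four-step relation is applied at rank [L + 2] to join the ranks [L] and [L + 4]; this [m]
     satisfies [m - (L + 2) = n + tri L]. *)
  set (m := n + tri L + L + 2).
  set (K := Z.to_nat (m + L + 10)).
  pose proof (tri_nonneg L) as HT.
  assert (HT4 : tri (L + 4) = tri L + 4 * L + 10)
    by (pose proof (tri_spec L); pose proof (tri_spec (L + 4)); lia).
  assert (HT3 : tri (L + 3) = tri L + 3 * L + 6)
    by (pose proof (tri_spec L); pose proof (tri_spec (L + 3)); lia).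
  assert (HT2 : tri (L + 2) = tri L + 2 * L + 3)
    by (pose proof (tri_spec L); pose proof (tri_spec (L + 2)); lia).
  assert (HT1 : tri (L + 1) = tri L + L + 1)
    by (pose proof (tri_spec L); pose proof (tri_spec (L + 1)); lia).
  pose proof (Wsum_four_step K (L + 2) m ltac:(lia) ltac:(lia)) as H.
  rewrite !jacobi_triple_coefficient in H by lia.
  replace (L + 2 + 2) with (L + 4) in H by lia. replace (L + 2 - 2) with L in H by lia.
  replace (L + 2 + 1) with (L + 3) in H by lia. replace (L + 3 - 1) with (L + 2) in H by lia.
  replace (L + 2 - 1) with (L + 1) in H by lia. replace (L + 1 - 1) with L in H by lia.
  replace (m - (L + 2)) with (n + tri L) in H by (subst m; lia).
  replace (n + tri L - tri L) with n in H by lia.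
  replace (m - tri (L + 3)) with (n - 2 * L - 4) in H by (subst m; lia).
  (* Both sides equal [n - L - 1]: two of the four partition terms cancel. *)
  replace (n + tri L - tri (L + 1)) with (m - tri (L + 2)) in H by (subst m; lia).
  assert (E1 : az l n = Wsum 1 0 K L (n + tri L)).
  { unfold az. destruct (Z.ltb_spec n 0); [lia|]. fold L.
    rewrite (Vd_rank_Wsum K) by (subst K m; lia). f_equal. lia. }
  assert (E2 : az (l + 4) (n - 3 * L - 8) = Wsum 1 0 K (L + 4) m).
  { unfold az. replace (Z.of_nat (l + 4)) with (L + 4) by (subst L; lia).
    destruct (Z.ltb_spec (n - 3 * L - 8) 0).
    - symmetry. apply Wsum_min; [lia|]. replace (Z.abs (L + 4)) with (L + 4) by lia. subst m; lia.
    - rewrite (Vd_rank_Wsum K) by (subst K m; lia). f_equal. subst m; lia. }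
  lia.
Qed.

Lemma Vd_rank_az m n :
  Z.of_nat (Vd_rank m n) = az (Z.abs_nat m) (Z.of_nat n - tri (Z.abs m)).
Proof.
  assert (E : Z.of_nat (Vd_rank m n) = Wsum 1 0 n (Z.abs m) (Z.of_nat n)).
  { rewrite (Vd_rank_Wsum n) by lia. destruct (Z.abs_eq_or_opp m) as [->| ->]; auto.
    now rewrite Wsum_sym. }
  unfold az. rewrite Zabs2Nat.id_abs.
  destruct (Z.ltb_spec (Z.of_nat n - tri (Z.abs m)) 0).
  - rewrite E. apply Wsum_min; [lia|]. rewrite Z.abs_idemp. lia.
  - replace (Z.to_nat (Z.of_nat n - tri (Z.abs m) + tri (Z.abs m))) with n by lia.
    now rewrite E, (Vd_rank_Wsum n) by lia.
Qed.

Lemma az_neg l n : n < 0 -> az l n = 0.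
Proof. intros. unfold az. destruct (Z.ltb_spec n 0); lia. Qed.

(** * Finite sums and the Basel problem *)

Open Scope R_scope.

Fixpoint rsum (f : nat -> R) (n : nat) : R :=
  match n with O => 0 | S n' => rsum f n' + f n' end.

Lemma rsum_ext f g n : (forall i, (i < n)%nat -> f i = g i) -> rsum f n = rsum g n.
Proof. induction n; intros H; simpl; auto. rewrite IHn, H by (auto; intros; apply H; lia). auto. Qed.

Lemma rsum_le f g n : (forall i, (i < n)%nat -> f i <= g i) -> rsum f n <= rsum g n.
Proof.
  induction n; intros H; simpl; [lra|]. apply Rplus_le_compat; [apply IHn; intros; apply H|apply H]; lia.
Qed.

Lemma rsum_plus f g n : rsum (fun i => f i + g i) n = rsum f n + rsum g n.
Proof. induction n; simpl; [lra|rewrite IHn; lra]. Qed.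

Lemma rsum_minus f g n : rsum (fun i => f i - g i) n = rsum f n - rsum g n.
Proof. induction n; simpl; [lra|rewrite IHn; lra]. Qed.

Lemma rsum_scal c f n : rsum (fun i => c * f i) n = c * rsum f n.
Proof. induction n; simpl; [lra|rewrite IHn; lra]. Qed.

Lemma rsum_const c n : rsum (fun _ => c) n = INR n * c.
Proof. induction n; [simpl; lra|]. rewrite S_INR. cbn [rsum]. rewrite IHn. lra. Qed.

Lemma rsum_nonneg f n : (forall i, (i < n)%nat -> 0 <= f i) -> 0 <= rsum f n.
Proof. intros H. pose proof (rsum_le (fun _ => 0) f n H). rewrite rsum_const in *. lra. Qed.

Lemma rsum_abs f n : Rabs (rsum f n) <= rsum (fun i => Rabs (f i)) n.
Proof.
  induction n; simpl; [rewrite Rabs_R0; lra|]. eapply Rle_trans; [apply Rabs_triang|]. lra.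
Qed.

Lemma rsum_shift f n : rsum f (S n) = f O + rsum (fun i => f (S i)) n.
Proof. induction n; [simpl; lra|]. change (rsum f (S n) + f (S n) = f O + (rsum (fun i => f (S i)) n + f (S n))). rewrite IHn; lra. Qed.

Lemma rsum_app f m n : rsum f (m + n) = rsum f m + rsum (fun i => f (m + i)%nat) n.
Proof.
  induction n; simpl; [rewrite Nat.add_0_r; lra|].
  rewrite Nat.add_succ_r. simpl. rewrite IHn. lra.
Qed.

Lemma rsum_mono f m n : (m <= n)%nat -> (forall i, 0 <= f i) -> rsum f m <= rsum f n.
Proof.
  intros H Hf. replace n with (m + (n - m))%nat by lia. rewrite rsum_app.
  pose proof (rsum_nonneg (fun i => f (m + i)%nat) (n - m) (fun i _ => Hf _)). lra.
Qed.

Lemma rsum_rev f n : rsum f n = rsum (fun k => f (n - 1 - k)%nat) n.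
Proof.
  revert f. induction n; intros f; [reflexivity|].
  rewrite rsum_shift, IHn. cbn [rsum]. rewrite Rplus_comm. f_equal.
  - apply rsum_ext. intros i Hi. f_equal. lia.
  - f_equal. lia.
Qed.

Lemma rsum_fold f m : rsum f (2 * m) = rsum (fun k => f k + f (2 * m - 1 - k)%nat) m.
Proof.
  rewrite rsum_plus. replace (2 * m)%nat with (m + m)%nat by lia. rewrite rsum_app. f_equal.
  rewrite rsum_rev. apply rsum_ext. intros. f_equal. lia.
Qed.

Lemma rsum_exchange f m n :
  rsum (fun i => rsum (fun j => f i j) n) m = rsum (fun j => rsum (fun i => f i j) m) n.
Proof.
  induction m; simpl.
  - rewrite rsum_const. lra.
  - rewrite IHm, <- rsum_plus. reflexivity.
Qed.

Lemma exp_le_compat a b : a <= b -> exp a <= exp b.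
Proof. intros [H|H]; [left; now apply exp_increasing|right; now rewrite H]. Qed.

Lemma derive_nonneg_incr (f df : R -> R) (a b : R) :
  a <= b -> (forall x, a <= x <= b -> is_derive f x (df x)) ->
  (forall x, a <= x <= b -> 0 <= df x) -> f a <= f b.
Proof.
  intros Hab Hd Hp.
  destruct (MVT_gen f a b df) as [c [Hc E]].
  - intros x Hx. rewrite Rmin_left, Rmax_right in Hx by lra. apply Hd. lra.
  - intros x Hx. rewrite Rmin_left, Rmax_right in Hx by lra.
    apply continuity_pt_filterlim. apply (ex_derive_continuous f x). exists (df x). apply Hd. lra.
  - rewrite Rmin_left, Rmax_right in Hc by lra.
    pose proof (Hp c Hc). nra.
Qed.

Lemma x_cos_le_sin x : 0 <= x <= PI -> x * cos x <= sin x.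
Proof.
  intros H.
  assert (sin 0 - 0 * cos 0 <= sin x - x * cos x); [|rewrite sin_0 in *; lra].
  apply (derive_nonneg_incr (fun x => sin x - x * cos x) (fun x => x * sin x)); [lra| |].
  - intros y Hy. auto_derive; auto. ring.
  - intros y Hy. apply Rmult_le_pos; [lra|]. apply sin_ge_0; lra.
Qed.

(** From [sin x < x <= tan x], the second inequality through [1/sin^2 = 1 + cot^2]. *)
Lemma inv_sin_sqr_bounds x : 0 < x < PI / 2 ->
  / (x * x) <= / (sin x * sin x) <= / (x * x) + 1.
Proof.
  intros H. assert (Hs : 0 < sin x) by (apply sin_gt_0; lra).
  assert (Hc : 0 < cos x) by (apply cos_gt_0; lra).
  pose proof (sin_lt_x x ltac:(lra)) as H1.
  pose proof (x_cos_le_sin x ltac:(lra)) as H2.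
  split.
  - apply Rinv_le_contravar; nra.
  - pose proof (sin2_cos2 x) as H3. unfold Rsqr in H3.
    replace (/ (sin x * sin x)) with (1 + (cos x / sin x) * (cos x / sin x)).
    + assert (0 <= cos x / sin x <= / x).
      { split; [apply Rlt_le, Rdiv_lt_0_compat; lra|].
        apply (Rmult_le_reg_r (x * sin x)); [nra|]. field_simplify; lra. }
      rewrite Rinv_mult. nra.
    + replace (/ (sin x * sin x)) with ((sin x * sin x + cos x * cos x) / (sin x * sin x)).
      * field; lra.
      * rewrite H3. field; lra.
Qed.

(** Since [1/sin^2 y + 1/cos^2 y = 4/sin^2 (2y)], pairing the angle [y] with [PI/2 - y] gives four
    times the sum over the doubled angles. *)
Lemma cosec_doubling n :
  rsum (fun k => / (sin ((2 * INR k + 1) * PI / 2 ^ (n + 2))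
                   * sin ((2 * INR k + 1) * PI / 2 ^ (n + 2)))) (2 ^ n) = 2 * 4 ^ n.
Proof.
  induction n as [|n IH].
  - simpl. replace ((2 * 0 + 1) * PI / (2 * (2 * 1))) with (PI / 4) by field.
    rewrite sin_PI4. assert (sqrt 2 * sqrt 2 = 2) by (apply sqrt_sqrt; lra).
    assert (0 < sqrt 2) by (apply sqrt_lt_R0; lra).
    replace (1 / sqrt 2 * (1 / sqrt 2)) with (/ (sqrt 2 * sqrt 2)) by (field; lra).
    rewrite H. lra.
  - replace (2 ^ S n)%nat with (2 * 2 ^ n)%nat by reflexivity.
    rewrite rsum_fold.
    replace (2 * 4 ^ S n) with (4 * (2 * 4 ^ n)) by (simpl; ring).
    rewrite <- IH, <- rsum_scal. apply rsum_ext. intros k Hk.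
    pose proof (pow_lt 2 (n + 2) ltac:(lra)) as Hp.
    replace (2 ^ (S n + 2)) with (2 * 2 ^ (n + 2)) by reflexivity.
    set (P := 2 ^ (n + 2)) in *.
    set (y := (2 * INR k + 1) * PI / (2 * P)).
    assert (HP : P = 4 * INR (2 ^ n)).
    { subst P. rewrite pow_add, pow_INR. change (INR 2) with 2. ring. }
    assert (Hk' : INR k + 1 <= INR (2 ^ n)).
    { rewrite <- S_INR. apply le_INR. lia. }
    assert (Hy : 0 < y < PI / 2).
    { pose proof PI_RGT_0. pose proof (pos_INR k). unfold y. split.
      - apply Rdiv_lt_0_compat; nra.
      - apply (Rmult_lt_reg_r (2 * P)); [lra|]. field_simplify; [|lra]. nra. }
    replace ((2 * INR (2 * 2 ^ n - 1 - k) + 1) * PI / (2 * P)) with (PI / 2 - y).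
    2:{ rewrite minus_INR, minus_INR, mult_INR by lia. unfold y. rewrite HP.
        change (INR 2) with (1 + 1). change (INR 1) with 1. field.
        pose proof (pos_INR k); lra. }
    replace ((2 * INR k + 1) * PI / P) with (2 * y) by (unfold y; field; lra).
    rewrite sin_shift, sin_2a.
    assert (0 < sin y) by (apply sin_gt_0; lra). assert (0 < cos y) by (apply cos_gt_0; lra).
    pose proof (sin2_cos2 y) as H3. unfold Rsqr in H3.
    replace (/ (sin y * sin y) + / (cos y * cos y))
      with ((sin y * sin y + cos y * cos y) / (sin y * sin y * (cos y * cos y))) by (field; lra).
    rewrite H3. field; lra.
Qed.

Definition odd_inv_sq (n : nat) : R := rsum (fun k => / ((2 * INR k + 1) * (2 * INR k + 1))) n.
Definition inv_sq (n : nat) : R := rsum (fun k => / ((INR k + 1) * (INR k + 1))) n.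

(** Replacing [1/sin^2] by [1/x^2] costs at most 1 for each of the [2^n] angles, against a total of
    order [4^n]. *)
Lemma odd_inv_sq_bounds n :
  PI * PI / 8 - PI * PI / 16 / 2 ^ n <= odd_inv_sq (2 ^ n) <= PI * PI / 8.
Proof.
  pose proof PI_RGT_0 as Hpi. pose proof (pow_lt 2 n ltac:(lra)) as Hp2.
  pose proof (cosec_doubling n) as HD.
  assert (HP : 2 ^ (n + 2) = 4 * INR (2 ^ n)) by (rewrite pow_add, pow_INR; change (INR 2) with 2%R; ring).
  assert (H4 : 4 ^ n = 2 ^ n * 2 ^ n) by (rewrite <- Rpow_mult_distr; f_equal; lra).
  assert (Hi : INR (2 ^ n) = 2 ^ n) by (rewrite pow_INR; reflexivity).
  assert (HB : forall k, (k < 2 ^ n)%nat ->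
    let x := (2 * INR k + 1) * PI / 2 ^ (n + 2) in
    0 < x < PI / 2 /\ / (x * x) = 16 * 4 ^ n / (PI * PI) * / ((2 * INR k + 1) * (2 * INR k + 1))).
  { intros k Hk x. subst x. rewrite HP, Hi.
    assert (Hk' : INR k + 1 <= 2 ^ n) by (rewrite <- Hi, <- S_INR; apply le_INR; lia).
    pose proof (pos_INR k). repeat split.
    - apply Rdiv_lt_0_compat; nra.
    - apply (Rmult_lt_reg_r (4 * 2 ^ n)); [lra|]. field_simplify; [|lra]. nra.
    - rewrite H4. field. lra. }
  assert (HL : 16 * 4 ^ n / (PI * PI) * odd_inv_sq (2 ^ n) <= 2 * 4 ^ n).
  { rewrite <- HD. unfold odd_inv_sq. rewrite <- rsum_scal. apply rsum_le. intros k Hk.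
    destruct (HB k Hk) as [H1 H2]. rewrite <- H2. now apply inv_sin_sqr_bounds. }
  assert (HU : 2 * 4 ^ n <= 16 * 4 ^ n / (PI * PI) * odd_inv_sq (2 ^ n) + 2 ^ n).
  { rewrite <- HD. unfold odd_inv_sq. rewrite <- rsum_scal.
    replace (2 ^ n)%R with (rsum (fun _ => 1) (2 ^ n)) by (rewrite rsum_const, Hi; ring).
    rewrite <- rsum_plus. apply rsum_le. intros k Hk.
    destruct (HB k Hk) as [H1 H2]. rewrite <- H2. now apply inv_sin_sqr_bounds. }
  rewrite H4 in HL, HU. set (P := 2 ^ n) in *. set (O := odd_inv_sq (2 ^ n)) in *.
  assert (Hk : 0 < PI * PI / (16 * (P * P))) by (apply Rdiv_lt_0_compat; nra).
  split.
  - apply (Rmult_le_compat_l (PI * PI / (16 * (P * P)))) in HU; [|lra].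
    field_simplify in HU; [|lra|lra].
    replace (PI * PI / 8 - PI * PI / 16 / P) with ((2 * (P * P) - P) * (PI * PI / (16 * (P * P)))) by (field; lra).
    replace O with ((16 * (P * P) / (PI * PI) * O) * (PI * PI / (16 * (P * P)))) by (field; lra).
    apply Rmult_le_compat_r; [lra|].
    assert (HU' : 2 * (P * P) <= 16 * (P * P) / (PI * PI) * O + P).
    { apply (Rmult_le_reg_l (PI * PI / (16 * (P * P)))); [lra|].
      field_simplify; [|lra|lra]. exact HU. }
    lra.
  - replace O with ((16 * (P * P) / (PI * PI) * O) * (PI * PI / (16 * (P * P)))) by (field; lra).
    replace (PI * PI / 8) with ((2 * (P * P)) * (PI * PI / (16 * (P * P)))) by (field; lra).
    apply Rmult_le_compat_r; [lra|]. exact HL.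
Qed.

Lemma inv_sq_split n : inv_sq (2 * n) = odd_inv_sq n + inv_sq n / 4.
Proof.
  induction n; [unfold inv_sq, odd_inv_sq; simpl; lra|].
  replace (2 * S n)%nat with (S (S (2 * n))) by lia.
  unfold inv_sq, odd_inv_sq in *. cbn [rsum]. rewrite IHn.
  rewrite S_INR, mult_INR. change (INR 2) with (1 + 1). pose proof (pos_INR n).
  field. lra.
Qed.

Lemma inv_sq_tail m n : (1 <= m)%nat -> inv_sq (m + n) - inv_sq m <= / INR m - / INR (m + n).
Proof.
  intros Hm. induction n.
  - rewrite Nat.add_0_r. lra.
  - rewrite Nat.add_succ_r. unfold inv_sq in *. cbn [rsum]. rewrite S_INR.
    assert (1 <= INR (m + n)) by (change 1 with (INR 1); apply le_INR; lia).
    set (x := INR (m + n)) in *.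
    assert (/ ((x + 1) * (x + 1)) <= / x - / (x + 1)).
    { replace (/ x - / (x + 1)) with (/ (x * (x + 1))) by (field; lra).
      apply Rinv_le_contravar; nra. }
    lra.
Qed.

Lemma inv_sq_mono m n : (m <= n)%nat -> inv_sq m <= inv_sq n.
Proof.
  intros H. apply rsum_mono; auto. intros i. pose proof (pos_INR i).
  apply Rlt_le, Rinv_0_lt_compat. nra.
Qed.

Lemma basel_upper L : inv_sq L <= PI * PI / 6.
Proof.
  assert (HL : (L <= 2 ^ L)%nat) by (apply Nat.lt_le_incl, Nat.pow_gt_lin_r; lia).
  pose proof (odd_inv_sq_bounds L) as [_ H]. pose proof (inv_sq_split (2 ^ L)) as E.
  pose proof (inv_sq_mono (2 ^ L) (2 * 2 ^ L) ltac:(lia)). pose proof (inv_sq_mono _ _ HL). lra.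
Qed.

(** A dyadic index [2^n] far beyond [L] brings the sum within [eps] of [PI^2/6], and the terms in
    between add up to at most [1/L] by telescoping. *)
Lemma basel_lower L : (1 <= L)%nat -> PI * PI / 6 - / INR L <= inv_sq L.
Proof.
  intros HL. apply le_epsilon. intros eps Heps.
  pose proof PI_RGT_0 as Hpi. pose proof PI_4 as Hpi4.
  assert (Hn : exists n, (L <= 2 ^ n)%nat /\ 4 / 2 ^ n <= eps).
  { destruct (pow_lt_1_zero (/ 2) ltac:(rewrite Rabs_right; lra) (eps / 4) ltac:(lra)) as [n0 Hn0].
    exists (max n0 L). split.
    - apply Nat.le_trans with (2 ^ L)%nat; [apply Nat.lt_le_incl, Nat.pow_gt_lin_r; lia|].
      apply Nat.pow_le_mono_r; lia.
    - specialize (Hn0 (max n0 L) ltac:(lia)). rewrite pow_inv, Rabs_right in Hn0.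
      + unfold Rdiv at 1. lra.
      + apply Rle_ge, Rlt_le, Rinv_0_lt_compat, pow_lt; lra. }
  destruct Hn as [n [H1 H2]].
  pose proof (odd_inv_sq_bounds n) as [H3 _]. pose proof (inv_sq_split (2 ^ n)) as E.
  assert (Hp : 0 < 2 ^ n) by (apply pow_lt; lra).
  pose proof (inv_sq_tail (2 ^ n) (2 ^ n) ltac:(lia)) as H4.
  replace (2 ^ n + 2 ^ n)%nat with (2 * 2 ^ n)%nat in H4 by lia.
  rewrite mult_INR, pow_INR in H4. change (INR 2) with 2 in H4.
  pose proof (inv_sq_tail L (2 ^ n - L) HL) as H5.
  replace (L + (2 ^ n - L))%nat with (2 ^ n)%nat in H5 by lia.
  rewrite pow_INR in H5. change (INR 2) with 2 in H5.
  rewrite Rinv_mult in H4.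
  assert (H6 : 0 < / 2 ^ n) by now apply Rinv_0_lt_compat.
  assert (H7 : PI * PI * / 2 ^ n <= 16 * / 2 ^ n) by (apply Rmult_le_compat_r; nra).
  unfold Rdiv in *. lra.
Qed.

(** * The Fourier integral for restricted partitions *)

(** [dsq r psi] is [|1 - r e^(i psi)|^2] and [arg r psi] is the argument of [1/(1 - r e^(i psi))].
    For [0 < r < 1] the real part [1 - r cos psi] is positive, so the arctangent is the right branch
    everywhere. *)
Definition dsq (r psi : R) : R := 1 - 2 * r * cos psi + r * r.
Definition arg (r psi : R) : R := atan (r * sin psi / (1 - r * cos psi)).
Definition rr (t : R) (k : nat) : R := exp (- (INR k * t)).

Lemma rr_bounds t k : 0 < t -> (1 <= k)%nat -> 0 < rr t k < 1.
Proof.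
  intros Ht Hk. unfold rr. split; [apply exp_pos|]. rewrite <- exp_0. apply exp_increasing.
  assert (1 <= INR k) by (change 1 with (INR 1); apply le_INR; lia). nra.
Qed.

Lemma one_minus_rcos_pos r psi : 0 < r < 1 -> 0 < 1 - r * cos psi.
Proof. intros H. pose proof (COS_bound psi). nra. Qed.

Lemma dsq_alt r psi : dsq r psi = (1 - r) * (1 - r) + 2 * r * (1 - cos psi).
Proof. unfold dsq. ring. Qed.

Lemma dsq_pos r psi : 0 < r < 1 -> 0 < dsq r psi.
Proof. intros H. rewrite dsq_alt. pose proof (COS_bound psi). nra. Qed.

Lemma dsq_squares r psi :
  dsq r psi = (1 - r * cos psi) * (1 - r * cos psi) + (r * sin psi) * (r * sin psi).
Proof. unfold dsq. pose proof (sin2_cos2 psi) as H. unfold Rsqr in H. nra. Qed.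

Lemma sqrt_dsq_arg r psi : 0 < r < 1 ->
  sqrt (1 + (r * sin psi / (1 - r * cos psi))²) = sqrt (dsq r psi) / (1 - r * cos psi).
Proof.
  intros H. pose proof (one_minus_rcos_pos r psi H) as Hu. pose proof (dsq_pos r psi H).
  replace (1 + (r * sin psi / (1 - r * cos psi))²)
    with (dsq r psi / ((1 - r * cos psi) * (1 - r * cos psi))).
  - rewrite sqrt_div_alt by nra. now rewrite sqrt_square by lra.
  - rewrite dsq_squares. unfold Rsqr. field. lra.
Qed.

Lemma cos_arg r psi : 0 < r < 1 -> sqrt (dsq r psi) * cos (arg r psi) = 1 - r * cos psi.
Proof.
  intros H. pose proof (one_minus_rcos_pos r psi H) as Hu.
  pose proof (sqrt_lt_R0 _ (dsq_pos r psi H)).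
  unfold arg. rewrite cos_atan, sqrt_dsq_arg by auto. field. lra.
Qed.

Lemma sin_arg r psi : 0 < r < 1 -> sqrt (dsq r psi) * sin (arg r psi) = r * sin psi.
Proof.
  intros H. pose proof (one_minus_rcos_pos r psi H) as Hu.
  pose proof (sqrt_lt_R0 _ (dsq_pos r psi H)).
  unfold arg. rewrite sin_atan, sqrt_dsq_arg by auto. field. lra.
Qed.

Lemma is_derive_arg r psi : 0 < r < 1 ->
  is_derive (arg r) psi ((r * cos psi - r * r) / dsq r psi).
Proof.
  intros H. pose proof (one_minus_rcos_pos r psi H) as Hu. pose proof (dsq_pos r psi H) as Hd.
  unfold arg. auto_derive; [lra|].
  pose proof (dsq_squares r psi) as E. pose proof (sin2_cos2 psi) as Hsc. unfold Rsqr in Hsc.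
  assert (Hne : (1 - r * cos psi) * (1 - r * cos psi) + (r * sin psi) * (r * sin psi) <> 0) by lra.
  rewrite E. field_simplify_eq; [|nra].
  unfold dsq in *.
  assert (Es : sin psi ^ 2 = 1 - cos psi ^ 2) by nra.
  replace (sin psi ^ 4) with ((sin psi ^ 2) ^ 2) by ring.
  rewrite ?Es. ring.
Qed.

(** Modulus of the product over [k <= M] of [1/(1 - e^(-kt) e^(ik theta))]; [phase] is its argument,
    a sum of arctangents and hence smooth. The polar form keeps the analysis real. *)
Fixpoint rho (t : R) (M : nat) (th : R) : R :=
  match M with
  | O => 1
  | S M' => rho t M' th / sqrt (dsq (rr t M) (INR M * th))
  end.

Definition phase (t : R) (M : nat) (th : R) : R :=
  rsum (fun k => arg (rr t (S k)) (INR (S k) * th)) M.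

Lemma rho_pos t M th : 0 < t -> 0 < rho t M th.
Proof.
  intros Ht. induction M; cbn [rho]; [lra|]. apply Rdiv_lt_0_compat; auto.
  apply sqrt_lt_R0, dsq_pos, rr_bounds; auto; lia.
Qed.

(** Real part of the statement that multiplication by [1 - r e^(i psi)] removes the last factor of
    the product. *)
Lemma fourier_pointwise t M th x : 0 < t ->
  rho t (S M) th * cos (phase t (S M) th - x * th)
  - rr t (S M) * (rho t (S M) th * cos (phase t (S M) th - (x - INR (S M)) * th))
  = rho t M th * cos (phase t M th - x * th).
Proof.
  intros Ht. unfold phase. cbn [rho rsum]. fold (phase t M th).
  pose proof (rr_bounds t (S M) Ht ltac:(lia)) as Hr.
  set (r := rr t (S M)) in *. set (psi := INR (S M) * th) in *.
  pose proof (sqrt_lt_R0 _ (dsq_pos r psi Hr)) as HD.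
  pose proof (cos_arg r psi Hr) as Hc. pose proof (sin_arg r psi Hr) as Hs.
  set (a := arg r psi) in *. set (D := sqrt (dsq r psi)) in *.
  replace (phase t M th + a - x * th) with ((phase t M th - x * th) + a) by ring.
  replace (phase t M th + a - (x - INR (S M)) * th) with (((phase t M th - x * th) + a) + psi)
    by (unfold psi; ring).
  set (b := phase t M th - x * th).
  rewrite (cos_plus (b + a) psi).
  replace (cos b) with (cos (b + a) * cos a + sin (b + a) * sin a)
    by (rewrite <- cos_minus; f_equal; ring).
  apply (Rmult_eq_reg_l D); [|lra].
  replace (D * (rho t M th * (cos (b + a) * cos a + sin (b + a) * sin a)))
    with (rho t M th * (cos (b + a) * (D * cos a) + sin (b + a) * (D * sin a))) by ring.
  rewrite Hc, Hs. field. lra.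
Qed.

Lemma ex_derive_rho t M th : 0 < t -> ex_derive (rho t M) th.
Proof.
  intros Ht. induction M; cbn [rho]; [apply ex_derive_const|].
  pose proof (rr_bounds t (S M) Ht ltac:(lia)) as Hr.
  apply (ex_derive_div (rho t M) (fun th => sqrt (dsq (rr t (S M)) (INR (S M) * th)))).
  - exact IHM.
  - pose proof (dsq_pos _ (INR (S M) * th) Hr) as Hd. unfold dsq in *.
    auto_derive. repeat split; auto; lra.
  - apply Rgt_not_eq, sqrt_lt_R0, dsq_pos, Hr.
Qed.

Lemma is_derive_phase t M th : 0 < t ->
  is_derive (phase t M) th
    (rsum (fun k => INR (S k) * ((rr t (S k) * cos (INR (S k) * th) - rr t (S k) * rr t (S k))
             / dsq (rr t (S k)) (INR (S k) * th))) M).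
Proof.
  intros Ht. unfold phase. induction M; cbn [rsum]; [apply (is_derive_const (V := R_NormedModule))|].
  apply (is_derive_plus (fun th => rsum _ M) (fun th => arg (rr t (S M)) (INR (S M) * th))); auto.
  pose proof (rr_bounds t (S M) Ht ltac:(lia)) as Hr.
  apply (is_derive_comp (arg (rr t (S M))) (fun th => INR (S M) * th)).
  - now apply is_derive_arg.
  - generalize (INR (S M)). intros a. auto_derive; auto. ring.
Qed.

Definition integrand (t : R) (M : nat) (x th : R) : R :=
  rho t M th * cos (phase t M th - x * th).

Lemma continuous_integrand t M x th : 0 < t -> continuous (integrand t M x) th.
Proof.
  intros Ht. apply (ex_derive_continuous (K := R_AbsRing) (V := R_NormedModule)).
  unfold integrand. apply (ex_derive_mult (rho t M)); [now apply ex_derive_rho|].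
  apply (ex_derive_comp cos (fun th => phase t M th - x * th)).
  - auto_derive; auto.
  - apply (ex_derive_minus (phase t M) (fun th => x * th)).
    + eexists. now apply is_derive_phase.
    + auto_derive; auto.
Qed.

Lemma continuous_rho t M th : 0 < t -> continuous (rho t M) th.
Proof.
  intros Ht. apply (ex_derive_continuous (K := R_AbsRing) (V := R_NormedModule)).
  now apply ex_derive_rho.
Qed.

Lemma ex_RInt_cont (f : R -> R) a b : (forall x, continuous f x) -> ex_RInt f a b.
Proof. intros H. apply (ex_RInt_continuous (V := R_CompleteNormedModule)). auto. Qed.

(** The integrand is the real part of the product times [e^(-in theta)], an even function of
    [theta], so half a period suffices and the value is [PI] times the coefficient. *)
Definition fourier (t : R) (M : nat) (n : Z) : R := RInt (integrand t M (IZR n)) 0 PI.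

Lemma fourier_rec t M n : 0 < t ->
  fourier t (S M) n - rr t (S M) * fourier t (S M) (n - Z.of_nat (S M)) = fourier t M n.
Proof.
  intros Ht. unfold fourier.
  assert (E1 : forall M x, ex_RInt (integrand t M x) 0 PI)
    by (intros; apply ex_RInt_cont; intros; now apply continuous_integrand).
  rewrite <- (RInt_scal (V := R_CompleteNormedModule)) by apply E1.
  rewrite <- (RInt_minus (V := R_CompleteNormedModule)); [|apply E1|].
  - apply RInt_ext. intros th _. rewrite minus_IZR, <- INR_IZR_INZ. unfold integrand.
    rewrite <- (fourier_pointwise t M th (IZR n) Ht). reflexivity.
  - apply (ex_RInt_scal (V := R_CompleteNormedModule)), E1.
Qed.

Lemma sin_IZR_PI n : sin (IZR n * PI) = 0.
Proof. apply sin_eq_0_1. now exists n. Qed.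

Lemma fourier_0 t n : fourier t 0 n = if (n =? 0)%Z then PI else 0.
Proof.
  unfold fourier.
  rewrite (RInt_ext _ (fun th => cos (IZR n * th))).
  2:{ intros x _. unfold integrand. cbn. rewrite Rmult_1_l.
      rewrite <- cos_neg. f_equal. ring. }
  destruct (Z.eqb_spec n 0) as [->|Hn].
  - rewrite (RInt_ext _ (fun th => 1)) by (intros; rewrite Rmult_0_l; apply cos_0).
    rewrite RInt_const. unfold scal; simpl; unfold mult; simpl. ring.
  - apply is_RInt_unique.
    assert (Hn' : IZR n <> 0) by (now apply not_0_IZR).
    replace 0 with (minus (sin (IZR n * PI) / IZR n) (sin (IZR n * 0) / IZR n)) at 2.
    + apply (is_RInt_derive (fun x => sin (IZR n * x) / IZR n)).
      * intros x _. auto_derive; auto. field. auto.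
      * intros x _. apply (ex_derive_continuous (K := R_AbsRing) (V := R_NormedModule)).
        auto_derive; auto.
    + rewrite sin_IZR_PI, Rmult_0_r, sin_0. unfold minus, plus, opp; simpl. field. auto.
Qed.

Lemma fourier_bounded t M : 0 < t -> exists B, forall n, Rabs (fourier t M n) <= B.
Proof.
  intros Ht. exists (RInt (rho t M) 0 PI). intros n. unfold fourier.
  pose proof PI_RGT_0.
  eapply Rle_trans; [apply abs_RInt_le; [lra|]|].
  - apply ex_RInt_cont; intros; now apply continuous_integrand.
  - apply RInt_le; [lra| | |].
    + apply (ex_RInt_cont (fun x => Rabs (integrand t M (IZR n) x))).
      intros x. apply continuous_comp; [now apply continuous_integrand|apply continuous_Rabs].
    + apply ex_RInt_cont; intros; now apply continuous_rho.
    + intros x _. unfold integrand. rewrite Rabs_mult, (Rabs_right (rho t M x))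
        by (apply Rle_ge, Rlt_le, rho_pos; auto).
      pose proof (rho_pos t M x Ht). pose proof (COS_bound (phase t M x - IZR n * x)).
      assert (Rabs (cos (phase t M x - IZR n * x)) <= 1) by (apply Rabs_le; lra). nra.
Qed.

(** By induction the shorter product contributes nothing, so the recurrence becomes geometric with
    step [M + 1]; iterating it [j] times multiplies a bounded quantity by [r^j]. *)
Lemma fourier_neg t M : 0 < t -> forall n, (n < 0)%Z -> fourier t M n = 0.
Proof.
  intros Ht. induction M as [|M IH]; intros n Hn.
  - rewrite fourier_0. destruct (Z.eqb_spec n 0); auto; lia.
  - destruct (fourier_bounded t (S M) Ht) as [B HB].
    pose proof (rr_bounds t (S M) Ht ltac:(lia)) as Hr.
    assert (E : forall j, fourier t (S M) n
       = rr t (S M) ^ j * fourier t (S M) (n - Z.of_nat j * Z.of_nat (S M))).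
    { induction j as [|j IHj].
      - simpl pow. rewrite Rmult_1_l. f_equal. lia.
      - rewrite IHj. pose proof (fourier_rec t M (n - Z.of_nat j * Z.of_nat (S M)) Ht) as H.
        rewrite (IH (n - Z.of_nat j * Z.of_nat (S M))%Z) in H by lia.
        replace (n - Z.of_nat (S j) * Z.of_nat (S M))%Z
          with (n - Z.of_nat j * Z.of_nat (S M) - Z.of_nat (S M))%Z by lia.
        cbn [pow].
        replace (fourier t (S M) (n - Z.of_nat j * Z.of_nat (S M))) with
          (rr t (S M) * fourier t (S M) (n - Z.of_nat j * Z.of_nat (S M) - Z.of_nat (S M))) by lra.
        ring. }
    apply Rabs_eq_0, Rle_antisym; [|apply Rabs_pos].
    apply le_epsilon. intros eps Heps. rewrite Rplus_0_l.
    assert (HB0 : 0 <= B) by (eapply Rle_trans; [apply Rabs_pos|apply (HB 0%Z)]).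
    destruct (pow_lt_1_zero (rr t (S M)) ltac:(rewrite Rabs_right; lra) (eps / (B + 1))
       ltac:(apply Rdiv_lt_0_compat; lra)) as [j Hj].
    specialize (Hj j ltac:(lia)). rewrite (E j), Rabs_mult.
    pose proof (HB (n - Z.of_nat j * Z.of_nat (S M))%Z) as H1.
    apply Rle_trans with (eps / (B + 1) * (B + 1)); [|right; field; lra].
    apply Rmult_le_compat; try apply Rabs_pos; lra.
Qed.

(** Both sides satisfy the same recurrence in [M] and vanish for negative [n], so no series has to
    be integrated term by term. *)
Lemma fourier_pm t M : 0 < t -> forall n,
  fourier t M n = PI * IZR (pm M n) * exp (- (IZR n * t)).
Proof.
  intros Ht. induction M as [|M IHM].
  - intros n. rewrite fourier_0, pm_0. destruct (Z.eqb_spec n 0) as [->|].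
    + rewrite Rmult_0_l, Ropp_0, exp_0. lra.
    + lra.
  - assert (H : forall k n, (n < Z.of_nat k)%Z ->
      fourier t (S M) n = PI * IZR (pm (S M) n) * exp (- (IZR n * t))).
    { induction k as [|k IHk]; intros n Hn.
      - rewrite fourier_neg, pm_neg by (auto; lia). lra.
      - pose proof (fourier_rec t M n Ht) as H. rewrite IHM, (IHk (n - Z.of_nat (S M))%Z) in H by lia.
        rewrite pm_S, plus_IZR.
        replace (fourier t (S M) n) with (PI * IZR (pm M n) * exp (- (IZR n * t))
          + rr t (S M) * (PI * IZR (pm (S M) (n - Z.of_nat (S M)))
              * exp (- (IZR (n - Z.of_nat (S M)) * t)))) by lra.
        assert (E : rr t (S M) * exp (- (IZR (n - Z.of_nat (S M)) * t)) = exp (- (IZR n * t))).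
        { unfold rr. rewrite <- exp_plus. f_equal. rewrite minus_IZR, <- INR_IZR_INZ. ring. }
        replace (rr t (S M) * (PI * IZR (pm (S M) (n - Z.of_nat (S M)))
              * exp (- (IZR (n - Z.of_nat (S M)) * t))))
          with (PI * IZR (pm (S M) (n - Z.of_nat (S M)))
             * (rr t (S M) * exp (- (IZR (n - Z.of_nat (S M)) * t)))) by ring.
        rewrite E. ring. }
    intros n. apply (H (Z.to_nat (n + 1))). lia.
Qed.

(** * Decay of the modulus and its first moment *)

Lemma abs_sin_le x : Rabs (sin x) <= Rabs x.
Proof.
  assert (H : forall y, 0 <= y -> Rabs (sin y) <= y).
  { intros y Hy. destruct (Rle_lt_dec y 1).
    - destruct (Req_dec y 0) as [->|]; [rewrite sin_0, Rabs_R0; lra|].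
      pose proof (sin_lt_x y ltac:(lra)). pose proof (sin_ge_0 y ltac:(lra) ltac:(pose proof PI2_3_2; lra)).
      rewrite Rabs_right; lra.
    - pose proof (SIN_bound y). apply Rabs_le. lra. }
  destruct (Rle_lt_dec 0 x).
  - rewrite (Rabs_right x) by lra. auto.
  - rewrite (Rabs_left x), <- Rabs_Ropp, <- sin_neg by lra. apply H. lra.
Qed.

Lemma abs_cos_minus_le a b : Rabs (cos a - cos b) <= Rabs (a - b).
Proof.
  rewrite form2, !Rabs_mult, (Rabs_left (-2)) by lra.
  pose proof (abs_sin_le ((a - b) / 2)). pose proof (SIN_bound ((a + b) / 2)).
  assert (Rabs (sin ((a + b) / 2)) <= 1) by (apply Rabs_le; lra).
  replace (Rabs (a - b)) with (2 * Rabs ((a - b) / 2)).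
  - pose proof (Rabs_pos (sin ((a + b) / 2))). pose proof (Rabs_pos (sin ((a - b) / 2))). nra.
  - unfold Rdiv. rewrite Rabs_mult, (Rabs_right (/ 2)) by lra. lra.
Qed.

Lemma one_minus_cos x : 1 - cos x = 2 * (sin (x / 2) * sin (x / 2)).
Proof. replace x with (2 * (x / 2)) at 1 by field. rewrite cos_2a_sin. ring. Qed.

Lemma one_minus_cos_le x : 1 - cos x <= x * x / 2.
Proof.
  rewrite one_minus_cos. pose proof (abs_sin_le (x / 2)) as H.
  apply Rsqr_le_abs_1 in H. unfold Rsqr in H. lra.
Qed.

Lemma sin_ge_third y : 0 <= y <= PI / 2 -> y / 3 <= sin y.
Proof.
  intros H. pose proof PI_4. destruct (sin_bound y 0 ltac:(lra) ltac:(lra)) as [H1 _].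
  unfold sin_approx, sin_term in H1. simpl in H1. nra.
Qed.

Lemma one_minus_cos_ge x : 0 <= x <= PI -> x * x / 18 <= 1 - cos x.
Proof.
  intros H. rewrite one_minus_cos. pose proof (sin_ge_third (x / 2) ltac:(lra)). nra.
Qed.

Lemma exp_le_double x : 0 <= x <= / 2 -> exp x <= 1 + 2 * x.
Proof.
  intros H. pose proof (exp_ineq1_le (- x)) as H1. rewrite exp_Ropp in H1.
  pose proof (exp_pos x).
  assert (H2 : (1 - x) * exp x <= 1).
  { apply (Rmult_le_compat_r (exp x)) in H1; [|lra]. rewrite Rinv_l in H1 by lra. lra. }
  nra.
Qed.

(** With [v = 1 - cos psi] the squared modulus of the denominator is [(1-r)^2 + 2rv]. For [r >= 1/3]
    one has [2r >= 2/3] and [(1-r)^2 <= 4/9], so it is at least [(1-r)^2 (1 + v/2)], which dominates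
    [(1-r)^2 e^(v/4)]. *)
Lemma factor_upper r psi : / 3 <= r < 1 ->
  / sqrt (dsq r psi) <= / (1 - r) * exp (- ((1 - cos psi) / 8)).
Proof.
  intros Hr. pose proof (COS_bound psi) as Hc.
  pose proof (dsq_pos r psi ltac:(lra)) as Hd.
  rewrite exp_Ropp, <- Rinv_mult. apply Rinv_le_contravar.
  - apply Rmult_lt_0_compat; [lra|apply exp_pos].
  - apply Rsqr_incr_0_var; [|apply sqrt_pos]. rewrite Rsqr_sqrt by lra.
    unfold Rsqr. replace ((1 - r) * exp ((1 - cos psi) / 8) * ((1 - r) * exp ((1 - cos psi) / 8)))
      with ((1 - r) * (1 - r) * (exp ((1 - cos psi) / 8) * exp ((1 - cos psi) / 8))) by ring.
    rewrite <- exp_plus.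
    replace ((1 - cos psi) / 8 + (1 - cos psi) / 8) with ((1 - cos psi) / 4) by field.
    pose proof (exp_le_double ((1 - cos psi) / 4) ltac:(lra)) as He.
    rewrite dsq_alt. set (v := 1 - cos psi) in *.
    assert (0 <= v) by (unfold v; lra).
    assert ((1 - r) * (1 - r) <= 4 / 9) by nra.
    assert ((1 - r) * (1 - r) * exp (v / 4) <= (1 - r) * (1 - r) * (1 + 2 * (v / 4)))
      by (apply Rmult_le_compat_l; nra).
    nra.
Qed.

Lemma sqrt_dsq_0 r : 0 < r < 1 -> sqrt (dsq r 0) = 1 - r.
Proof.
  intros H. replace (dsq r 0) with ((1 - r) * (1 - r)) by (unfold dsq; rewrite cos_0; ring).
  apply sqrt_square. lra.
Qed.

Lemma factor_trivial r psi : 0 < r < 1 -> / sqrt (dsq r psi) <= / (1 - r).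
Proof.
  intros H. apply Rinv_le_contravar; [lra|].
  rewrite <- (sqrt_square (1 - r)) by lra. apply sqrt_le_1_alt. rewrite dsq_alt.
  pose proof (COS_bound psi). nra.
Qed.

Definition cos_defect (K : nat) (th : R) : R := rsum (fun k => 1 - cos (INR (S k) * th)) K.

Lemma rho_0_S t M : 0 < t -> rho t (S M) 0 = rho t M 0 * / (1 - rr t (S M)).
Proof.
  intros Ht. cbn [rho]. rewrite Rmult_0_r, sqrt_dsq_0 by (apply rr_bounds; auto; lia). reflexivity.
Qed.

(** Only factors with [kt <= 1] are used for decay: there [e^(-kt) >= 1/e >= 1/3], as [factor_upper]
    demands. The others are bounded by their value at 0. *)
Lemma rho_upper t K M th : 0 < t -> INR K * t <= 1 -> (K <= M)%nat ->
  rho t M th <= rho t M 0 * exp (- (cos_defect K th / 8)).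
Proof.
  intros Ht HK HM.
  assert (H : forall M, rho t M th <= rho t M 0 * exp (- (cos_defect (Nat.min K M) th / 8))).
  { clear M HM. induction M as [|M IH].
    - rewrite Nat.min_0_r. cbn. replace (- (0 / 8)) with 0 by field. rewrite exp_0. lra.
    - rewrite rho_0_S by auto. cbn [rho].
      pose proof (rr_bounds t (S M) Ht ltac:(lia)) as Hr.
      pose proof (rho_pos t M th Ht). pose proof (rho_pos t M 0 Ht).
      pose proof (sqrt_lt_R0 _ (dsq_pos (rr t (S M)) (INR (S M) * th) Hr)) as HD.
      pose proof (Rinv_0_lt_compat _ HD) as HD'.
      destruct (le_lt_dec (S M) K) as [H1|H1].
      + replace (Nat.min K (S M)) with (S M) by lia. replace (Nat.min K M) with M in IH by lia.
        assert (Hr3 : / 3 <= rr t (S M)).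
        { unfold rr. apply Rle_trans with (exp (- (1))).
          - rewrite exp_Ropp. apply Rinv_le_contravar; [apply exp_pos|apply exp_le_3].
          - apply exp_le_compat. apply le_INR in H1. nra. }
        pose proof (factor_upper (rr t (S M)) (INR (S M) * th) ltac:(lra)) as Hf.
        unfold cos_defect in *. cbn [rsum].
        replace (exp (- ((rsum (fun k => 1 - cos (INR (S k) * th)) M + (1 - cos (INR (S M) * th))) / 8)))
          with (exp (- (rsum (fun k => 1 - cos (INR (S k) * th)) M / 8))
                * exp (- ((1 - cos (INR (S M) * th)) / 8))) by (rewrite <- exp_plus; f_equal; field).
        unfold Rdiv at 1.
        eapply Rle_trans; [apply Rmult_le_compat; [lra|lra|exact IH|exact Hf]|].
        right. ring.
      + replace (Nat.min K (S M)) with (Nat.min K M) by lia.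
        pose proof (factor_trivial (rr t (S M)) (INR (S M) * th) Hr) as Hf.
        unfold Rdiv at 1.
        eapply Rle_trans; [apply Rmult_le_compat; [lra|lra|exact IH|exact Hf]|].
        right. ring. }
  specialize (H M). now replace (Nat.min K M) with K in H by lia.
Qed.

Lemma dirichlet K th :
  2 * sin (th / 2) * rsum (fun k => cos (INR (S k) * th)) K
  = sin ((INR K + / 2) * th) - sin (th / 2).
Proof.
  induction K as [|K IH].
  - simpl. replace ((0 + / 2) * th) with (th / 2) by field. ring.
  - cbn [rsum]. rewrite Rmult_plus_distr_l, IH, S_INR.
    replace ((INR K + 1 + / 2) * th) with ((INR K + 1) * th + th / 2) by field.
    replace ((INR K + / 2) * th) with ((INR K + 1) * th - th / 2) by field.
    rewrite sin_plus, sin_minus. ring.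
Qed.

Lemma sum_squares_ge m : INR m ^ 3 / 3 <= rsum (fun k => INR (S k) * INR (S k)) m.
Proof.
  induction m; [simpl; lra|]. cbn [rsum]. rewrite S_INR. pose proof (pos_INR m). nra.
Qed.

(** For [k <= m] the angles stay below 3, hence below [PI], where [1 - cos x >= x^2/18]; the terms
    with [k > m] are dropped. *)
Lemma cos_defect_small m th : (1 <= m)%nat -> 0 <= th -> INR m * th <= 3 ->
  th * th * INR m ^ 3 / 54 <= cos_defect (2 * m) th.
Proof.
  intros Hm Hth H. unfold cos_defect.
  apply Rle_trans with (rsum (fun k => 1 - cos (INR (S k) * th)) m).
  - apply Rle_trans with (rsum (fun k => th * th / 18 * (INR (S k) * INR (S k))) m).
    + rewrite rsum_scal. pose proof (sum_squares_ge m).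
      apply Rle_trans with (th * th / 18 * (INR m ^ 3 / 3)); [right; field|].
      apply Rmult_le_compat_l; nra.
    + apply rsum_le. intros k Hk.
      apply Rle_trans with (INR (S k) * th * (INR (S k) * th) / 18); [right; field|].
      apply one_minus_cos_ge. pose proof PI2_3_2. pose proof (pos_INR (S k)).
      assert (INR (S k) <= INR m) by (apply le_INR; lia). split; nra.
  - apply rsum_mono; [lia|]. intros i. pose proof (COS_bound (INR (S i) * th)). lra.
Qed.

(** By the Dirichlet kernel the sum of the cosines is at most [1/(2 sin(theta/2))]. As
    [sin(theta/2) >= theta/6] and [m theta >= 3], this is at most [m], half the number of terms. *)
Lemma cos_defect_large m th : (1 <= m)%nat -> 0 <= th <= PI -> 3 <= INR m * th ->
  INR m <= cos_defect (2 * m) th.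
Proof.
  intros Hm Hth H. unfold cos_defect. rewrite rsum_minus, rsum_const, mult_INR.
  change (INR 2) with 2. pose proof (dirichlet (2 * m) th) as HD.
  pose proof (sin_ge_third (th / 2) ltac:(lra)) as Hs.
  pose proof (SIN_bound ((INR (2 * m) + / 2) * th)).
  assert (Hm1 : 1 <= INR m) by (change 1 with (INR 1); apply le_INR; lia).
  set (S := rsum (fun k => cos (INR (Datatypes.S k) * th)) (2 * m)) in *.
  set (s := sin (th / 2)) in *.
  assert (1 <= 2 * INR m * s) by nra.
  assert (0 < s) by nra.
  assert (S <= INR m); [|lra].
  destruct (Rle_lt_dec S (INR m)); auto. nra.
Qed.

(** The product of 54, 8 and [4^3], coming from [cos_defect_small], from the exponent in [rho_upper]
    and from [m >= 1/(4t)]. *)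
Definition gauss_c : R := / 27648.

(** About [1/t] factors have [kt <= 1]. While [m theta <= 3] they yield a Gaussian of width
    [t^(3/2)]; for larger [theta] they yield an exponent proportional to [m], that is to [1/t]. *)
Lemma rho_gauss t M th : 0 < t <= / 4 -> 1 <= INR M * t -> 0 <= th <= PI ->
  rho t M th <= rho t M 0 * (exp (- (gauss_c * (th * th) / t ^ 3)) + exp (- (/ (32 * t)))).
Proof.
  intros Ht HM Hth.
  assert (Hx : 0 <= / (2 * t)) by (apply Rlt_le, Rinv_0_lt_compat; lra).
  (* The floor of [1/(2t)]: then [2mt <= 1], and [t <= 1/4] gives [m >= 1/(4t)]. *)
  destruct (nfloor_ex (/ (2 * t)) Hx) as [m [Hm1 Hm2]].
  assert (Hti : t * / (2 * t) = / 2) by (field; lra).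
  assert (Ha : INR m * t <= / 2) by nra.
  assert (Hb : / 4 <= INR m * t) by nra.
  assert (Hm : (1 <= m)%nat) by (destruct m; [simpl in Hb; lra|lia]).
  assert (HmM : (2 * m <= M)%nat).
  { apply INR_le. rewrite mult_INR. change (INR 2) with 2. nra. }
  pose proof (rho_pos t M 0 ltac:(lra)) as Hr0.
  eapply Rle_trans; [apply (rho_upper t (2 * m) M th); auto; [lra|]|].
  { rewrite mult_INR. change (INR 2) with 2. lra. }
  apply Rmult_le_compat_l; [lra|].
  pose proof (exp_pos (- (gauss_c * (th * th) / t ^ 3))). pose proof (exp_pos (- (/ (32 * t)))).
  assert (Hm4 : / (4 * t) <= INR m).
  { apply (Rmult_le_reg_r t); [lra|]. replace (/ (4 * t) * t) with (/ 4) by (field; lra). lra. }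
  destruct (Rle_lt_dec (INR m * th) 3) as [H3|H3].
  - apply Rle_trans with (exp (- (gauss_c * (th * th) / t ^ 3))); [|lra].
    apply exp_le_compat, Ropp_le_contravar.
    pose proof (cos_defect_small m th Hm ltac:(lra) H3) as Hc.
    apply Rle_trans with (th * th * INR m ^ 3 / 54 / 8); [|lra].
    assert (Hcube : (/ (4 * t)) ^ 3 <= INR m ^ 3).
    { apply pow_incr. split; [apply Rlt_le, Rinv_0_lt_compat; lra|auto]. }
    unfold gauss_c.
    replace (/ 27648 * (th * th) / t ^ 3) with (th * th * ((/ (4 * t)) ^ 3) / 54 / 8) by (field; lra).
    assert (th * th * (/ (4 * t)) ^ 3 <= th * th * INR m ^ 3) by (apply Rmult_le_compat_l; nra).
    lra.
  - apply Rle_trans with (exp (- (/ (32 * t)))); [|lra].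
    apply exp_le_compat, Ropp_le_contravar.
    pose proof (cos_defect_large m th Hm Hth ltac:(lra)) as Hc.
    replace (/ (32 * t)) with (/ (4 * t) / 8) by (field; lra). lra.
Qed.

Lemma exp_neg_cube x : 0 < x -> exp (- x) <= 27 / x ^ 3.
Proof.
  intros Hx. rewrite exp_Ropp.
  replace (27 / x ^ 3) with (/ (x ^ 3 / 27)) by (field; lra).
  apply Rinv_le_contravar.
  - apply Rdiv_lt_0_compat; [apply pow_lt; auto|lra].
  - replace x with (x / 3 + x / 3 + x / 3) at 2 by field. rewrite !exp_plus.
    pose proof (exp_ineq1_le (x / 3)) as H.
    replace (x ^ 3 / 27) with (x / 3 * (x / 3) * (x / 3)) by field.
    assert (x / 3 <= exp (x / 3)) by lra.
    repeat apply Rmult_le_compat; try nra; lra.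
Qed.

(** 13824 is half of 27648, from the Gaussian moment [1/(2a)]; 27 times [32^3] is the constant of
    [exp_neg_cube] at [1/(32t)], and 8 bounds [PI^2/2]. *)
Definition mom_c : R := 13824 + 8 * 27 * 32768.

Lemma rho_moment t M : 0 < t <= / 4 -> 1 <= INR M * t ->
  RInt (fun th => th * rho t M th) 0 PI <= rho t M 0 * (mom_c * t ^ 3).
Proof.
  intros Ht HM. pose proof PI_RGT_0 as Hpi. pose proof PI_4.
  pose proof (rho_pos t M 0 ltac:(lra)) as Hr0.
  pose proof (pow_lt t 3 ltac:(lra)) as Ht3.
  set (a := gauss_c / t ^ 3). assert (Ha : 0 < a) by (unfold a, gauss_c; apply Rdiv_lt_0_compat; lra).
  set (e := exp (- (/ (32 * t)))).
  (* The weight [th] gives the majorant [g] of [rho_gauss] an elementary antiderivative. *)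
  set (G := fun th => - rho t M 0 / (2 * a) * exp (- (a * (th * th))) + rho t M 0 * e * (th * th) / 2).
  set (g := fun th => rho t M 0 * (th * exp (- (a * (th * th)))) + rho t M 0 * e * th).
  assert (HG : is_RInt g 0 PI (G PI - G 0)).
  { apply (is_RInt_derive G g).
    - intros x _. unfold G, g. auto_derive; auto. field. lra.
    - intros x _. apply (ex_derive_continuous (K := R_AbsRing) (V := R_NormedModule)).
      unfold g. auto_derive; auto. }
  apply Rle_trans with (RInt g 0 PI).
  - apply RInt_le; [lra| |eexists; exact HG|].
    + apply ex_RInt_cont. intros x. apply (continuous_mult (fun th => th) (rho t M)).
      * apply continuous_id.
      * apply continuous_rho. lra.
    + intros x Hx. pose proof (rho_gauss t M x Ht HM ltac:(lra)) as H1.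
      unfold g. apply (Rmult_le_compat_l x) in H1; [|lra].
      eapply Rle_trans; [exact H1|]. right. unfold a, e.
      replace (gauss_c / t ^ 3 * (x * x)) with (gauss_c * (x * x) / t ^ 3) by (field; lra). ring.
  - rewrite (is_RInt_unique _ _ _ _ HG). unfold G.
    rewrite !Rmult_0_r, Ropp_0, exp_0.
    pose proof (exp_pos (- (a * (PI * PI)))) as He.
    assert (He1 : e <= 27 * 32768 * t ^ 3).
    { unfold e. eapply Rle_trans; [apply exp_neg_cube, Rinv_0_lt_compat; lra|].
      right. field. lra. }
    assert (He0 : 0 < e) by apply exp_pos.
    assert (H1 : rho t M 0 / (2 * a) = rho t M 0 * (13824 * t ^ 3)) by (unfold a, gauss_c; field; lra).
    assert (H2 : 0 < rho t M 0 / (2 * a)) by (apply Rdiv_lt_0_compat; lra).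
    assert (H3 : rho t M 0 * e * (PI * PI) / 2 <= rho t M 0 * (27 * 32768 * t ^ 3) * 8).
    { replace (rho t M 0 * e * (PI * PI) / 2) with (rho t M 0 * (e * (PI * PI / 2))) by field.
      rewrite Rmult_assoc. apply Rmult_le_compat_l; [lra|].
      apply Rmult_le_compat; nra. }
    unfold mom_c. replace (- rho t M 0 / (2 * a)) with (- (rho t M 0 / (2 * a))) by (field; lra).
    nra.
Qed.

Lemma fourier_lipschitz t M n : 0 < t <= / 4 -> 1 <= INR M * t ->
  Rabs (fourier t M n - fourier t M (n - 1)) <= rho t M 0 * (mom_c * t ^ 3).
Proof.
  intros Ht HM. pose proof PI_RGT_0. unfold fourier.
  assert (E1 : forall x, ex_RInt (integrand t M x) 0 PI)
    by (intros; apply ex_RInt_cont; intros; apply continuous_integrand; lra).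
  assert (E2 : Rabs (RInt (fun th => minus (integrand t M (IZR n) th) (integrand t M (IZR (n - 1)) th)) 0 PI)
     <= rho t M 0 * (mom_c * t ^ 3)).
  2:{ rewrite (RInt_minus (V := R_CompleteNormedModule)) in E2 by apply E1. exact E2. }
  eapply Rle_trans; [|apply (rho_moment t M Ht HM)].
  assert (Hc : forall x, continuous (fun th => minus (integrand t M (IZR n) th) (integrand t M (IZR (n - 1)) th)) x).
  { intros x. apply (continuous_minus (integrand t M (IZR n))); apply continuous_integrand; lra. }
  eapply Rle_trans; [apply abs_RInt_le; [lra|apply ex_RInt_cont, Hc]|].
  apply RInt_le; [lra| | |].
  - apply (ex_RInt_cont (fun x => Rabs _)). intros x.
    apply (continuous_comp _ Rabs); [apply Hc|apply continuous_Rabs].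
  - apply ex_RInt_cont. intros x. apply (continuous_mult (fun th => th) (rho t M)).
    + apply continuous_id.
    + apply continuous_rho. lra.
  - intros x Hx. unfold integrand, minus, plus, opp. simpl.
    pose proof (rho_pos t M x ltac:(lra)).
    replace (rho t M x * cos (phase t M x - IZR n * x) + - (rho t M x * cos (phase t M x - IZR (n - 1) * x)))
      with (rho t M x * (cos (phase t M x - IZR n * x) - cos (phase t M x - IZR (n - 1) * x))) by ring.
    rewrite Rabs_mult, Rabs_right, Rmult_comm by lra.
    apply Rmult_le_compat_r; [lra|].
    eapply Rle_trans; [apply abs_cos_minus_le|].
    rewrite minus_IZR. replace (phase t M x - IZR n * x - (phase t M x - (IZR n - 1) * x)) with (- x) by ring.
    rewrite Rabs_Ropp, Rabs_right; lra.
Qed.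

(** * The integral near zero: modulus from below and linear phase *)

Lemma rsum_exp_le s M : 0 < s -> rsum (fun k => exp (- (INR (S k) * s))) M <= / s.
Proof.
  intros Hs.
  assert (H : rsum (fun k => exp (- (INR (S k) * s))) M <= (1 - exp (- (INR M * s))) / s).
  { induction M; cbn [rsum].
    - simpl. rewrite Rmult_0_l, Ropp_0, exp_0. right. field. lra.
    - eapply Rle_trans; [apply Rplus_le_compat_r, IHM|].
      rewrite S_INR. set (E := exp (- ((INR M + 1) * s))).
      assert (E1 : exp (- (INR M * s)) = E * exp s) by (unfold E; rewrite <- exp_plus; f_equal; ring).
      rewrite E1. assert (0 < E) by apply exp_pos. pose proof (exp_ineq1_le s).
      apply (Rmult_le_reg_r s); auto. field_simplify; [|lra|lra]. nra. }
  eapply Rle_trans; [exact H|]. pose proof (exp_pos (- (INR M * s))).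
  apply (Rmult_le_reg_r s); auto. field_simplify; lra.
Qed.

Lemma one_minus_exp_ge y : 0 < y -> y / (1 + y) <= 1 - exp (- y).
Proof.
  intros Hy. pose proof (exp_ineq1_le y). rewrite exp_Ropp.
  assert (/ exp y <= / (1 + y)) by (apply Rinv_le_contravar; lra).
  replace (y / (1 + y)) with (1 - / (1 + y)) by (field; lra). lra.
Qed.

Lemma inv_one_minus_exp y : 0 < y -> / (1 - exp (- y)) <= (1 + y) / y.
Proof.
  intros Hy. pose proof (one_minus_exp_ge y Hy).
  replace ((1 + y) / y) with (/ (y / (1 + y))) by (field; lra).
  apply Rinv_le_contravar; auto. apply Rdiv_lt_0_compat; lra.
Qed.

(** Half of the exponential absorbs the cube, via [1 + y <= 6 e^(y/6)]. The same cube serves the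
    modulus in [rho_lower] and the phase in [phase_linear]. *)
Lemma exp_decay y : 0 <= y -> exp (- y) * (1 + y) ^ 3 <= 216 * exp (- (y / 2)).
Proof.
  intros Hy. pose proof (exp_ineq1_le (y / 6)) as H.
  assert (H1 : (1 + y) ^ 3 <= (6 * exp (y / 6)) ^ 3) by (apply pow_incr; lra).
  assert (E : (6 * exp (y / 6)) ^ 3 = 216 * exp (y / 2)).
  { replace (y / 2) with (y / 6 + y / 6 + y / 6) by field. rewrite !exp_plus. ring. }
  rewrite E in H1. replace (- (y / 2)) with (- y + y / 2) by field. rewrite exp_plus.
  pose proof (exp_pos (- y)). nra.
Qed.

Lemma rr_cube_sum t M : 0 < t ->
  rsum (fun k => rr t (S k) * (1 + INR (S k) * t) ^ 3) M <= 432 / t.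
Proof.
  intros Ht.
  apply Rle_trans with (rsum (fun k => 216 * exp (- (INR (S k) * (t / 2)))) M).
  - apply rsum_le. intros k _. unfold rr.
    replace (INR (S k) * (t / 2)) with (INR (S k) * t / 2) by field.
    apply exp_decay. pose proof (pos_INR (S k)). nra.
  - rewrite rsum_scal. pose proof (rsum_exp_le (t / 2) M ltac:(lra)).
    replace (432 / t) with (216 * / (t / 2)) by (field; lra). lra.
Qed.

Lemma exp_ge_sqrt x : 0 <= x -> sqrt (1 + x) <= exp (x / 2).
Proof.
  intros Hx. rewrite <- (sqrt_square (exp (x / 2))) by (left; apply exp_pos).
  apply sqrt_le_1_alt. rewrite <- exp_plus. replace (x / 2 + x / 2) with x by field.
  apply exp_ineq1_le.
Qed.

(** The [k]-th denominator exceeds its value at 0 at most by the factor [sqrt (1 + x)] with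
    [x = theta^2/t^2 e^(-kt) (1 + kt)^3], because [1/(1 - e^(-kt)) <= (1 + kt)/(kt)]; and
    [sqrt (1 + x) <= e^(x/2)]. Hence the modulus stays comparable to its maximum for
    [theta = O(t^(3/2))]. *)
Lemma rho_lower t M th : 0 < t ->
  rho t M 0 * exp (- (216 * (th * th) / t ^ 3)) <= rho t M th.
Proof.
  intros Ht.
  set (x := fun k => th * th / (t * t) * (rr t (S k) * (1 + INR (S k) * t) ^ 3)).
  assert (H : rho t M 0 * exp (- (rsum x M / 2)) <= rho t M th).
  { induction M as [|M IH].
    - cbn. replace (- (0 / 2)) with 0 by field. rewrite exp_0. lra.
    - rewrite rho_0_S by auto. cbn [rho rsum].
      pose proof (rr_bounds t (S M) Ht ltac:(lia)) as Hr.
      pose proof (rho_pos t M 0 Ht) as H0.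
      pose proof (dsq_pos (rr t (S M)) (INR (S M) * th) Hr) as Hd.
      pose proof (sqrt_lt_R0 _ Hd) as HD.
      set (r := rr t (S M)) in *. set (D := sqrt (dsq r (INR (S M) * th))) in *.
      assert (Hy : 0 < INR (S M) * t) by (pose proof (lt_0_INR (S M) ltac:(lia)); nra).
      set (y := INR (S M) * t) in *.
      assert (Hx0 : 0 <= x M).
      { unfold x. fold r. fold y. apply Rmult_le_pos; [apply Rmult_le_pos; [nra|]|].
        - apply Rlt_le, Rinv_0_lt_compat; nra.
        - apply Rmult_le_pos; [lra|]. apply pow_le; lra. }
      assert (HDu : D <= (1 - r) * exp (x M / 2)).
      { apply Rle_trans with ((1 - r) * sqrt (1 + x M)).
        - rewrite <- (sqrt_square (1 - r)) by lra. rewrite <- sqrt_mult by nra.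
          unfold D. apply sqrt_le_1_alt. rewrite dsq_alt.
          pose proof (one_minus_cos_le (INR (S M) * th)) as Hc.
          pose proof (inv_one_minus_exp y Hy) as Hi. change (exp (- y)) with r in Hi.
          assert (Hi2 : 1 * y <= (1 - r) * (1 + y)).
          { apply (Rmult_le_compat_r (y * (1 - r))) in Hi; [|nra].
            field_simplify in Hi; [|lra|lra]. lra. }
          assert (Ey : y * y = (INR (S M) * INR (S M)) * (t * t)) by (unfold y; ring).
          assert (Hk : r * (INR (S M) * th * (INR (S M) * th)) <= (1 - r) * (1 - r) * x M).
          { unfold x. fold r. fold y.
            replace (r * (INR (S M) * th * (INR (S M) * th)))
              with (th * th / (t * t) * (r * (y * y))) by (rewrite Ey; field; lra).
            replace ((1 - r) * (1 - r) * (th * th / (t * t) * (r * (1 + y) ^ 3)))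
              with (th * th / (t * t) * (r * (((1 - r) * (1 + y)) * ((1 - r) * (1 + y)) * (1 + y)))) by ring.
            apply Rmult_le_compat_l.
            { apply Rmult_le_pos; [nra|]. apply Rlt_le, Rinv_0_lt_compat; nra. }
            apply Rmult_le_compat_l; [lra|].
            assert (y * y <= ((1 - r) * (1 + y)) * ((1 - r) * (1 + y))) by (apply Rmult_le_compat; lra).
            nra. }
          nra.
        - apply Rmult_le_compat_l; [lra|]. now apply exp_ge_sqrt. }
      replace (- ((rsum x M + x M) / 2)) with (- (rsum x M / 2) + - (x M / 2)) by field.
      rewrite exp_plus.
      replace (rho t M 0 * / (1 - r) * (exp (- (rsum x M / 2)) * exp (- (x M / 2))))
        with ((rho t M 0 * exp (- (rsum x M / 2))) * / ((1 - r) * exp (x M / 2))).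
      2:{ rewrite (exp_Ropp (x M / 2)). pose proof (exp_pos (x M / 2)). field. split; lra. }
      unfold Rdiv at 1. apply Rmult_le_compat; auto.
      + apply Rmult_le_pos; [lra|left; apply exp_pos].
      + apply Rlt_le, Rinv_0_lt_compat. apply Rmult_lt_0_compat; [lra|apply exp_pos].
      + now apply Rinv_le_contravar. }
  eapply Rle_trans; [|exact H]. apply Rmult_le_compat_l; [left; now apply rho_pos|].
  apply exp_le_compat, Ropp_le_contravar. unfold x. rewrite rsum_scal.
  pose proof (rr_cube_sum t M Ht) as Hs.
  assert (0 <= th * th / (t * t)) by (apply Rmult_le_pos; [nra|apply Rlt_le, Rinv_0_lt_compat; nra]).
  apply (Rmult_le_compat_l _ _ _ H0) in Hs.
  replace (216 * (th * th) / t ^ 3) with (th * th / (t * t) * (432 / t) / 2) by (field; lra). lra.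
Qed.

(** The derivative of [phase t M] at 0. The exact saddle point is where it equals [N]. *)
Definition mean (t : R) (M : nat) : R :=
  rsum (fun k => INR (S k) * (rr t (S k) / (1 - rr t (S k)))) M.

(** The slope of [arg r] at 0 is [r/(1-r)], and elsewhere it deviates from this by [O(psi^2)]
    because of the factor [1 - cos psi]; integration gives the cube. *)
Lemma arg_linear r psi : 0 < r < 1 -> 0 <= psi ->
  Rabs (arg r psi - psi * (r / (1 - r))) <= r / (1 - r) ^ 3 * psi ^ 3.
Proof.
  intros Hr Hp.
  assert (Hpos : 0 < r / (1 - r) ^ 3) by (apply Rdiv_lt_0_compat; [lra|apply pow_lt; lra]).
  assert (A0 : arg r 0 = 0) by (unfold arg; rewrite sin_0, Rmult_0_r; unfold Rdiv; rewrite Rmult_0_l; apply atan_0).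
  assert (Hd : forall x, (r * cos x - r * r) / dsq r x - r / (1 - r)
     = - (r * (1 + r) * (1 - cos x) / ((1 - r) * dsq r x))).
  { intros x. pose proof (dsq_pos r x Hr). unfold dsq in *. field. split; lra. }
  assert (Hdb : forall x, 0 <= x -> 0 <= r * (1 + r) * (1 - cos x) / ((1 - r) * dsq r x)
     <= r / (1 - r) ^ 3 * (3 * x ^ 2)).
  { intros x Hx. pose proof (dsq_pos r x Hr) as Hq. pose proof (COS_bound x).
    pose proof (one_minus_cos_le x). split.
    - apply Rmult_le_pos; [|apply Rlt_le, Rinv_0_lt_compat; nra].
      apply Rmult_le_pos; nra.
    - assert (Hge : (1 - r) * (1 - r) <= dsq r x) by (rewrite dsq_alt; nra).
      replace (r / (1 - r) ^ 3 * (3 * x ^ 2)) with (r * (3 * x ^ 2) * / ((1 - r) * ((1 - r) * (1 - r)))) by (field; lra).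
      unfold Rdiv. apply Rmult_le_compat.
      + apply Rmult_le_pos; nra.
      + apply Rlt_le, Rinv_0_lt_compat; nra.
      + rewrite !Rmult_assoc. apply Rmult_le_compat_l; [lra|]. nra.
      + apply Rinv_le_contravar; [|nra]. apply Rmult_lt_0_compat; nra. }
  assert (U : 0 <= psi * (r / (1 - r)) - arg r psi).
  { pose proof (derive_nonneg_incr (fun x => x * (r / (1 - r)) - arg r x)
      (fun x => r / (1 - r) - (r * cos x - r * r) / dsq r x) 0 psi Hp) as H.
    cbv beta in H. rewrite A0 in H.
    assert (0 * (r / (1 - r)) - 0 <= psi * (r / (1 - r)) - arg r psi); [|lra].
    apply H.
    - intros x _. apply (is_derive_minus (fun x => x * (r / (1 - r))) (arg r)).
      + generalize (r / (1 - r)); intros v. auto_derive; auto. ring.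
      + now apply is_derive_arg.
    - intros x Hx. pose proof (Hd x). pose proof (Hdb x ltac:(lra)). lra. }
  assert (L : psi * (r / (1 - r)) - arg r psi <= r / (1 - r) ^ 3 * psi ^ 3).
  { pose proof (derive_nonneg_incr (fun x => r / (1 - r) ^ 3 * x ^ 3 - (x * (r / (1 - r)) - arg r x))
      (fun x => r / (1 - r) ^ 3 * (3 * x ^ 2) - (r / (1 - r) - (r * cos x - r * r) / dsq r x)) 0 psi Hp) as H.
    cbv beta in H. rewrite A0 in H.
    assert (r / (1 - r) ^ 3 * 0 ^ 3 - (0 * (r / (1 - r)) - 0)
      <= r / (1 - r) ^ 3 * psi ^ 3 - (psi * (r / (1 - r)) - arg r psi)); [|simpl in *; lra].
    apply H.
    - intros x _.
      apply (is_derive_minus (fun x => r / (1 - r) ^ 3 * x ^ 3) (fun x => x * (r / (1 - r)) - arg r x)).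
      + generalize (r / (1 - r) ^ 3); intros v. auto_derive; auto. ring.
      + apply (is_derive_minus (fun x => x * (r / (1 - r))) (arg r)).
        * generalize (r / (1 - r)); intros v. auto_derive; auto. ring.
        * now apply is_derive_arg.
    - intros x Hx. pose proof (Hd x). pose proof (Hdb x ltac:(lra)). lra. }
  rewrite Rabs_left1; lra.
Qed.

Lemma phase_linear t M th : 0 < t -> 0 <= th ->
  Rabs (phase t M th - mean t M * th) <= 432 * th ^ 3 / t ^ 4.
Proof.
  intros Ht Hth. unfold phase, mean.
  rewrite (Rmult_comm (rsum _ _) th), <- rsum_scal, <- rsum_minus.
  eapply Rle_trans; [apply rsum_abs|].
  apply Rle_trans with (rsum (fun k => th ^ 3 / t ^ 3 * (rr t (S k) * (1 + INR (S k) * t) ^ 3)) M).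
  - apply rsum_le. intros k _.
    pose proof (rr_bounds t (S k) Ht ltac:(lia)) as Hr.
    assert (Hk : 0 < INR (S k)) by (apply lt_0_INR; lia).
    replace (th * (INR (S k) * (rr t (S k) / (1 - rr t (S k)))))
      with (INR (S k) * th * (rr t (S k) / (1 - rr t (S k)))) by ring.
    eapply Rle_trans; [apply arg_linear; auto; apply Rmult_le_pos; lra|].
    pose proof (inv_one_minus_exp (INR (S k) * t) ltac:(apply Rmult_lt_0_compat; lra)) as Hi.
    change (exp (- (INR (S k) * t))) with (rr t (S k)) in Hi.
    set (r := rr t (S k)) in *. set (n := INR (S k)) in *.
    assert (Hi3 : (/ (1 - r)) ^ 3 <= ((1 + n * t) / (n * t)) ^ 3).
    { apply pow_incr. split; auto. apply Rlt_le, Rinv_0_lt_compat; lra. }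
    replace (r / (1 - r) ^ 3 * (n * th) ^ 3) with (r * (n * th) ^ 3 * (/ (1 - r)) ^ 3) by (field; lra).
    replace (th ^ 3 / t ^ 3 * (r * (1 + n * t) ^ 3))
      with (r * (n * th) ^ 3 * ((1 + n * t) / (n * t)) ^ 3) by (field; lra).
    apply Rmult_le_compat_l; auto. apply Rmult_le_pos; [lra|]. apply pow_le, Rmult_le_pos; lra.
  - rewrite rsum_scal. pose proof (rr_cube_sum t M Ht) as Hs.
    assert (0 <= th ^ 3 / t ^ 3)
      by (apply Rmult_le_pos; [apply pow_le; lra|apply Rlt_le, Rinv_0_lt_compat, pow_lt; lra]).
    apply (Rmult_le_compat_l _ _ _ H) in Hs. eapply Rle_trans; [exact Hs|]. right. field. lra.
Qed.

Lemma two_sinh_ge u : 0 <= u -> 2 * u <= exp u - exp (- u).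
Proof.
  intros Hu.
  pose proof (derive_nonneg_incr (fun x => exp x - exp (- x) - 2 * x) (fun x => exp x + exp (- x) - 2) 0 u Hu) as H.
  cbv beta in H. rewrite Ropp_0, exp_0 in H.
  assert (1 - 1 - 2 * 0 <= exp u - exp (- u) - 2 * u); [|lra]. apply H.
  - intros x _. auto_derive; auto. ring.
  - intros x _. rewrite exp_Ropp. pose proof (exp_pos x).
    replace (exp x + / exp x - 2) with ((exp x - 1) * (exp x - 1) / exp x) by (field; lra).
    apply Rmult_le_pos; [apply Rle_0_sqr|]. apply Rlt_le, Rinv_0_lt_compat; auto.
Qed.

(** Three integrations starting from [e^x + e^(-x) <= 6] on [[0,1]]. *)
Lemma two_sinh_le u : 0 <= u <= 1 -> exp u - exp (- u) <= 2 * u + u ^ 3.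
Proof.
  intros Hu. pose proof exp_le_3 as E3.
  assert (H2 : forall x, 0 <= x <= 1 -> exp x + exp (- x) <= 6).
  { intros x Hx. pose proof (exp_le_compat x 1 ltac:(lra)).
    pose proof (exp_le_compat (- x) 0 ltac:(lra)). rewrite exp_0 in *. lra. }
  assert (H1 : forall x, 0 <= x <= 1 -> exp x - exp (- x) <= 6 * x).
  { intros x Hx.
    pose proof (derive_nonneg_incr (fun x => 6 * x - (exp x - exp (- x))) (fun x => 6 - (exp x + exp (- x))) 0 x ltac:(lra)) as H.
    cbv beta in H. rewrite Ropp_0, exp_0 in H.
    assert (6 * 0 - (1 - 1) <= 6 * x - (exp x - exp (- x))); [|lra]. apply H.
    - intros y _. auto_derive; auto. ring.
    - intros y Hy. pose proof (H2 y ltac:(lra)). lra. }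
  assert (H0 : forall x, 0 <= x <= 1 -> exp x + exp (- x) <= 2 + 3 * x ^ 2).
  { intros x Hx.
    pose proof (derive_nonneg_incr (fun x => 2 + 3 * x ^ 2 - (exp x + exp (- x))) (fun x => 6 * x - (exp x - exp (- x))) 0 x ltac:(lra)) as H.
    cbv beta in H. rewrite Ropp_0, exp_0 in H.
    assert (2 + 3 * 0 ^ 2 - (1 + 1) <= 2 + 3 * x ^ 2 - (exp x + exp (- x))); [|simpl in *; lra]. apply H.
    - intros y _. auto_derive; auto. ring.
    - intros y Hy. pose proof (H1 y ltac:(lra)). lra. }
  pose proof (derive_nonneg_incr (fun x => 2 * x + x ^ 3 - (exp x - exp (- x))) (fun x => 2 + 3 * x ^ 2 - (exp x + exp (- x))) 0 u ltac:(lra)) as H.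
  cbv beta in H. rewrite Ropp_0, exp_0 in H.
  assert (2 * 0 + 0 ^ 3 - (1 - 1) <= 2 * u + u ^ 3 - (exp u - exp (- u))); [|simpl in *; lra]. apply H.
  - intros y _. auto_derive; auto. ring.
  - intros y Hy. pose proof (H0 y ltac:(lra)). lra.
Qed.

(** The left side is the sum of [k e^(-ky)] over all [k >= 1]; in the form [1/(2 sinh(y/2))^2] it
    can be compared with [1/y^2]. *)
Lemma exp_over_sq y : 0 < y ->
  exp (- y) / ((1 - exp (- y)) * (1 - exp (- y)))
  = / ((exp (y / 2) - exp (- (y / 2))) * (exp (y / 2) - exp (- (y / 2)))).
Proof.
  intros Hy. pose proof (two_sinh_ge (y / 2) ltac:(lra)) as Hs.
  set (a := exp (y / 2)) in *. assert (Ha : 0 < a) by apply exp_pos.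
  assert (E1 : exp (- (y / 2)) = / a) by (unfold a; apply exp_Ropp).
  assert (E2 : exp (- y) = / a * / a) by (rewrite <- E1, <- exp_plus; f_equal; field).
  rewrite E1 in *. rewrite E2.
  assert (a * / a = 1) by (field; lra).
  assert (1 < a * a) by nra.
  field. repeat split; nra.
Qed.

Lemma exp_over_sq_upper y : 0 < y ->
  exp (- y) / ((1 - exp (- y)) * (1 - exp (- y))) <= / (y * y).
Proof.
  intros Hy. rewrite exp_over_sq by auto. pose proof (two_sinh_ge (y / 2) ltac:(lra)).
  apply Rinv_le_contravar; nra.
Qed.

Lemma exp_over_sq_lower y : 0 < y <= 1 ->
  / (y * y) - / 4 <= exp (- y) / ((1 - exp (- y)) * (1 - exp (- y))).
Proof.
  intros Hy. rewrite exp_over_sq by lra. pose proof (two_sinh_ge (y / 2) ltac:(lra)).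
  pose proof (two_sinh_le (y / 2) ltac:(lra)) as H1.
  set (d := exp (y / 2) - exp (- (y / 2))) in *.
  assert (Hd : d <= y * (1 + y * y / 8)) by lra.
  apply Rle_trans with (/ ((y * (1 + y * y / 8)) * (y * (1 + y * y / 8)))).
  - set (w := 1 + y * y / 8). assert (Hw : 1 <= w) by (unfold w; nra).
    apply (Rmult_le_reg_r (y * w * (y * w))); [apply Rmult_lt_0_compat; nra|].
    rewrite Rinv_l by (apply Rgt_not_eq, Rmult_lt_0_compat; nra).
    replace ((/ (y * y) - / 4) * (y * w * (y * w))) with (w * w * (1 - y * y / 4)) by (field; lra).
    unfold w. set (z := y * y). assert (0 <= z) by (unfold z; nra).
    assert ((1 + z / 8) * (1 + z / 8) * (1 - z / 4) = 1 - 3 * z * z / 64 - z * z * z / 256) by field.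
    assert (0 <= z * z) by nra. assert (0 <= z * z * z) by nra. lra.
  - apply Rinv_le_contravar; [nra|]. apply Rmult_le_compat; lra.
Qed.

Lemma exp_neg_sq z : 0 < z -> exp (- z) <= 4 / (z * z).
Proof.
  intros Hz. rewrite exp_Ropp. replace (4 / (z * z)) with (/ (z / 2 * (z / 2))) by (field; lra).
  apply Rinv_le_contravar; [nra|].
  replace z with (z / 2 + z / 2) at 3 by field. rewrite exp_plus.
  pose proof (exp_ineq1_le (z / 2)). apply Rmult_le_compat; lra.
Qed.

Lemma arith_geom_sum y M : 0 < y ->
  rsum (fun k => INR (S k) * exp (- (INR (S k) * y))) M
  = exp (- y) / ((1 - exp (- y)) * (1 - exp (- y)))
    - exp (- (INR M * y)) * exp (- y) * (INR M * (1 - exp (- y)) + 1)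
      / ((1 - exp (- y)) * (1 - exp (- y))).
Proof.
  intros Hy. assert (Hx : exp (- y) < 1) by (rewrite <- exp_0; apply exp_increasing; lra).
  induction M; cbn [rsum].
  - simpl. rewrite Rmult_0_l, Ropp_0, exp_0. field. lra.
  - rewrite IHM, S_INR.
    replace (exp (- ((INR M + 1) * y))) with (exp (- (INR M * y)) * exp (- y))
      by (rewrite <- exp_plus; f_equal; ring).
    field. lra.
Qed.

Lemma arith_geom_upper y M : 0 < y ->
  rsum (fun k => INR (S k) * exp (- (INR (S k) * y))) M <= / (y * y).
Proof.
  intros Hy. rewrite arith_geom_sum by auto.
  assert (Hx : exp (- y) < 1) by (rewrite <- exp_0; apply exp_increasing; lra).
  pose proof (exp_over_sq_upper y Hy). pose proof (exp_pos (- y)). pose proof (exp_pos (- (INR M * y))).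
  pose proof (pos_INR M).
  assert (0 <= exp (- (INR M * y)) * exp (- y) * (INR M * (1 - exp (- y)) + 1)
      / ((1 - exp (- y)) * (1 - exp (- y)))); [|lra].
  apply Rmult_le_pos; [|apply Rlt_le, Rinv_0_lt_compat; nra].
  apply Rmult_le_pos; [nra|]. nra.
Qed.

(** The loss is [1/4] from [exp_over_sq_lower] and at most 1 from cutting the sum at [M], which the
    bound on [M y^4] guarantees. *)
Lemma arith_geom_lower y M : 0 < y <= 1 -> 32 <= INR M * y ^ 4 ->
  / (y * y) - 5 / 4 <= rsum (fun k => INR (S k) * exp (- (INR (S k) * y))) M.
Proof.
  intros Hy HM. rewrite arith_geom_sum by lra.
  assert (Hx : exp (- y) < 1) by (rewrite <- exp_0; apply exp_increasing; lra).
  pose proof (exp_over_sq_lower y Hy) as H1. pose proof (exp_pos (- y)) as H2.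
  pose proof (pow_lt y 4 ltac:(lra)) as Hy4.
  assert (Hy41 : y ^ 4 <= 1) by (rewrite <- (pow1 4); apply pow_incr; lra).
  assert (HM1 : 1 <= INR M) by nra.
  pose proof (exp_neg_sq (INR M * y) ltac:(nra)) as H3. pose proof (exp_pos (- (INR M * y))) as H4.
  pose proof (inv_one_minus_exp y ltac:(lra)) as H5.
  set (x := exp (- y)) in *. set (E := exp (- (INR M * y))) in *.
  assert (H6 : / ((1 - x) * (1 - x)) <= 4 / (y * y)).
  { rewrite Rinv_mult. apply Rle_trans with ((1 + y) / y * ((1 + y) / y)).
    - assert (0 < / (1 - x)) by (apply Rinv_0_lt_compat; lra). apply Rmult_le_compat; lra.
    - replace ((1 + y) / y * ((1 + y) / y)) with ((1 + y) * (1 + y) * / (y * y)) by (field; lra).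
      unfold Rdiv. apply Rmult_le_compat_r; [apply Rlt_le, Rinv_0_lt_compat; nra|nra]. }
  assert (H7 : E * x * (INR M * (1 - x) + 1) / ((1 - x) * (1 - x)) <= 1); [|lra].
  apply Rle_trans with (4 / (INR M * y * (INR M * y)) * (2 * INR M) * (4 / (y * y))).
  - unfold Rdiv at 1. apply Rmult_le_compat; auto.
    + apply Rmult_le_pos; [nra|]. nra.
    + apply Rlt_le, Rinv_0_lt_compat; nra.
    + apply Rmult_le_compat; [nra|nra| |nra]. nra.
  - replace (4 / (INR M * y * (INR M * y)) * (2 * INR M) * (4 / (y * y)))
      with (32 / (INR M * y ^ 4)) by (field; lra).
    apply (Rmult_le_reg_r (INR M * y ^ 4)); [lra|]. unfold Rdiv.
    rewrite Rmult_assoc, Rinv_l by lra. lra.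
Qed.

Lemma rr_pow t k n : rr t k ^ n = exp (- (INR k * (INR n * t))).
Proof.
  induction n.
  - simpl. rewrite Rmult_0_l, Rmult_0_r, Ropp_0, exp_0. reflexivity.
  - rewrite S_INR. cbn [pow]. rewrite IHn. unfold rr. rewrite <- exp_plus. f_equal. ring.
Qed.

Lemma geom_split r L : 0 < r < 1 ->
  r / (1 - r) = rsum (fun m => r ^ S m) L + r ^ L * (r / (1 - r)).
Proof.
  intros Hr. induction L.
  - simpl. ring.
  - cbn [rsum]. rewrite IHL at 1. cbn [pow]. field. lra.
Qed.

(** Expanding [L] terms of each geometric series and exchanging the sums leaves inner sums close to
    [1/(mt)^2], so the mean is close to [zeta(2)/t^2]. The expansion stops at a finite [L] because
    the lower bound for an inner sum needs [mt <= 1]. *)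
Lemma mean_split t M L : 0 < t ->
  mean t M = rsum (fun m => rsum (fun k => INR (S k) * exp (- (INR (S k) * (INR (S m) * t)))) M) L
    + rsum (fun k => INR (S k) * (rr t (S k) ^ L * (rr t (S k) / (1 - rr t (S k))))) M.
Proof.
  intros Ht. rewrite rsum_exchange, <- rsum_plus. apply rsum_ext. intros k _.
  rewrite (geom_split _ L) at 1 by (apply rr_bounds; auto; lia).
  rewrite Rmult_plus_distr_l. f_equal.
  rewrite <- rsum_scal. apply rsum_ext. intros m _. now rewrite rr_pow.
Qed.

Lemma inv_sq_scaled t L : 0 < t ->
  rsum (fun m => / (INR (S m) * t * (INR (S m) * t))) L = inv_sq L / (t * t).
Proof.
  intros Ht. unfold inv_sq, Rdiv. rewrite Rmult_comm, <- rsum_scal. apply rsum_ext.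
  intros m _. rewrite S_INR. pose proof (pos_INR m). field. lra.
Qed.

Lemma mean_bounds t M : 0 < t <= / 4 -> 32 <= INR M * t ^ 4 ->
  Rabs (mean t M - PI * PI / (6 * (t * t))) <= 4 / t.
Proof.
  intros Ht HM.
  assert (Hx : 0 <= / t) by (apply Rlt_le, Rinv_0_lt_compat; lra).
  (* With the floor of [1/t] as [L], the Basel tail [1/(L t^2)], the [L] losses of [5/4] and the
     remainder of the geometric series are all [O(1/t)]. *)
  destruct (nfloor_ex (/ t) Hx) as [L [HL1 HL2]].
  assert (Hti : t * / t = 1) by (field; lra).
  assert (Ha : INR L * t <= 1) by nra.
  assert (Hb : 3 / 4 <= INR L * t) by nra.
  assert (HL : (1 <= L)%nat) by (destruct L; [simpl in Hb; lra|lia]).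
  assert (HL0 : 0 < INR L) by (apply lt_0_INR; lia).
  assert (Htt : 0 < / (t * t)) by (apply Rinv_0_lt_compat; nra).
  rewrite (mean_split t M L) by lra.
  set (S1 := rsum (fun m => rsum _ M) L). set (S2 := rsum _ M).
  assert (U1 : S1 <= PI * PI / (6 * (t * t))).
  { apply Rle_trans with (rsum (fun m => / (INR (S m) * t * (INR (S m) * t))) L).
    - apply rsum_le. intros m _. apply arith_geom_upper.
      pose proof (lt_0_INR (S m) ltac:(lia)). nra.
    - rewrite inv_sq_scaled by lra. pose proof (basel_upper L).
      replace (PI * PI / (6 * (t * t))) with (PI * PI / 6 * / (t * t)) by (field; lra).
      apply Rmult_le_compat_r; lra. }
  assert (L1 : PI * PI / (6 * (t * t)) - 4 / 3 / t - 5 / 4 / t <= S1).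
  { apply Rle_trans with (rsum (fun m => / (INR (S m) * t * (INR (S m) * t)) - 5 / 4) L).
    - rewrite rsum_minus, rsum_const, inv_sq_scaled by lra.
      pose proof (basel_lower L HL) as HB.
      apply (Rmult_le_compat_r (/ (t * t))) in HB; [|lra].
      assert (/ INR L * / (t * t) <= 4 / 3 / t).
      { replace (/ INR L * / (t * t)) with (/ (INR L * t) * / t) by (field; lra).
        unfold Rdiv. apply Rmult_le_compat_r; [lra|].
        replace (4 * / 3) with (/ (3 / 4)) by field. apply Rinv_le_contravar; lra. }
      replace (PI * PI / (6 * (t * t))) with (PI * PI / 6 * / (t * t)) by (field; lra).
      unfold Rdiv in *. nra.
    - apply rsum_le. intros m Hm.
      assert (1 <= INR (S m)) by (change 1 with (INR 1); apply le_INR; lia).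
      assert (INR (S m) <= INR L) by (apply le_INR; lia).
      apply arith_geom_lower; [split; nra|].
      eapply Rle_trans; [exact HM|]. apply Rmult_le_compat_l; [apply pos_INR|].
      apply pow_incr. nra. }
  assert (L2 : 0 <= S2).
  { apply rsum_nonneg. intros k _. pose proof (rr_bounds t (S k) ltac:(lra) ltac:(lia)).
    apply Rmult_le_pos; [apply pos_INR|]. apply Rmult_le_pos; [apply pow_le; lra|].
    apply Rlt_le, Rdiv_lt_0_compat; lra. }
  assert (U2 : S2 <= 4 / 3 / t).
  { apply Rle_trans with (rsum (fun k => / t * exp (- (INR (S k) * (INR L * t)))) M).
    - apply rsum_le. intros k _. rewrite rr_pow.
      pose proof (rr_bounds t (S k) ltac:(lra) ltac:(lia)) as Hr.
      pose proof (exp_pos (- (INR (S k) * (INR L * t)))).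
      assert (INR (S k) * (rr t (S k) / (1 - rr t (S k))) <= / t).
      { assert (Hy : 0 < INR (S k) * t) by (pose proof (lt_0_INR (S k) ltac:(lia)); nra).
        unfold rr in *. set (y := INR (S k) * t) in *.
        pose proof (exp_ineq1_le y) as He. rewrite exp_Ropp in *.
        pose proof (exp_pos y).
        replace (/ exp y / (1 - / exp y)) with (/ (exp y - 1)) by (field; split; lra).
        apply (Rmult_le_reg_r (t * (exp y - 1))); [nra|].
        replace (INR (S k) * / (exp y - 1) * (t * (exp y - 1))) with (INR (S k) * t) by (field; lra).
        fold y.
        replace (/ t * (t * (exp y - 1))) with (exp y - 1) by (field; lra). lra. }
      nra.
    - rewrite rsum_scal. pose proof (rsum_exp_le (INR L * t) M ltac:(lra)) as He.
      assert (/ (INR L * t) <= / (3 / 4)) by (apply Rinv_le_contravar; lra).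
      replace (4 / 3 / t) with (/ t * (/ (3 / 4))) by (field; lra).
      apply Rmult_le_compat_l; lra. }
  unfold Rdiv in *. apply Rabs_le. lra.
Qed.

Lemma cos_ge_half x : Rabs x <= 1 -> / 2 <= cos x.
Proof.
  intros H. pose proof (one_minus_cos_le x). apply Rabs_le_between in H. nra.
Qed.

(** With [d = t^(3/2)] the range is split at [d] and [Bd]. On [[0, d]] the modulus is at least
    [e^(-216)] times its maximum and the cosine at least [1/2]; on [[d, Bd]] only the sign of the
    cosine is used; beyond [Bd] the first moment controls the integral. *)
Lemma fourier_lower : exists c t0, 0 < c /\ 0 < t0 <= / 4 /\
  forall t M N, 0 < t <= t0 -> 32 <= INR M * t ^ 4 -> IZR N = PI * PI / (6 * (t * t)) ->
  c * (t * sqrt t) * rho t M 0 <= fourier t M N.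
Proof.
  (* Chosen so that the bound [mom_c t^3/(Bd)] for the tail is half of the contribution
     [d e^(-216)/2] of [[0, d]], both relative to the maximum of the modulus. *)
  set (B := 4 * mom_c * exp 216).
  assert (HB : 1 <= B).
  { pose proof (exp_ineq1_le 216). unfold B, mom_c. lra. }
  (* On [[0, Bd]] the phase is at most [A sqrt t]: [432 B^3 sqrt t] from its nonlinearity and
     [4 B sqrt t] from the error of the mean. Hence [t <= 1/A^2] keeps it below 1. *)
  set (A := 432 * B ^ 3 + 4 * B). assert (HA : 4 <= A).
  { pose proof (pow_le B 3 ltac:(lra)). unfold A. lra. }
  exists (exp (- 216) / 4), (/ (A * A)).
  assert (HA2 : 4 <= A * A) by nra.
  split; [apply Rdiv_lt_0_compat; [apply exp_pos|lra]|].
  split; [split; [apply Rinv_0_lt_compat; nra|apply Rinv_le_contravar; nra]|].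
  intros t M N Ht HM HN.
  assert (Ht4 : t <= / 4).
  { apply Rle_trans with (/ (A * A)); [lra|]. apply Rinv_le_contravar; nra. }
  assert (Hs : 0 < sqrt t) by (apply sqrt_lt_R0; lra).
  assert (Hss : sqrt t * sqrt t = t) by (apply sqrt_sqrt; lra).
  assert (HsA : A * sqrt t <= 1).
  { apply Rsqr_incr_0_var; [|lra]. unfold Rsqr.
    replace (A * sqrt t * (A * sqrt t)) with (A * A * t) by (rewrite <- Hss at 1; ring).
    destruct Ht as [_ Ht]. apply (Rmult_le_compat_l (A * A)) in Ht; [|lra].
    rewrite Rinv_r in Ht by lra. lra. }
  set (d := t * sqrt t).
  assert (Hd : 0 < d) by (unfold d; nra).
  assert (Hd2 : d * d = t ^ 3) by (unfold d; replace (t ^ 3) with (t * t * (sqrt t * sqrt t)) by (rewrite Hss; ring); ring).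
  pose proof PI_RGT_0 as Hpi. pose proof PI2_3_2 as Hpi3.
  assert (HBd : B * d <= 1).
  { unfold d. assert (4 * B <= A) by (pose proof (pow_le B 3 ltac:(lra)); unfold A; lra).
    assert (B * sqrt t <= 1) by nra. nra. }
  pose proof (rho_pos t M 0 ltac:(lra)) as Hr0.
  assert (HM1 : 1 <= INR M * t).
  { assert (t ^ 4 <= t).
    { replace (t ^ 4) with (t * (t * t * t)) by ring. assert (t * t * t <= 1) by nra. nra. }
    pose proof (pos_INR M). nra. }
  assert (Hph : forall th, 0 <= th <= B * d -> Rabs (phase t M th - IZR N * th) <= 1).
  { intros th Hth.
    pose proof (phase_linear t M th ltac:(lra) ltac:(lra)) as H1.
    pose proof (mean_bounds t M ltac:(lra) HM) as H2. rewrite <- HN in H2.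
    replace (phase t M th - IZR N * th) with ((phase t M th - mean t M * th) + (mean t M - IZR N) * th) by ring.
    eapply Rle_trans; [apply Rabs_triang|]. rewrite Rabs_mult, (Rabs_right th) by lra.
    assert (H3 : Rabs (mean t M - IZR N) * th <= 4 / t * (B * d)).
    { apply Rmult_le_compat; try lra. apply Rabs_pos. }
    assert (H4 : 432 * th ^ 3 / t ^ 4 <= 432 * (B * d) ^ 3 / t ^ 4).
    { unfold Rdiv. apply Rmult_le_compat_r; [apply Rlt_le, Rinv_0_lt_compat, pow_lt; lra|].
      apply Rmult_le_compat_l; [lra|]. apply pow_incr; lra. }
    assert (E1 : 432 * (B * d) ^ 3 / t ^ 4 = 432 * B ^ 3 * sqrt t).
    { replace ((B * d) ^ 3) with (B ^ 3 * (d * d) * d) by ring. rewrite Hd2. unfold d. field. lra. }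
    assert (E2 : 4 / t * (B * d) = 4 * B * sqrt t) by (unfold d; field; lra).
    rewrite E1 in H4. rewrite E2 in H3. unfold A in HsA. lra. }
  assert (Cint : forall a b, ex_RInt (integrand t M (IZR N)) a b)
    by (intros; apply ex_RInt_cont; intros; apply continuous_integrand; lra).
  assert (Cmom : forall a b, ex_RInt (fun th => th * rho t M th) a b).
  { intros. apply ex_RInt_cont. intros x. apply (continuous_mult (fun th => th) (rho t M)).
    - apply continuous_id.
    - apply continuous_rho. lra. }
  assert (Hdb : d <= B * d) by nra.
  assert (Hsplit : fourier t M N = RInt (integrand t M (IZR N)) 0 d
     + RInt (integrand t M (IZR N)) d (B * d) + RInt (integrand t M (IZR N)) (B * d) PI).
  { unfold fourier. rewrite <- (RInt_Chasles (V := R_CompleteNormedModule) _ 0 (B * d) PI) by apply Cint.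
    rewrite <- (RInt_Chasles (V := R_CompleteNormedModule) _ 0 d (B * d)) by apply Cint. reflexivity. }
  assert (I1 : d * (rho t M 0 * exp (- 216) / 2) <= RInt (integrand t M (IZR N)) 0 d).
  { replace (d * (rho t M 0 * exp (- 216) / 2)) with (RInt (fun _ => rho t M 0 * exp (- 216) / 2) 0 d).
    2:{ rewrite RInt_const. unfold scal; simpl; unfold mult; simpl. ring. }
    apply RInt_le; [lra|apply ex_RInt_const|apply Cint|].
    intros th Hth. unfold integrand.
    pose proof (cos_ge_half _ (Hph th ltac:(lra))) as Hc.
    pose proof (rho_lower t M th ltac:(lra)) as Hl.
    assert (rho t M 0 * exp (- 216) <= rho t M th).
    { eapply Rle_trans; [|exact Hl]. apply Rmult_le_compat_l; [lra|].
      apply exp_le_compat.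
      assert (216 * (th * th) / t ^ 3 <= 216); [|lra].
      assert (th * th <= t ^ 3) by (rewrite <- Hd2; nra).
      pose proof (pow_lt t 3 ltac:(lra)).
      apply (Rmult_le_reg_r (t ^ 3)); auto. unfold Rdiv. rewrite Rmult_assoc, Rinv_l by lra. lra. }
    pose proof (exp_pos (- 216)).
    assert (0 < rho t M 0 * exp (- 216)) by (apply Rmult_lt_0_compat; lra).
    apply Rle_trans with (rho t M th * / 2); [lra|]. apply Rmult_le_compat_l; lra. }
  assert (I2 : 0 <= RInt (integrand t M (IZR N)) d (B * d)).
  { apply RInt_ge_0; [lra|apply Cint|]. intros th Hth. unfold integrand.
    pose proof (cos_ge_half _ (Hph th ltac:(lra))) as Hc.
    pose proof (rho_pos t M th ltac:(lra)). apply Rmult_le_pos; lra. }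
  (* Markov's inequality: here [theta/(Bd) >= 1]. *)
  assert (I3 : Rabs (RInt (integrand t M (IZR N)) (B * d) PI) <= / (B * d) * (rho t M 0 * (mom_c * t ^ 3))).
  { eapply Rle_trans; [apply abs_RInt_le; [lra|apply Cint]|].
    apply Rle_trans with (RInt (fun th => / (B * d) * (th * rho t M th)) (B * d) PI).
    - apply RInt_le; [lra| | |].
      + apply (ex_RInt_cont (fun x => Rabs _)). intros x.
        apply (continuous_comp _ Rabs); [apply continuous_integrand; lra|apply continuous_Rabs].
      + apply (ex_RInt_scal (V := R_CompleteNormedModule) (fun th => th * rho t M th)). apply Cmom.
      + intros th Hth. unfold integrand. pose proof (rho_pos t M th ltac:(lra)) as Hr.
        rewrite Rabs_mult, Rabs_right by lra.
        pose proof (COS_bound (phase t M th - IZR N * th)).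
        assert (Rabs (cos (phase t M th - IZR N * th)) <= 1) by (apply Rabs_le; lra).
        assert (1 <= / (B * d) * th).
        { apply (Rmult_le_reg_l (B * d)); [nra|]. rewrite <- Rmult_assoc, Rinv_r by nra. lra. }
        apply Rle_trans with (rho t M th * 1); [apply Rmult_le_compat_l; lra|].
        rewrite <- Rmult_assoc. rewrite Rmult_comm. apply Rmult_le_compat_r; lra.
    - rewrite (RInt_scal (V := R_CompleteNormedModule) (fun th => th * rho t M th)) by apply Cmom.
      unfold scal; simpl; unfold mult; simpl.
      apply Rmult_le_compat_l; [apply Rlt_le, Rinv_0_lt_compat; nra|].
      eapply Rle_trans; [|apply (rho_moment t M ltac:(lra) HM1)].
      rewrite <- (RInt_Chasles (V := R_CompleteNormedModule) _ 0 (B * d) PI) by apply Cmom.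
      assert (0 <= RInt (fun th => th * rho t M th) 0 (B * d)).
      { apply RInt_ge_0; [nra|apply Cmom|]. intros th Hth. pose proof (rho_pos t M th ltac:(lra)). apply Rmult_le_pos; lra. }
      unfold plus; simpl. lra. }
  assert (E3 : / (B * d) * (rho t M 0 * (mom_c * t ^ 3)) = rho t M 0 * d * (exp (- 216) / 4)).
  { rewrite <- Hd2. unfold B. replace (exp (-216)) with (/ exp 216) by (rewrite <- exp_Ropp; f_equal; lra).
    pose proof (exp_pos 216).
    field. unfold mom_c. repeat split; lra. }
  rewrite E3 in I3. apply Rabs_le_between in I3. rewrite Hsplit. fold d. lra.
Qed.

Lemma IZR_pz_nonneg n : 0 <= IZR (pz n).
Proof. apply IZR_le. unfold pz. destruct (n <? 0)%Z; lia. Qed.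

Lemma partition_increment : exists C t0, 0 < C /\ 0 < t0 <= / 4 /\
  forall (N : nat) t, 0 < t <= t0 -> INR N = PI * PI / (6 * (t * t)) ->
  0 < IZR (pz (Z.of_nat N)) /\
  forall k : nat,
  Rabs (IZR (pz (Z.of_nat N - Z.of_nat k)) * exp (INR k * t)
        - IZR (pz (Z.of_nat N - Z.of_nat k - 1)) * exp ((INR k + 1) * t))
  <= C * (t * sqrt t) * IZR (pz (Z.of_nat N)).
Proof.
  destruct fourier_lower as (c & t0 & Hc & Ht0 & HF).
  assert (Hmom : 0 < mom_c) by (unfold mom_c; lra).
  exists (mom_c / c), t0. split; [now apply Rdiv_lt_0_compat|]. split; [auto|].
  intros N t Ht HN.
  assert (Ht4 : 0 < t ^ 4) by (apply pow_lt; lra).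
  destruct (INR_unbounded (32 / t ^ 4)) as [M0 HM0].
  (* [M >= N] makes the bound on the parts harmless up to [N], and [M0] makes [M t^4] large enough
     for the mean. *)
  set (M := max N M0).
  assert (HMM : 32 / t ^ 4 <= INR M).
  { left. eapply Rlt_le_trans; [exact HM0|]. apply le_INR. lia. }
  assert (HM : 32 <= INR M * t ^ 4).
  { apply (Rmult_le_compat_r (t ^ 4)) in HMM; [|lra].
    replace (32 / t ^ 4 * t ^ 4) with 32 in HMM by (field; lra). lra. }
  assert (HM1 : 1 <= INR M * t).
  { assert (t ^ 4 <= t).
    { replace (t ^ 4) with (t * (t * t * t)) by ring. assert (t * t * t <= 1) by nra. nra. }
    pose proof (pos_INR M). nra. }
  assert (Hp : forall n, (n <= Z.of_nat N)%Z -> fourier t M n = PI * IZR (pz n) * exp (- (IZR n * t))).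
  { intros n Hn. rewrite fourier_pm by lra. rewrite pm_pz by (subst M; lia). reflexivity. }
  pose proof (HF t M (Z.of_nat N) Ht HM ltac:(rewrite <- INR_IZR_INZ; exact HN)) as Hlow.
  rewrite Hp in Hlow by lia. rewrite <- INR_IZR_INZ in Hlow.
  pose proof (rho_pos t M 0 ltac:(lra)) as Hr0.
  assert (Hs : 0 < sqrt t) by (apply sqrt_lt_R0; lra).
  assert (Hss : sqrt t * sqrt t = t) by (apply sqrt_sqrt; lra).
  set (d := t * sqrt t) in *. assert (Hd : 0 < d) by (unfold d; nra).
  assert (Hd2 : d * d = t ^ 3) by (unfold d; replace (t ^ 3) with (t * t * (sqrt t * sqrt t)) by (rewrite Hss; ring); ring).
  pose proof PI_RGT_0 as Hpi.
  pose proof (exp_pos (- (INR N * t))) as HeN.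
  set (P := IZR (pz (Z.of_nat N))) in *.
  assert (HP : 0 < P).
  { assert (0 <= P) by apply IZR_pz_nonneg.
    assert (0 < c * d * rho t M 0) by (apply Rmult_lt_0_compat; [apply Rmult_lt_0_compat|]; auto).
    destruct (Req_dec P 0) as [E|]; [|lra]. rewrite E in Hlow. nra. }
  split; auto. intros k.
  pose proof (fourier_lipschitz t M (Z.of_nat N - Z.of_nat k) ltac:(lra) HM1) as HL.
  rewrite !Hp in HL by lia. rewrite !minus_IZR, <- !INR_IZR_INZ in HL.
  set (a := IZR (pz (Z.of_nat N - Z.of_nat k))) in *.
  set (b := IZR (pz (Z.of_nat N - Z.of_nat k - 1))) in *.
  replace (exp (- ((INR N - INR k) * t))) with (exp (- (INR N * t)) * exp (INR k * t)) in HL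
    by (rewrite <- exp_plus; apply f_equal; ring).
  replace (exp (- ((INR N - INR k - 1) * t))) with (exp (- (INR N * t)) * exp ((INR k + 1) * t)) in HL
    by (rewrite <- exp_plus; apply f_equal; ring).
  replace (PI * a * (exp (- (INR N * t)) * exp (INR k * t)) - PI * b * (exp (- (INR N * t)) * exp ((INR k + 1) * t)))
    with ((PI * exp (- (INR N * t))) * (a * exp (INR k * t) - b * exp ((INR k + 1) * t))) in HL by ring.
  rewrite Rabs_mult, (Rabs_right (PI * exp (- (INR N * t)))) in HL by nra.
  set (X := Rabs (a * exp (INR k * t) - b * exp ((INR k + 1) * t))) in *.
  set (W := PI * exp (- (INR N * t))) in *. assert (HW : 0 < W) by (unfold W; nra).
  rewrite <- Hd2 in HL.
  replace (PI * P * exp (- (INR N * t))) with (W * P) in Hlow by (unfold W; ring).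
  apply (Rmult_le_reg_l W); auto. eapply Rle_trans; [exact HL|].
  replace (W * (mom_c / c * d * P)) with (mom_c / c * d * (W * P)) by ring.
  replace (rho t M 0 * (mom_c * (d * d))) with (mom_c / c * d * (c * d * rho t M 0)) by (field; lra).
  apply Rmult_le_compat_l; auto. apply Rmult_le_pos; [|lra]. apply Rlt_le, Rdiv_lt_0_compat; auto.
Qed.

(** * The Gaussian integral *)

Definition gint (Y : R) : R := RInt (fun x => exp (- (x * x))) 0 Y.

Lemma continuous_gauss c x : continuous (fun x => exp (- (c * (x * x)))) x.
Proof.
  apply (ex_derive_continuous (K := R_AbsRing) (V := R_NormedModule)). auto_derive; auto.
Qed.

Lemma continuous_gauss1 x : continuous (fun x => exp (- (x * x))) x.
Proof.
  apply (ex_derive_continuous (K := R_AbsRing) (V := R_NormedModule)). auto_derive; auto.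
Qed.

Lemma is_derive_gint Y : is_derive gint Y (exp (- (Y * Y))).
Proof.
  apply (is_derive_RInt (V := R_CompleteNormedModule) (fun x => exp (- (x * x))) gint 0).
  - apply filter_forall. intros y. apply (RInt_correct (V := R_CompleteNormedModule)).
    apply ex_RInt_cont, continuous_gauss1.
  - apply continuous_gauss1.
Qed.

(** An auxiliary integral whose derivative for [Y >= 0] is minus that of [gint^2]; it starts at
    [arctan 1 = PI/4] and is at most [e^(-Y^2)]. *)
Definition haux (Y : R) : R := RInt (fun u => exp (- (Y * Y * (1 + u * u))) / (1 + u * u)) 0 1.

Lemma continuous_haux_integrand Y u :
  continuous (fun u => exp (- (Y * Y * (1 + u * u))) / (1 + u * u)) u.
Proof.
  apply (ex_derive_continuous (K := R_AbsRing) (V := R_NormedModule)). auto_derive. nra.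
Qed.

Lemma gint_scaled c Y : 0 < c -> RInt (fun x => exp (- (c * c * (x * x)))) 0 Y = gint (c * Y) / c.
Proof.
  intros Hc. unfold gint.
  pose proof (RInt_comp_lin (V := R_CompleteNormedModule) (fun x => exp (- (x * x))) c 0 0 Y) as H.
  rewrite Rmult_0_r, !Rplus_0_r in H.
  rewrite <- H by (apply ex_RInt_cont, continuous_gauss1).
  rewrite (RInt_ext (fun y => scal c (exp (- ((c * y + 0) * (c * y + 0)))))
    (fun x => scal c (exp (- (c * c * (x * x)))))).
  2:{ intros x _. apply f_equal, f_equal. ring. }
  rewrite (RInt_scal (V := R_CompleteNormedModule)) by (apply ex_RInt_cont, continuous_gauss).
  assert (G : forall v : R, v = c * v / c) by (intros; field; lra). apply G.
Qed.

Lemma is_derive_haux Y : 0 <= Y -> is_derive haux Y (- (2 * exp (- (Y * Y)) * gint Y)).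
Proof.
  intros HY. unfold haux.
  assert (HD : forall x u, Derive (fun z => exp (- (z * z * (1 + u * u))) / (1 + u * u)) x
     = - 2 * x * exp (- (x * x * (1 + u * u)))).
  { intros x u. apply is_derive_unique. auto_derive; [nra|]. field. nra. }
  replace (- (2 * exp (- (Y * Y)) * gint Y)) with
    (RInt (fun u => Derive (fun z => exp (- (z * z * (1 + u * u))) / (1 + u * u)) Y) 0 1).
  - apply (is_derive_RInt_param (fun z u => exp (- (z * z * (1 + u * u))) / (1 + u * u)) 0 1 Y).
    + apply filter_forall. intros x u _. auto_derive. nra.
    + intros u _.
      apply (continuity_2d_pt_ext (fun x v => - 2 * x * exp (- (x * x * (1 + v * v)))));
        [intros; now rewrite HD|].
      apply continuity_2d_pt_mult.
      * apply continuity_2d_pt_mult; [apply continuity_2d_pt_const|apply continuity_2d_pt_id1].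
      * apply (continuity_1d_2d_pt_comp exp).
        { apply derivable_continuous_pt, derivable_pt_exp. }
        apply continuity_2d_pt_opp, continuity_2d_pt_mult.
        { apply continuity_2d_pt_mult; apply continuity_2d_pt_id1. }
        apply continuity_2d_pt_plus; [apply continuity_2d_pt_const|].
        apply continuity_2d_pt_mult; apply continuity_2d_pt_id2.
    + apply filter_forall. intros x. apply ex_RInt_cont, continuous_haux_integrand.
  - rewrite (RInt_ext _ (fun u => scal (- 2 * Y * exp (- (Y * Y))) (exp (- (Y * Y * (u * u)))))).
    2:{ intros u _. rewrite HD. unfold scal; simpl; unfold mult; simpl.
        rewrite (Rmult_assoc (_ * Y)), <- exp_plus. apply f_equal, f_equal. ring. }
    rewrite (RInt_scal (V := R_CompleteNormedModule)) by (apply ex_RInt_cont, continuous_gauss).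
    unfold scal; simpl; unfold mult; simpl.
    destruct HY as [HY|<-].
    + rewrite gint_scaled by auto. rewrite Rmult_1_r. field. lra.
    + replace (gint 0) with 0 by (symmetry; apply (RInt_point (V := R_CompleteNormedModule))). ring.
Qed.

Lemma gint_nonneg Y : 0 <= Y -> 0 <= gint Y.
Proof.
  intros H. apply RInt_ge_0; auto; [apply ex_RInt_cont, continuous_gauss1|].
  intros. left. apply exp_pos.
Qed.

Lemma haux_bounds Y : 0 <= haux Y <= exp (- (Y * Y)).
Proof.
  assert (Hp : forall u, 0 < exp (- (Y * Y * (1 + u * u)))) by (intros; apply exp_pos).
  split.
  - apply RInt_ge_0; [lra|apply ex_RInt_cont, continuous_haux_integrand|].
    intros u _. apply Rlt_le, Rdiv_lt_0_compat; auto. nra.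
  - replace (exp (- (Y * Y))) with (RInt (fun _ => exp (- (Y * Y))) 0 1).
    2:{ rewrite RInt_const. unfold scal; simpl; unfold mult; simpl. ring. }
    apply RInt_le; [lra|apply ex_RInt_cont, continuous_haux_integrand|apply ex_RInt_const|].
    intros u _. apply Rle_trans with (exp (- (Y * Y * (1 + u * u)))).
    + rewrite <- (Rmult_1_r (exp _)) at 2. unfold Rdiv. apply Rmult_le_compat_l; [left; auto|].
      rewrite <- Rinv_1. apply Rinv_le_contravar; nra.
    + apply exp_le_compat. nra.
Qed.

Lemma haux_0 : haux 0 = PI / 4.
Proof.
  unfold haux. rewrite (RInt_ext _ (fun u => / (1 + u²))).
  2:{ intros u _. rewrite !Rmult_0_l, Ropp_0, exp_0. unfold Rdiv. now rewrite Rmult_1_l. }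
  apply is_RInt_unique. replace (PI / 4) with (minus (atan 1) (atan 0)).
  - apply (is_RInt_derive atan).
    + intros x _. apply is_derive_atan.
    + intros x _. apply (ex_derive_continuous (K := R_AbsRing) (V := R_NormedModule)).
      unfold Rsqr. auto_derive. nra.
  - rewrite atan_1, atan_0. unfold minus, plus, opp; simpl. ring.
Qed.

(* [gint^2 + haux] has derivative zero, which evaluates the Gaussian integral. *)
Lemma gint_sqr Y : 0 <= Y -> gint Y * gint Y = PI / 4 - haux Y.
Proof.
  intros HY.
  assert (HD : forall x, 0 <= x -> is_derive (fun x => gint x * gint x + haux x) x 0).
  { intros x Hx.
    replace 0 with (plus (exp (- (x * x)) * gint x + gint x * exp (- (x * x)))
      (- (2 * exp (- (x * x)) * gint x))) by (unfold plus; simpl; ring).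
    apply (is_derive_plus (fun x => gint x * gint x) haux); [|now apply is_derive_haux].
    apply (is_derive_mult gint gint); try apply is_derive_gint. intros; apply Rmult_comm. }
  assert (H1 : gint 0 * gint 0 + haux 0 <= gint Y * gint Y + haux Y).
  { apply (derive_nonneg_incr (fun x => gint x * gint x + haux x) (fun _ => 0)); auto;
      [intros; apply HD; lra|intros; lra]. }
  assert (H2 : - (gint 0 * gint 0 + haux 0) <= - (gint Y * gint Y + haux Y)).
  { apply (derive_nonneg_incr (fun x => - (gint x * gint x + haux x)) (fun _ => 0)); auto; [|intros; lra].
    intros x Hx. replace 0 with (opp 0) by (unfold opp; simpl; ring).
    apply (is_derive_opp (fun x => gint x * gint x + haux x)), HD. lra. }
  replace (gint 0) with 0 in * by (symmetry; apply (RInt_point (V := R_CompleteNormedModule))).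
  rewrite haux_0 in *. lra.
Qed.

Lemma gint_limit Y : 0 <= Y -> Rabs (gint Y - sqrt PI / 2) <= 2 * exp (- (Y * Y)).
Proof.
  intros HY. pose proof (gint_sqr Y HY) as E. pose proof (haux_bounds Y) as Hh.
  pose proof (gint_nonneg Y HY) as Hg. pose proof PI_RGT_0. pose proof PI2_3_2.
  assert (Hs : sqrt PI * sqrt PI = PI) by (apply sqrt_sqrt; lra).
  assert (Hs1 : 1 <= sqrt PI) by (rewrite <- sqrt_1; apply sqrt_le_1_alt; lra).
  assert ((sqrt PI / 2 - gint Y) * (sqrt PI / 2 + gint Y) = haux Y) by nra.
  apply Rabs_le. split; [|nra].
  assert (sqrt PI / 2 - gint Y <= 2 * haux Y); [|lra].
  assert (0 <= sqrt PI / 2 - gint Y) by nra. nra.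
Qed.

Definition gsum (c : R) (N : nat) : R := rsum (fun j => exp (- (c * (INR (S j) * INR (S j))))) N.

Lemma gsum_integral c N : 0 < c ->
  Rabs (gsum (c * c) N - gint (c * INR N) / c) <= 1.
Proof.
  intros Hc. rewrite <- gint_scaled by auto.
  set (f := fun x => exp (- (c * c * (x * x)))).
  assert (Hex : forall a b, ex_RInt f a b) by (intros; apply ex_RInt_cont, continuous_gauss).
  assert (Hcc : 0 < c * c) by nra.
  assert (H : gsum (c * c) N <= RInt f 0 (INR N) <= gsum (c * c) N + 1 - f (INR N)).
  { induction N as [|N IH].
    - unfold gsum, f. simpl. rewrite (RInt_point (V := R_CompleteNormedModule)).
      rewrite !Rmult_0_r, Ropp_0, exp_0. unfold zero; simpl. lra.
    - unfold gsum in *. cbn [rsum].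
      rewrite <- (RInt_Chasles (V := R_CompleteNormedModule) f 0 (INR N) (INR (S N))) by apply Hex.
      change (plus (RInt f 0 (INR N)) (RInt f (INR N) (INR (S N)))) with
        (RInt f 0 (INR N) + RInt f (INR N) (INR (S N))).
      assert (HN : INR N <= INR (S N)) by (rewrite S_INR; lra). pose proof (pos_INR N).
      assert (Hc1 : forall v : R, RInt (fun _ : R => v) (INR N) (INR (S N)) = v).
      { intros v. rewrite RInt_const, S_INR. unfold scal; simpl; unfold mult; simpl. ring. }
      assert (L1 : f (INR (S N)) <= RInt f (INR N) (INR (S N))).
      { eapply Rle_trans; [right; symmetry; apply (Hc1 (f (INR (S N))))|]. apply RInt_le; auto; [apply ex_RInt_const|].
        intros x Hx. apply exp_le_compat, Ropp_le_contravar, Rmult_le_compat_l; nra. }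
      assert (L2 : RInt f (INR N) (INR (S N)) <= f (INR N)).
      { eapply Rle_trans; [|right; apply (Hc1 (f (INR N)))]. apply RInt_le; auto; [apply ex_RInt_const|].
        intros x Hx. apply exp_le_compat, Ropp_le_contravar, Rmult_le_compat_l; nra. }
      unfold f in *. lra. }
  assert (0 < f (INR N)) by apply exp_pos. apply Rabs_le. lra.
Qed.

(** * Propagation of the error along the recurrence *)

Definition Fx (x : R) : R := (1 + x) / (1 + x + x * x).

Lemma F_Fx a : F a = Fx (exp (- a)).
Proof.
  unfold F, Fx. do 2 f_equal. replace (-2 * a) with (- a + - a) by ring. rewrite exp_plus. ring.
Qed.

Lemma Fx_bounds x : 0 <= x <= 1 -> 2 / 3 <= Fx x <= 1.
Proof.
  intros H. unfold Fx. assert (0 < 1 + x + x * x) by nra.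
  split; apply (Rmult_le_reg_r (1 + x + x * x)); auto; unfold Rdiv;
    rewrite ?Rmult_assoc, ?Rinv_l by lra; nra.
Qed.

Lemma Fx_fixpoint x : 0 <= x -> Fx x = 1 - x * x + x * x * x * Fx x.
Proof. intros H. unfold Fx. field. nra. Qed.

Lemma Fx_lipschitz x y : 0 <= x -> 0 <= y -> Rabs (Fx x - Fx y) <= Rabs (x - y).
Proof.
  intros Hx Hy. unfold Fx.
  replace ((1 + x) / (1 + x + x * x) - (1 + y) / (1 + y + y * y))
    with ((y - x) * ((x + y + x * y) / ((1 + x + x * x) * (1 + y + y * y)))) by (field; split; nra).
  rewrite Rabs_mult, Rabs_minus_sym.
  rewrite <- (Rmult_1_r (Rabs (x - y))) at 2. apply Rmult_le_compat_l; [apply Rabs_pos|].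
  assert (0 <= x * y) by nra.
  assert (Hd : x + y + x * y <= (1 + x + x * x) * (1 + y + y * y)).
  { assert (0 <= x * x) by nra. assert (0 <= y * y) by nra.
    assert (0 <= x * (y * y)) by nra. assert (0 <= x * x * y) by nra.
    assert (0 <= x * x * (y * y)) by nra. nra. }
  assert (0 < (1 + x + x * x) * (1 + y + y * y)) by (apply Rmult_lt_0_compat; nra).
  rewrite Rabs_right.
  - apply (Rmult_le_reg_r ((1 + x + x * x) * (1 + y + y * y))); auto. unfold Rdiv.
    rewrite Rmult_assoc, Rinv_l by lra. lra.
  - apply Rle_ge, Rmult_le_pos; [nra|]. apply Rlt_le, Rinv_0_lt_compat; auto.
Qed.

Lemma exp_neg_bounds y : 0 <= y -> 0 < exp (- y) <= 1.
Proof.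
  intros H. split; [apply exp_pos|]. rewrite <- exp_0. apply exp_le_compat. lra.
Qed.

Lemma one_minus_exp_le y : 1 - exp (- y) <= y.
Proof. pose proof (exp_ineq1_le (- y)). lra. Qed.

Lemma y_exp_le y : y * exp (- y) <= 1 - exp (- y).
Proof.
  pose proof (exp_ineq1_le y). pose proof (exp_pos (- y)).
  assert (exp y * exp (- y) = 1) by (rewrite <- exp_plus, Rplus_opp_r; apply exp_0). nra.
Qed.

Lemma one_minus_exp_ge_of u y : 0 <= u <= y -> u / (1 + u) <= 1 - exp (- y).
Proof.
  intros [[Hu|<-] Hy].
  - pose proof (one_minus_exp_ge u Hu). pose proof (exp_le_compat (- y) (- u) ltac:(lra)). lra.
  - pose proof (exp_neg_bounds y Hy). unfold Rdiv. rewrite Rmult_0_l. lra.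
Qed.

(** The fixed-point equation is exact when [2l + 4], [3l + 8] and [l + 4] are replaced by [2l], [3l]
    and [l]. With [w = e^(-4t)] these replacements cost [4t], [8t] and [4t]. *)
Lemma F_residual t l : 0 <= t -> 0 <= l ->
  Rabs (1 - exp (- ((2 * l + 4) * t)) + exp (- ((3 * l + 8) * t)) * F (t * (l + 4)) - F (t * l))
  <= 16 * t.
Proof.
  intros Ht Hl. rewrite !F_Fx.
  set (x := exp (- (t * l))). set (w := exp (- (4 * t))).
  assert (Htl : 0 <= t * l) by nra.
  pose proof (exp_neg_bounds (t * l) Htl) as Hx. fold x in Hx.
  pose proof (exp_neg_bounds (4 * t) ltac:(lra)) as Hw. fold w in Hw.
  pose proof (one_minus_exp_le (4 * t)) as Hw4. fold w in Hw4.
  replace (exp (- (t * (l + 4)))) with (x * w) by (unfold x, w; rewrite <- exp_plus; apply f_equal; ring).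
  replace (exp (- ((2 * l + 4) * t))) with (x * x * w)
    by (unfold x, w; rewrite <- !exp_plus; apply f_equal; ring).
  replace (exp (- ((3 * l + 8) * t))) with (x * x * x * (w * w))
    by (unfold x, w; rewrite <- !exp_plus; apply f_equal; ring).
  rewrite (Fx_fixpoint x) by lra.
  assert (Hxw : 0 <= x * w <= 1) by nra.
  pose proof (Fx_bounds (x * w) Hxw) as HF.
  pose proof (Fx_lipschitz (x * w) x ltac:(lra) ltac:(lra)) as HL.
  set (G := Fx (x * w)) in *. set (H := Fx x) in *.
  replace (1 - x * x * w + x * x * x * (w * w) * G - (1 - x * x + x * x * x * H))
    with (x * x * (1 - w) + - (x * x * x * (1 - w * w) * G) + x * x * x * (G - H)) by ring.
  assert (Hx2 : 0 <= x * x <= 1) by nra. assert (Hx3 : 0 <= x * x * x <= 1) by nra.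
  assert (A1 : Rabs (x * x * (1 - w)) <= 4 * t) by (rewrite Rabs_right; nra).
  assert (A2 : Rabs (- (x * x * x * (1 - w * w) * G)) <= 8 * t).
  { assert (0 <= 1 - w * w <= 8 * t) by nra.
    assert (0 <= x * x * x * (1 - w * w) <= 8 * t) by nra.
    rewrite Rabs_Ropp, Rabs_right; nra. }
  assert (A3 : Rabs (x * x * x * (G - H)) <= 4 * t).
  { rewrite Rabs_mult, (Rabs_right (x * x * x)) by lra.
    assert (Rabs (x * w - x) <= 4 * t) by (rewrite Rabs_left1; nra).
    pose proof (Rabs_pos (G - H)). nra. }
  eapply Rle_trans; [apply Rabs_triang|].
  eapply Rle_trans; [apply Rplus_le_compat_r, Rabs_triang|]. lra.
Qed.

(** Here [s = sqrt t]; multiplied by [s], the inequality pays for the residual [16t] of one step. If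
    [sl > 1], the contraction gains at least [s]. If [sl <= 1], it may gain far less, and the drop
    of [36 e^(-sl)] is used instead: [e^(-sl) >= 1/3] and [1 - e^(-4s) >= 4s/3] make it at least
    [16s], which determines 36. *)
Lemma potential_drop s l : 0 < s <= / 2 -> 0 <= l ->
  16 * s <= 16 * (1 - exp (- ((3 * l + 8) * (s * s)))) + 36 * (exp (- (s * l)) - exp (- (s * (l + 4)))).
Proof.
  intros Hs Hl.
  pose proof (exp_neg_bounds ((3 * l + 8) * (s * s)) ltac:(nra)) as Hg.
  replace (exp (- (s * (l + 4)))) with (exp (- (s * l)) * exp (- (4 * s)))
    by (rewrite <- exp_plus; apply f_equal; ring).
  pose proof (exp_pos (- (s * l))) as He. pose proof (exp_neg_bounds (4 * s) ltac:(lra)) as H4.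
  destruct (Rle_lt_dec (s * l) 1) as [H|H].
  - assert (E1 : / 3 <= exp (- (s * l))).
    { apply Rle_trans with (exp (- (1))); [|apply exp_le_compat; lra].
      rewrite exp_Ropp. apply Rinv_le_contravar; [apply exp_pos|apply exp_le_3]. }
    pose proof (one_minus_exp_ge (4 * s) ltac:(lra)) as E2.
    assert (4 * s / 3 <= 4 * s / (1 + 4 * s)).
    { unfold Rdiv. apply Rmult_le_compat_l; [lra|]. apply Rinv_le_contravar; lra. }
    nra.
  - pose proof (one_minus_exp_ge_of (3 * s) ((3 * l + 8) * (s * s)) ltac:(nra)) as E2.
    assert (s <= 3 * s / (1 + 3 * s)).
    { apply (Rmult_le_reg_r (1 + 3 * s)); [lra|]. unfold Rdiv. rewrite Rmult_assoc, Rinv_l by lra. nra. }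
    nra.
Qed.

(* The error is propagated along the recurrence by the potential
   [C k t^(3/2) + sqrt t (2C + 16 + 36 exp (- sqrt t l))]. *)
Lemma az_approx (C t : R) (N : nat) : 0 < C -> 0 < t <= / 4 ->
  let P := IZR (pz (Z.of_nat N)) in
  0 < P ->
  (forall k : nat,
    Rabs (IZR (pz (Z.of_nat N - Z.of_nat k)) * exp (INR k * t)
        - IZR (pz (Z.of_nat N - Z.of_nat k - 1)) * exp ((INR k + 1) * t)) <= C * (t * sqrt t) * P) ->
  forall l k : nat,
  Rabs (IZR (az l (Z.of_nat N - Z.of_nat k)) - P * exp (- (INR k * t)) * F (t * INR l))
  <= P * exp (- (INR k * t)) * (C * INR k * (t * sqrt t) + (2 * C + 52) * sqrt t).
Proof.
  intros HC Ht P HP Hinc.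
  set (s := sqrt t) in *.
  assert (Hs : 0 < s) by (apply sqrt_lt_R0; lra).
  assert (Hss : s * s = t) by (apply sqrt_sqrt; lra).
  assert (Hs2 : s <= / 2) by nra.
  set (g := fun k : nat => IZR (pz (Z.of_nat N - Z.of_nat k)) * exp (INR k * t)).
  assert (Hg0 : g O = P).
  { unfold g. simpl INR. rewrite Rmult_0_l, exp_0, Rmult_1_r. unfold P. do 2 f_equal. lia. }
  assert (HL : forall k b, Rabs (g k - g (k + b)%nat) <= C * (t * s) * P * INR b).
  { intros k b. induction b as [|b IH].
    - rewrite Nat.add_0_r, Rminus_diag, Rabs_R0. simpl. lra.
    - replace (g k - g (k + S b)%nat) with ((g k - g (k + b)%nat) + (g (k + b)%nat - g (k + S b)%nat)) by ring.
      eapply Rle_trans; [apply Rabs_triang|]. rewrite S_INR.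
      assert (Rabs (g (k + b)%nat - g (k + S b)%nat) <= C * (t * s) * P); [|lra].
      eapply Rle_trans; [|apply (Hinc (k + b)%nat)]. right. unfold g. rewrite <- S_INR.
      replace (k + S b)%nat with (S (k + b)) by lia.
      replace (Z.of_nat N - Z.of_nat (S (k + b)))%Z with (Z.of_nat N - Z.of_nat (k + b) - 1)%Z by lia.
      reflexivity. }
  assert (Hpg : forall k, IZR (pz (Z.of_nat N - Z.of_nat k)) = exp (- (INR k * t)) * g k).
  { intros k. unfold g. rewrite Rmult_comm, Rmult_assoc, <- exp_plus, Rplus_opp_r, exp_0. ring. }
  assert (Main : forall fuel l k, (Z.of_nat N - Z.of_nat k < Z.of_nat fuel)%Z ->
    Rabs (IZR (az l (Z.of_nat N - Z.of_nat k)) - P * exp (- (INR k * t)) * F (t * INR l))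
    <= P * exp (- (INR k * t))
       * (C * INR k * (t * s) + s * (2 * C + 16 + 36 * exp (- (s * INR l))))).
  { induction fuel as [|fuel IH]; intros l k Hf.
    (* For [k > N] both counts are 0, and the Lipschitz bound from 0 to [k] then says
       [1 <= C k t^(3/2)]: the permitted error exceeds the main term. *)
    - rewrite az_neg by lia. unfold Rminus. rewrite Rplus_0_l, Rabs_Ropp.
      pose proof (HL O k) as H1. rewrite Hg0 in H1. simpl in H1.
      assert (Hgk : g k = 0).
      { unfold g, pz. destruct (Z.ltb_spec (Z.of_nat N - Z.of_nat k) 0); [lra|lia]. }
      rewrite Hgk, Rminus_0_r, Rabs_right in H1 by lra.
      assert (H2 : 1 <= C * INR k * (t * s)) by (apply (Rmult_le_reg_l P); auto; lra).
      pose proof (exp_pos (- (INR k * t))) as He. pose proof (exp_pos (- (s * INR l))) as He2.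
      rewrite F_Fx.
      pose proof (exp_neg_bounds (t * INR l) ltac:(pose proof (pos_INR l); nra)) as Hx.
      pose proof (Fx_bounds (exp (- (t * INR l))) ltac:(lra)) as HF.
      assert (HPE : 0 < P * exp (- (INR k * t))) by nra.
      rewrite Rabs_right by (apply Rle_ge, Rmult_le_pos; lra).
      apply Rmult_le_compat_l; [lra|]. nra.
    - destruct (Z.ltb_spec (Z.of_nat N - Z.of_nat k) 0) as [Hn|Hn]; [apply IH; lia|].
      rewrite az_recurrence by lia.
      specialize (IH (l + 4)%nat (k + (3 * l + 8))%nat ltac:(lia)).
      replace (Z.of_nat N - Z.of_nat k - 3 * Z.of_nat l - 8)%Z
        with (Z.of_nat N - Z.of_nat (k + (3 * l + 8)))%Z by lia.
      replace (Z.of_nat N - Z.of_nat k - 2 * Z.of_nat l - 4)%Z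
        with (Z.of_nat N - Z.of_nat (k + (2 * l + 4)))%Z by lia.
      rewrite plus_IZR, minus_IZR, !Hpg.
      set (a' := IZR (az (l + 4) (Z.of_nat N - Z.of_nat (k + (3 * l + 8))))) in *.
      pose proof (HL O k) as H1. rewrite Hg0 in H1. simpl (0 + k)%nat in H1.
      pose proof (HL k (2 * l + 4)%nat) as H2.
      set (lr := INR l) in *. assert (Hlr : 0 <= lr) by apply pos_INR.
      assert (Eb : INR (2 * l + 4) = 2 * lr + 4) by (unfold lr; rewrite plus_INR, mult_INR; simpl; ring).
      assert (Ec : INR (3 * l + 8) = 3 * lr + 8) by (unfold lr; rewrite plus_INR, mult_INR; simpl; ring).
      assert (El : INR (l + 4) = lr + 4) by (unfold lr; rewrite plus_INR; simpl; ring).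
      rewrite (plus_INR k (3 * l + 8)), Ec, El in IH. rewrite Eb in H2.
      rewrite (plus_INR k (2 * l + 4)), Eb.
      set (b := 2 * lr + 4) in *. set (c := 3 * lr + 8) in *.
      pose proof (F_residual t lr ltac:(lra) Hlr) as HR. fold b c in HR.
      pose proof (potential_drop s lr ltac:(lra) Hlr) as HV. fold c in HV. rewrite Hss in HV.
      replace (exp (- ((INR k + c) * t))) with (exp (- (INR k * t)) * exp (- (c * t))) in IH
        by (rewrite <- exp_plus; apply f_equal; ring).
      replace (exp (- ((INR k + b) * t))) with (exp (- (INR k * t)) * exp (- (b * t)))
        by (rewrite <- exp_plus; apply f_equal; ring).
      assert (Hb : 0 <= b * t) by (unfold b; nra). assert (Hcb : b * t <= c * t) by (unfold b, c; nra).
      pose proof (exp_neg_bounds (b * t) Hb) as Bb. pose proof (exp_neg_bounds (c * t) ltac:(lra)) as Bc.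
      pose proof (exp_le_compat (- (c * t)) (- (b * t)) ltac:(lra)) as Bcb.
      pose proof (y_exp_le (b * t)) as Yb. pose proof (y_exp_le (c * t)) as Yc.
      pose proof (exp_pos (- (INR k * t))) as HE.
      pose proof (exp_pos (- (s * (lr + 4)))) as He4.
      pose proof (pos_INR k) as Hk.
      set (E := exp (- (INR k * t))) in *. set (be := exp (- (b * t))) in *.
      set (ga := exp (- (c * t))) in *. set (e0 := exp (- (s * lr))) in *.
      set (e4 := exp (- (s * (lr + 4)))) in *.
      set (Fl := F (t * lr)) in *. set (F4 := F (t * (lr + 4))) in *.
      set (gk := g k) in *. set (gb := g (k + (2 * l + 4))%nat) in *. set (K := INR k) in *.
      (* The partition terms are grouped so that [gk - P] carries the factor [1 - be]. Since the
         inductive error carries [ga <= be], the part of the error proportional to [k] does not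
         grow. *)
      replace (E * gk - E * be * gb + a' - P * E * Fl)
        with (E * ((gk - P) * (1 - be)) + E * (be * (gk - gb)) + (a' - P * (E * ga) * F4)
              + P * E * (1 - be + ga * F4 - Fl)) by ring.
      rewrite Rabs_minus_sym in H1.
      assert (T1 : Rabs (E * ((gk - P) * (1 - be))) <= E * (C * (t * s) * P * K * (1 - be))).
      { rewrite !Rabs_mult, (Rabs_right E), (Rabs_right (1 - be)) by lra.
        apply Rmult_le_compat_l; [lra|]. apply Rmult_le_compat_r; lra. }
      assert (T2 : Rabs (E * (be * (gk - gb))) <= E * (be * (C * (t * s) * P * b))).
      { rewrite !Rabs_mult, (Rabs_right E), (Rabs_right be) by lra.
        apply Rmult_le_compat_l; [lra|]. apply Rmult_le_compat_l; lra. }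
      assert (T4 : Rabs (P * E * (1 - be + ga * F4 - Fl)) <= P * E * (16 * t)).
      { rewrite Rabs_mult, (Rabs_right (P * E)) by nra. apply Rmult_le_compat_l; [nra|lra]. }
      eapply Rle_trans; [apply Rabs_triang|].
      eapply Rle_trans; [apply Rplus_le_compat_r, Rabs_triang|].
      eapply Rle_trans; [apply Rplus_le_compat_r, Rplus_le_compat_r, Rabs_triang|].
      eapply Rle_trans; [apply Rplus_le_compat; [apply Rplus_le_compat; [apply Rplus_le_compat;
        [exact T1|exact T2]|exact IH]|exact T4]|].
      replace (E * (C * (t * s) * P * K * (1 - be)) + E * (be * (C * (t * s) * P * b))
        + P * (E * ga) * (C * (K + c) * (t * s) + s * (2 * C + 16 + 36 * e4)) + P * E * (16 * t))
        with (P * E * (C * (t * s) * K * (1 - be) + be * (C * (t * s) * b)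
          + ga * (C * (K + c) * (t * s) + s * (2 * C + 16 + 36 * e4)) + 16 * t)) by ring.
      apply Rmult_le_compat_l; [nra|].
      assert (Hts : 0 < t * s) by nra.
      assert (K1 : C * (t * s) * K * (1 - be) + ga * (C * K * (t * s)) <= C * K * (t * s)).
      { assert (0 <= C * K * (t * s)) by (apply Rmult_le_pos; [apply Rmult_le_pos|]; lra). nra. }
      (* Moving [k] by [b] and by [c] costs terms of the form [y e^(-y)], each at most
         [1 - e^(-y) <= 1 - ga]; the summand [2C] of the potential pays for both. *)
      assert (K2 : be * (C * (t * s) * b) + ga * (C * c * (t * s)) <= C * s * (2 * (1 - ga))).
      { replace (be * (C * (t * s) * b) + ga * (C * c * (t * s)))
          with (C * s * (b * t * be + c * t * ga)) by ring.
        apply Rmult_le_compat_l; [nra|]. lra. }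
      assert (K3 : ga * (36 * e4) <= 36 * e4) by nra.
      assert (K4 : s * (16 * s) <= s * (16 * (1 - ga) + 36 * (e0 - e4))) by (apply Rmult_le_compat_l; lra).
      assert (K5 : s * (ga * (36 * e4)) <= s * (36 * e4)) by (apply Rmult_le_compat_l; lra).
      replace (16 * t) with (s * (16 * s)) by (rewrite <- Hss; ring).
      nra. }
  intros l k. eapply Rle_trans; [apply (Main (S N) l k); lia|].
  pose proof (exp_pos (- (INR k * t))).
  pose proof (exp_neg_bounds (s * INR l) ltac:(pose proof (pos_INR l); nra)).
  apply Rmult_le_compat_l; nra.
Qed.

(** * The uniform estimate at the saddle point *)

Definition saddle (N : nat) : R := PI / sqrt (6 * INR N).

Lemma saddle_pos N : (1 <= N)%nat -> 0 < saddle N.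
Proof.
  intros H. assert (1 <= INR N) by (change 1 with (INR 1); apply le_INR; lia).
  apply Rdiv_lt_0_compat; [apply PI_RGT_0|]. apply sqrt_lt_R0. lra.
Qed.

Lemma saddle_sq N : (1 <= N)%nat -> INR N = PI * PI / (6 * (saddle N * saddle N)).
Proof.
  intros H. assert (1 <= INR N) by (change 1 with (INR 1); apply le_INR; lia).
  pose proof PI_RGT_0. unfold saddle.
  assert (0 < sqrt (6 * INR N)) by (apply sqrt_lt_R0; lra).
  assert (sqrt (6 * INR N) * sqrt (6 * INR N) = 6 * INR N) by (apply sqrt_sqrt; lra).
  replace (PI * PI / (6 * (PI / sqrt (6 * INR N) * (PI / sqrt (6 * INR N)))))
    with (sqrt (6 * INR N) * sqrt (6 * INR N) / 6) by (field; lra).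
  lra.
Qed.

Lemma saddle_le N : (1 <= N)%nat -> saddle N <= 2 * / sqrt (INR N).
Proof.
  intros H. assert (1 <= INR N) by (change 1 with (INR 1); apply le_INR; lia).
  unfold saddle. rewrite sqrt_mult by lra.
  assert (0 < sqrt (INR N)) by (apply sqrt_lt_R0; lra).
  assert (2 <= sqrt 6) by (rewrite <- (sqrt_square 2) by lra; apply sqrt_le_1_alt; lra).
  pose proof PI_4. pose proof PI_RGT_0.
  unfold Rdiv. rewrite Rinv_mult, <- Rmult_assoc.
  apply Rmult_le_compat_r; [apply Rlt_le, Rinv_0_lt_compat; auto|].
  apply Rle_trans with (4 * / 2); [|lra].
  apply Rmult_le_compat; [lra| |lra|].
  - apply Rlt_le, Rinv_0_lt_compat. lra.
  - apply Rinv_le_contravar; lra.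
Qed.

Lemma is_lim_seq_inv_INR : is_lim_seq (fun N => / INR N) 0.
Proof.
  apply (is_lim_seq_inv INR p_infty); [apply is_lim_seq_INR|discriminate].
Qed.

Lemma is_lim_seq_sqrt_0 u : is_lim_seq u 0 -> is_lim_seq (fun n => sqrt (u n)) 0.
Proof.
  intros H. rewrite <- sqrt_0. apply (is_lim_seq_continuous sqrt u 0); auto.
  apply continuity_pt_sqrt. lra.
Qed.

Lemma is_lim_seq_squeeze_abs (u e : nat -> R) (a : R) :
  is_lim_seq e 0 -> Hierarchy.eventually (fun n => Rabs (u n - a) <= e n) -> is_lim_seq u a.
Proof.
  intros He Hu.
  apply (is_lim_seq_le_le_loc (fun n => a - e n) u (fun n => a + e n)).
  - revert Hu. apply filter_imp. intros n H. apply Rabs_le_between in H. lra.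
  - replace (Finite a) with (Finite (a - 0)) by (f_equal; ring).
    apply is_lim_seq_minus'; auto. apply is_lim_seq_const.
  - replace (Finite a) with (Finite (a + 0)) by (f_equal; ring).
    apply is_lim_seq_plus'; auto. apply is_lim_seq_const.
Qed.

Lemma is_lim_seq_saddle : is_lim_seq saddle 0.
Proof.
  apply (is_lim_seq_squeeze_abs _ (fun N => 2 * sqrt (/ INR N))).
  - replace (Finite 0) with (Finite (2 * 0)) by (f_equal; ring).
    apply is_lim_seq_scal_l with (lu := Finite 0). apply is_lim_seq_sqrt_0, is_lim_seq_inv_INR.
  - exists 1%nat. intros N HN. rewrite sqrt_inv, Rminus_0_r, Rabs_right.
    + now apply saddle_le.
    + apply Rle_ge, Rlt_le, saddle_pos; auto.
Qed.

Lemma IZR_pz_part N : IZR (pz (Z.of_nat N)) = INR (part N).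
Proof.
  unfold pz. destruct (Z.ltb_spec (Z.of_nat N) 0); [lia|].
  now rewrite Nat2Z.id, <- INR_IZR_INZ.
Qed.

Lemma az_uniform : exists C N1, 0 < C /\ (1 <= N1)%nat /\ forall N, (N1 <= N)%nat ->
  saddle N <= / 4 /\ 0 < INR (part N) /\ forall l k : nat,
  Rabs (IZR (az l (Z.of_nat N - Z.of_nat k))
        - INR (part N) * exp (- (INR k * saddle N)) * F (saddle N * INR l))
  <= INR (part N) * exp (- (INR k * saddle N))
     * (C * (INR k * (saddle N * sqrt (saddle N)) + sqrt (saddle N))).
Proof.
  destruct partition_increment as (C & t0 & HC & Ht0 & HK).
  destruct (proj2 (is_lim_seq_spec saddle 0) is_lim_seq_saddle (mkposreal t0 (proj1 Ht0))) as [N1 HN1].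
  simpl in HN1.
  exists (2 * C + 52), (max N1 1). split; [lra|]. split; [lia|].
  intros N HN. pose proof (saddle_pos N ltac:(lia)) as Hp.
  specialize (HN1 N ltac:(lia)). rewrite Rminus_0_r, Rabs_right in HN1 by lra.
  destruct (HK N (saddle N) ltac:(lra) ltac:(apply saddle_sq; lia)) as [HP Hinc].
  split; [lra|]. pose proof (az_approx C (saddle N) N HC ltac:(lra)) as HA.
  cbv zeta in HA. specialize (HA HP Hinc). rewrite IZR_pz_part in *.
  split; auto. intros l k. eapply Rle_trans; [apply HA|].
  pose proof (exp_pos (- (INR k * saddle N))). assert (0 < sqrt (saddle N)) by (now apply sqrt_lt_R0).
  pose proof (pos_INR k).
  assert (0 <= INR k * (saddle N * sqrt (saddle N))).
  { apply Rmult_le_pos; [lra|]. apply Rmult_le_pos; lra. }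
  apply Rmult_le_compat_l; [apply Rmult_le_pos; lra|]. nra.
Qed.

Lemma INR_Vd_rank_az m N :
  INR (Vd_rank m N) = IZR (az (Z.abs_nat m) (Z.of_nat N - Z.of_nat (Z.to_nat (tri (Z.abs m))))).
Proof.
  rewrite INR_IZR_INZ, Vd_rank_az, Z2Nat.id; auto. apply tri_nonneg.
Qed.

Lemma tri_half_nat a : Z.of_nat (a * (a + 1) / 2) = tri (Z.of_nat a).
Proof.
  unfold tri. rewrite Nat2Z.inj_div, Nat2Z.inj_mul, Nat2Z.inj_add. reflexivity.
Qed.

(** The left side has order [N^(-1/4)]; squaring reduces the claim to [N^(-1/2) <= N^(-1/5)]. *)
Lemma sqrt_saddle_le N : (1 <= N)%nat -> sqrt (saddle N) <= 2 * Rpower (INR N) (-1/10).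
Proof.
  intros HN. assert (H1 : 1 <= INR N) by (change 1 with (INR 1); apply le_INR; lia).
  pose proof (saddle_pos N HN) as Hp.
  assert (HR : 0 < Rpower (INR N) (-1/10)) by apply exp_pos.
  apply Rsqr_incr_0_var; [|lra]. rewrite Rsqr_sqrt by lra. unfold Rsqr.
  replace (2 * Rpower (INR N) (-1/10) * (2 * Rpower (INR N) (-1/10)))
    with (4 * (Rpower (INR N) (-1/10) * Rpower (INR N) (-1/10))) by ring.
  rewrite <- Rpower_plus.
  eapply Rle_trans; [now apply saddle_le|].
  rewrite <- Rpower_sqrt, <- Rpower_Ropp by lra.
  assert (Rpower (INR N) (- / 2) <= Rpower (INR N) (-1/10 + -1/10)).
  { destruct H1 as [H1|H1].
    - apply Rle_Rpower; lra.
    - rewrite <- H1. unfold Rpower. rewrite ln_1, !Rmult_0_r. lra. }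
  assert (0 < Rpower (INR N) (- / 2)) by apply exp_pos. lra.
Qed.

Lemma F_bounds a : 0 <= a -> 2 / 3 <= F a <= 1.
Proof.
  intros H. rewrite F_Fx. apply Fx_bounds. pose proof (exp_neg_bounds a H). lra.
Qed.

Lemma uniform_asymptotics :
  exists C N0 : R, forall (N : nat) (l : Z), N0 <= INR N ->
     let a := Z.abs_nat l in
     let main := INR (part N) * F (PI * IZR (Z.abs l) / sqrt (6 * INR N)) in
     Rabs (INR (Vd_rank l (N + a * (a + 1) / 2)%nat) - main)
       <= C * Rpower (INR N) (-1/10) * main.
Proof.
  destruct az_uniform as (C & N1 & HC & HN1 & H).
  (* The factor 3 is the 2 of [sqrt_saddle_le] divided by the lower bound [2/3] of [F], which turns
     the error into a relative one. *)
  exists (3 * C), (INR N1). intros N l HN a main. apply INR_le in HN.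
  destruct (H N HN) as (Hs4 & HP & HA). specialize (HA a 0%nat).
  pose proof (saddle_pos N ltac:(lia)) as Hp.
  assert (E1 : INR (Vd_rank l (N + a * (a + 1) / 2)) = IZR (az a (Z.of_nat N - Z.of_nat 0))).
  { rewrite INR_IZR_INZ, Vd_rank_az, Nat2Z.inj_add, tri_half_nat. fold a. unfold a.
    rewrite Zabs2Nat.id_abs. do 2 f_equal. lia. }
  assert (E2 : main = INR (part N) * F (saddle N * INR a)).
  { unfold main. do 2 f_equal. unfold saddle, a. rewrite (INR_IZR_INZ (Z.abs_nat l)), Zabs2Nat.id_abs.
    assert (0 < sqrt (6 * INR N)).
    { apply sqrt_lt_R0. pose proof (lt_0_INR N ltac:(lia)). lra. }
    field. lra. }
  rewrite E1, E2. simpl INR in HA. rewrite !Rmult_0_l, Ropp_0, exp_0, !Rmult_1_r, Rplus_0_l in HA.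
  eapply Rle_trans; [exact HA|].
  pose proof (F_bounds (saddle N * INR a) ltac:(pose proof (pos_INR a); nra)) as HF.
  pose proof (sqrt_saddle_le N ltac:(lia)) as Hs.
  assert (HR : 0 < Rpower (INR N) (-1/10)) by apply exp_pos.
  set (R10 := Rpower (INR N) (-1/10)) in *. set (s := sqrt (saddle N)) in *.
  set (P := INR (part N)) in *. set (f := F (saddle N * INR a)) in *.
  replace (3 * C * R10 * (P * f)) with (P * (C * (3 * R10 * f))) by ring.
  apply Rmult_le_compat_l; [lra|]. apply Rmult_le_compat_l; [lra|]. nra.
Qed.

(** * Summation over all ranks and the limit law *)

Lemma IZR_zsum f n : IZR (zsum f n) = rsum (fun i => IZR (f i)) n.
Proof. induction n; cbn [zsum rsum]; auto. now rewrite plus_IZR, IHn. Qed.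

Lemma gauss_sum_symmetric c N :
  rsum (fun i => exp (- (c * (IZR (Z.of_nat i - Z.of_nat N) * IZR (Z.of_nat i - Z.of_nat N))))) (2 * N + 1)
  = 1 + 2 * gsum c N.
Proof.
  replace (2 * N + 1)%nat with (N + S N)%nat by lia.
  rewrite rsum_app, rsum_shift, rsum_rev. unfold gsum.
  replace (Z.of_nat (N + 0) - Z.of_nat N)%Z with 0%Z by lia.
  rewrite !Rmult_0_r, Ropp_0, exp_0.
  rewrite (rsum_ext _ (fun j => exp (- (c * (INR (S j) * INR (S j)))))) at 1.
  2:{ intros i Hi. replace (Z.of_nat (N - 1 - i) - Z.of_nat N)%Z with (- Z.of_nat (S i))%Z by lia.
      rewrite opp_IZR, <- INR_IZR_INZ. apply f_equal. ring. }
  rewrite (rsum_ext (fun i => exp (- (c * (IZR (Z.of_nat (N + S i) - Z.of_nat N) * IZR (Z.of_nat (N + S i) - Z.of_nat N)))))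
     (fun j => exp (- (c * (INR (S j) * INR (S j)))))).
  2:{ intros i Hi. replace (Z.of_nat (N + S i) - Z.of_nat N)%Z with (Z.of_nat (S i)) by lia.
      rewrite <- INR_IZR_INZ. reflexivity. }
  ring.
Qed.

Lemma IZR_tri_abs m : 2 * IZR (tri (Z.abs m)) = IZR m * IZR m + IZR (Z.abs m).
Proof.
  pose proof (tri_spec (Z.abs m)) as H. apply (f_equal IZR) in H.
  rewrite !mult_IZR, plus_IZR in H. rewrite <- !mult_IZR in *. rewrite mult_IZR in H.
  assert (E : (Z.abs m * Z.abs m = m * m)%Z) by lia.
  rewrite mult_IZR, H, <- E, !mult_IZR. ring.
Qed.

(** A power of the rank in an error term is absorbed by halving the exponent, so that the errors
    remain summable over all ranks. *)
Lemma u_exp_le u : 0 <= u -> u * exp (- (u * u / 2)) <= exp (- (u * u / 4)).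
Proof.
  intros Hu. replace (- (u * u / 2)) with (- (u * u / 4) + - (u * u / 4)) by field.
  rewrite exp_plus. pose proof (exp_pos (- (u * u / 4))) as H.
  assert (u * exp (- (u * u / 4)) <= 1); [|nra].
  pose proof (exp_ineq1_le (u * u / 4)) as H1.
  assert (E : exp (u * u / 4) * exp (- (u * u / 4)) = 1) by (rewrite <- exp_plus, Rplus_opp_r; apply exp_0).
  assert (0 <= (u / 2 - 1) * (u / 2 - 1)) by apply Rle_0_sqr. nra.
Qed.

Lemma x_exp_le x : 0 <= x -> x * exp (- x) <= exp (- (x / 2)).
Proof.
  intros Hx. replace (- x) with (- (x / 2) + - (x / 2)) by field.
  rewrite exp_plus. pose proof (exp_pos (- (x / 2))) as H.
  assert (x * exp (- (x / 2)) <= 1); [|nra].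
  replace (x / 2) with (x / 4 + x / 4) by field. rewrite Ropp_plus_distr, exp_plus.
  pose proof (exp_ineq1_le (x / 4)) as H1. pose proof (exp_pos (- (x / 4))).
  assert (E : exp (x / 4) * exp (- (x / 4)) = 1) by (rewrite <- exp_plus, Rplus_opp_r; apply exp_0).
  set (e := exp (- (x / 4))) in *.
  assert (H3 : (1 + x / 4) * e <= 1) by nra.
  assert (x * (e * e) <= ((1 + x / 4) * e) * ((1 + x / 4) * e)).
  { replace (x * (e * e)) with (x * e * e) by ring.
    assert (0 <= (1 - x / 4) * (1 - x / 4)) by apply Rle_0_sqr. nra. }
  assert (0 <= (1 + x / 4) * e) by nra. nra.
Qed.

Lemma F_near_zero a : 0 <= a -> Rabs (F a - 2 / 3) <= a.
Proof.
  intros Ha. rewrite F_Fx. replace (2 / 3) with (Fx 1) by (unfold Fx; field).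
  pose proof (exp_neg_bounds a Ha) as H. pose proof (one_minus_exp_le a).
  eapply Rle_trans; [apply Fx_lipschitz; lra|]. rewrite Rabs_left1; lra.
Qed.

(** The first bound keeps a Gaussian on the right and is summed over all ranks; the second is
    relative to the Gaussian and serves a single rank. Its term [y^2 t^(3/2)] has order
    [m^2 N^(-3/4)], which tends to 0 for [m = o(N^(3/8))]. *)
Lemma rank_estimates : exists C N1, 0 < C /\ (1 <= N1)%nat /\ forall N, (N1 <= N)%nat ->
  saddle N <= / 4 /\ 0 < INR (part N) /\ forall m : Z,
  let t := saddle N in let s := sqrt t in let x := IZR m in let y := IZR (Z.abs m) in
  Rabs (INR (Vd_rank m N) / INR (part N) - 2 / 3 * exp (- (t / 2 * (x * x))))
    <= C * s * exp (- (t / 4 * (x * x))) /\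
  Rabs (INR (Vd_rank m N) / (INR (part N) * exp (- (t / 2 * (x * x)))) - 2 / 3)
    <= C * (t * y + y * y * (t * s) + s).
Proof.
  destruct az_uniform as (C & N1 & HC & HN1 & H).
  exists (2 * C + 2), N1. split; [lra|]. split; auto. intros N HN.
  destruct (H N HN) as (Hs4 & HP & HA). split; auto. split; auto. clear H.
  intros m t s x y. specialize (HA (Z.abs_nat m) (Z.to_nat (tri (Z.abs m)))).
  rewrite <- INR_Vd_rank_az in HA.
  rewrite (INR_IZR_INZ (Z.to_nat _)), Z2Nat.id in HA by apply tri_nonneg.
  rewrite (INR_IZR_INZ (Z.abs_nat m)), Zabs2Nat.id_abs in HA. fold y t s in HA.
  pose proof (IZR_tri_abs m) as HT. fold x y in HT. set (T := IZR (tri (Z.abs m))) in *.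
  assert (Hy : 0 <= y) by (apply IZR_le; lia).
  assert (Hyy : y * y = x * x) by (unfold x, y; rewrite <- !mult_IZR; f_equal; lia).
  assert (Hy1 : y <= y * y) by (unfold y; rewrite <- mult_IZR; apply IZR_le; nia).
  pose proof (saddle_pos N ltac:(lia)) as Hp. fold t in Hp.
  assert (Hs : 0 < s) by (now apply sqrt_lt_R0).
  assert (Hss : s * s = t) by (apply sqrt_sqrt; lra).
  set (P := INR (part N)) in *. set (V := INR (Vd_rank m N)) in *.
  set (G := exp (- (t / 2 * (x * x)))). assert (HG : 0 < G) by apply exp_pos.
  set (h := exp (- (t * y / 2))).
  pose proof (exp_neg_bounds (t * y / 2) ltac:(nra)) as Hh. fold h in Hh.
  pose proof (one_minus_exp_le (t * y / 2)) as Hh1. fold h in Hh1.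
  assert (ET : exp (- (T * t)) = G * h).
  { unfold G, h. rewrite <- exp_plus. apply f_equal.
    replace (T * t) with (2 * T * t / 2) by field. rewrite HT. field. }
  rewrite ET in HA.
  set (f := F (t * y)) in *. assert (Hty : 0 <= t * y) by nra.
  pose proof (F_bounds (t * y) Hty) as Hf. fold f in Hf.
  pose proof (F_near_zero (t * y) Hty) as Hf0. fold f in Hf0.
  assert (HT2 : 0 <= T <= y * y) by lra.
  assert (Hts : 0 < t * s) by nra.
  assert (Hdiv : Rabs (V / P - G * h * f) <= G * h * (C * (T * (t * s) + s))).
  { replace (V / P - G * h * f) with ((V - P * (G * h) * f) * / P) by (field; lra).
    rewrite Rabs_mult, (Rabs_right (/ P)) by (apply Rle_ge, Rlt_le, Rinv_0_lt_compat; auto).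
    apply (Rmult_le_reg_r P); auto. rewrite Rmult_assoc, Rinv_l, Rmult_1_r by lra. lra. }
  assert (Hhf : Rabs (h * f - 2 / 3) <= 2 * (t * y)).
  { replace (h * f - 2 / 3) with ((h - 1) * f + (f - 2 / 3)) by ring.
    eapply Rle_trans; [apply Rabs_triang|]. rewrite Rabs_mult, Rabs_left1, (Rabs_right f) by lra. nra. }
  split.
  - replace (V / P - 2 / 3 * G) with ((V / P - G * h * f) + G * (h * f - 2 / 3)) by ring.
    eapply Rle_trans; [apply Rabs_triang|]. rewrite (Rabs_mult G), (Rabs_right G) by lra.
    set (G4 := exp (- (t / 4 * (x * x)))). assert (HG4 : 0 < G4) by apply exp_pos.
    assert (B1 : G * (2 * (t * y)) <= 2 * s * G4).
    { replace (G * (2 * (t * y))) with (2 * s * (s * y * G)) by (rewrite <- Hss; ring).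
      apply Rmult_le_compat_l; [lra|]. pose proof (u_exp_le (s * y) ltac:(nra)) as Hu.
      replace (s * y * (s * y) / 2) with (t / 2 * (x * x)) in Hu by (rewrite <- Hss, <- Hyy; field).
      replace (s * y * (s * y) / 4) with (t / 4 * (x * x)) in Hu by (rewrite <- Hss, <- Hyy; field).
      exact Hu. }
    assert (B2 : G * h * (T * t) <= G4).
    { rewrite <- ET, Rmult_comm. eapply Rle_trans; [apply x_exp_le; nra|].
      apply exp_le_compat. replace (T * t / 2) with (2 * T * t / 4) by field. rewrite HT. nra. }
    assert (B3 : G * h <= G4).
    { rewrite <- ET. apply exp_le_compat. replace (T * t) with (2 * T * t / 2) by field. rewrite HT. nra. }
    assert (B4 : G * Rabs (h * f - 2 / 3) <= G * (2 * (t * y))) by (apply Rmult_le_compat_l; lra).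
    assert (B5 : G * h * (C * (T * (t * s) + s)) <= 2 * C * s * G4).
    { replace (G * h * (C * (T * (t * s) + s))) with (C * s * (G * h * (T * t) + G * h)) by ring.
      replace (2 * C * s * G4) with (C * s * (G4 + G4)) by ring.
      apply Rmult_le_compat_l; [nra|lra]. }
    lra.
  - replace (V / (P * G) - 2 / 3) with ((V / P - G * h * f) * / G + (h * f - 2 / 3)) by (field; lra).
    eapply Rle_trans; [apply Rabs_triang|].
    assert (B1 : Rabs ((V / P - G * h * f) * / G) <= C * (T * (t * s) + s)).
    { rewrite Rabs_mult, (Rabs_right (/ G)) by (apply Rle_ge, Rlt_le, Rinv_0_lt_compat; auto).
      apply (Rmult_le_reg_r G); auto. rewrite Rmult_assoc, Rinv_l, Rmult_1_r by lra.
      eapply Rle_trans; [exact Hdiv|].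
      replace (G * h * (C * (T * (t * s) + s))) with (h * (C * (T * (t * s) + s) * G)) by ring.
      assert (0 <= C * (T * (t * s) + s) * G).
      { apply Rmult_le_pos; [|lra]. apply Rmult_le_pos; [lra|]. nra. }
      nra. }
    assert (T * (t * s) <= y * y * (t * s)) by (apply Rmult_le_compat_r; lra).
    assert (0 <= y * y * (t * s)) by (apply Rmult_le_pos; nra).
    nra.
Qed.

Lemma INR_Vd_sum N :
  INR (Vd N) = rsum (fun i => INR (Vd_rank (Z.of_nat i - Z.of_nat N) N)) (2 * N + 1).
Proof.
  rewrite INR_IZR_INZ, Vd_sum_ranks, IZR_zsum. apply rsum_ext. intros i _.
  now rewrite <- INR_IZR_INZ.
Qed.

Lemma gint_le_1 Y : 0 <= Y -> gint Y <= 1.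
Proof.
  intros H. pose proof (gint_sqr Y H). pose proof (haux_bounds Y). pose proof PI_4.
  pose proof (gint_nonneg Y H). nra.
Qed.

Lemma gsum_quarter_bound s N : 0 < s <= / 2 -> s * (1 + 2 * gsum (s * s / 4) N) <= 6.
Proof.
  intros Hs. pose proof (gsum_integral (s / 2) N ltac:(lra)) as H.
  replace (s / 2 * (s / 2)) with (s * s / 4) in H by field.
  pose proof (gint_le_1 (s / 2 * INR N) ltac:(pose proof (pos_INR N); nra)) as Hg.
  apply Rabs_le_between in H.
  assert (gint (s / 2 * INR N) / (s / 2) <= 2 / s).
  { replace (2 / s) with (1 * / (s / 2)) by (field; lra). unfold Rdiv at 1.
    apply Rmult_le_compat_r; [apply Rlt_le, Rinv_0_lt_compat; lra|auto]. }
  assert (s * gsum (s * s / 4) N <= s * (1 + 2 / s)) by (apply Rmult_le_compat_l; lra).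
  replace (s * (1 + 2 / s)) with (s + 2) in H1 by (field; lra). lra.
Qed.

(** The sum over ranks stops at [N]. The hypothesis on [s^2 N^2] makes the missing Gaussian tail
    [O(e^(-N/2))], and [e^(-N/2) <= 2/N]. *)
Lemma gsum_half_limit s N : 0 < s <= / 2 -> INR N <= s * s * (INR N * INR N) -> 0 < INR N ->
  Rabs (s * (1 + 2 * gsum (s * s / 2) N) - sqrt (2 * PI)) <= 3 * s + 16 * / INR N.
Proof.
  intros Hs HN HN0.
  assert (Hq : sqrt 2 * sqrt 2 = 2) by (apply sqrt_sqrt; lra).
  assert (Hq1 : 0 < sqrt 2) by (apply sqrt_lt_R0; lra). assert (Hq2 : sqrt 2 <= 2) by nra.
  set (c := s / sqrt 2). assert (Hc : 0 < c) by (apply Rdiv_lt_0_compat; lra).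
  assert (Hcc : c * c = s * s / 2).
  { unfold c. replace (s / sqrt 2 * (s / sqrt 2)) with (s * s / (sqrt 2 * sqrt 2)) by (field; lra).
    now rewrite Hq. }
  pose proof (gsum_integral c N Hc) as H. rewrite Hcc in H.
  assert (HcN : 0 <= c * INR N) by nra.
  pose proof (gint_limit (c * INR N) HcN) as HL.
  replace (c * INR N * (c * INR N)) with (c * c * (INR N * INR N)) in HL by ring. rewrite Hcc in HL.
  assert (He : exp (- (s * s / 2 * (INR N * INR N))) <= 2 * / INR N).
  { apply Rle_trans with (exp (- (INR N / 2))); [apply exp_le_compat; lra|].
    rewrite exp_Ropp. pose proof (exp_ineq1_le (INR N / 2)).
    replace (2 * / INR N) with (/ (INR N / 2)) by (field; lra). apply Rinv_le_contravar; lra. }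
  set (I := gint (c * INR N)) in *. set (g := gsum (s * s / 2) N) in *.
  rewrite sqrt_mult by (pose proof PI_RGT_0; lra).
  assert (Hsc : s * (I / c) = sqrt 2 * I) by (unfold c; field; lra).
  assert (A1 : Rabs (s * (1 + 2 * g) - 2 * (sqrt 2 * I)) <= 3 * s).
  { rewrite <- Hsc. replace (s * (1 + 2 * g) - 2 * (s * (I / c))) with (s * (1 + 2 * (g - I / c))) by ring.
    rewrite Rabs_mult, (Rabs_right s) by lra.
    assert (Rabs (1 + 2 * (g - I / c)) <= 3).
    { apply Rabs_le. apply Rabs_le_between in H. lra. }
    nra. }
  assert (A2 : Rabs (2 * (sqrt 2 * I) - sqrt 2 * sqrt PI) <= 16 * / INR N).
  { replace (2 * (sqrt 2 * I) - sqrt 2 * sqrt PI) with (2 * sqrt 2 * (I - sqrt PI / 2)) by field.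
    rewrite Rabs_mult, (Rabs_right (2 * sqrt 2)) by lra.
    replace (16 * / INR N) with (4 * (2 * (2 * / INR N))) by ring.
    apply Rmult_le_compat; [lra|apply Rabs_pos|lra|lra]. }
  replace (s * (1 + 2 * g) - sqrt 2 * sqrt PI)
    with ((s * (1 + 2 * g) - 2 * (sqrt 2 * I)) + (2 * (sqrt 2 * I) - sqrt 2 * sqrt PI)) by ring.
  eapply Rle_trans; [apply Rabs_triang|]. lra.
Qed.

Lemma saddle_ge N : (1 <= N)%nat -> INR N <= saddle N * (INR N * INR N).
Proof.
  intros H. assert (H1 : 1 <= INR N) by (change 1 with (INR 1); apply le_INR; lia).
  pose proof (saddle_pos N H) as Hp. pose proof (saddle_sq N H) as E. pose proof PI2_3_2.
  assert (1 <= saddle N * INR N).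
  { assert (E2 : INR N * (saddle N * saddle N) = PI * PI / 6) by (rewrite E; field; lra).
    destruct (Rle_lt_dec 1 (saddle N * INR N)); auto.
    assert (9 / 6 <= PI * PI / 6) by nra.
    assert ((saddle N * INR N) * (saddle N * INR N) < 1) by nra.
    assert ((saddle N * INR N) * (saddle N * INR N) = INR N * (PI * PI / 6)) by (rewrite <- E2; ring).
    nra. }
  nra.
Qed.

(** Each rank has an error of [O(sqrt t)] times a Gaussian, and these Gaussians sum to
    [O(1/sqrt t)]; after multiplication by [sqrt t] the total error is [O(sqrt t)]. *)
Lemma is_lim_seq_total :
  is_lim_seq (fun N => sqrt (saddle N) * INR (Vd N) / INR (part N)) (2 / 3 * sqrt (2 * PI)).
Proof.
  destruct rank_estimates as (C & N1 & HC & HN1 & H).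
  apply (is_lim_seq_squeeze_abs _ (fun N => (6 * C + 3) * sqrt (saddle N) + 16 * / INR N)).
  - replace (Finite 0) with (Finite ((6 * C + 3) * 0 + 16 * 0)) by (f_equal; ring).
    apply is_lim_seq_plus'.
    + apply (is_lim_seq_scal_l (fun N => sqrt (saddle N)) (6 * C + 3) 0).
      apply is_lim_seq_sqrt_0, is_lim_seq_saddle.
    + apply (is_lim_seq_scal_l (fun N => / INR N) 16 0). apply is_lim_seq_inv_INR.
  - exists N1. intros N HN. destruct (H N HN) as (Hs4 & HP & HR). clear H.
    pose proof (saddle_pos N ltac:(lia)) as Hp. pose proof (saddle_ge N ltac:(lia)) as Hge.
    pose proof (lt_0_INR N ltac:(lia)) as HN0.
    set (t := saddle N) in *. set (s := sqrt t) in *.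
    assert (Hs : 0 < s) by (now apply sqrt_lt_R0).
    assert (Hss : s * s = t) by (apply sqrt_sqrt; lra). assert (Hs2 : s <= / 2) by nra.
    pose proof (gsum_half_limit s N ltac:(lra) ltac:(rewrite Hss; auto) HN0) as HL.
    pose proof (gsum_quarter_bound s N ltac:(lra)) as HQ.
    rewrite Hss in HL, HQ.
    assert (HS : Rabs (INR (Vd N) / INR (part N) - 2 / 3 * (1 + 2 * gsum (t / 2) N))
      <= C * s * (1 + 2 * gsum (t / 4) N)).
    { rewrite INR_Vd_sum, <- !gauss_sum_symmetric, <- !rsum_scal.
      unfold Rdiv at 1. rewrite Rmult_comm, <- rsum_scal, <- rsum_minus.
      eapply Rle_trans; [apply rsum_abs|]. apply rsum_le. intros i _.
      rewrite (Rmult_comm (/ INR (part N))). apply HR. }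
    set (g2 := gsum (t / 2) N) in *. set (g4 := gsum (t / 4) N) in *.
    replace (s * INR (Vd N) / INR (part N) - 2 / 3 * sqrt (2 * PI))
      with (s * (INR (Vd N) / INR (part N) - 2 / 3 * (1 + 2 * g2))
            + 2 / 3 * (s * (1 + 2 * g2) - sqrt (2 * PI))) by (field; lra).
    eapply Rle_trans; [apply Rabs_triang|].
    rewrite !Rabs_mult, (Rabs_right s), (Rabs_right (2 / 3)) by lra.
    assert (s * Rabs (INR (Vd N) / INR (part N) - 2 / 3 * (1 + 2 * g2)) <= s * (C * s * (1 + 2 * g4)))
      by (apply Rmult_le_compat_l; lra).
    assert (C * s * (s * (1 + 2 * g4)) <= C * s * 6) by (apply Rmult_le_compat_l; nra).
    pose proof (Rabs_pos (s * (1 + 2 * g2) - sqrt (2 * PI))).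
    assert (0 < / INR N) by (now apply Rinv_0_lt_compat).
    lra.
Qed.

Lemma is_lim_seq_rank (m : nat -> Z) :
  is_lim_seq (fun N => IZR (Z.abs (m N)) / Rpower (INR N) (3/8)) 0 ->
  is_lim_seq (fun N => INR (Vd_rank (m N) N)
    / (INR (part N) * exp (- (saddle N / 2 * (IZR (m N) * IZR (m N)))))) (2 / 3).
Proof.
  intros Hm. set (w := fun N => IZR (Z.abs (m N)) / Rpower (INR N) (3/8)) in *.
  destruct rank_estimates as (C & N1 & HC & HN1 & H).
  apply (is_lim_seq_squeeze_abs _ (fun N => C * (2 * w N + 4 * (w N * w N) + sqrt (saddle N)))).
  - replace (Finite 0) with (Finite (C * (2 * 0 + 4 * (0 * 0) + 0))) by (f_equal; ring).
    apply (is_lim_seq_scal_l _ C (Finite (2 * 0 + 4 * (0 * 0) + 0))).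
    apply is_lim_seq_plus'; [apply is_lim_seq_plus'|].
    + apply (is_lim_seq_scal_l w 2 0 Hm).
    + apply (is_lim_seq_scal_l (fun N => w N * w N) 4 (Finite (0 * 0))). now apply is_lim_seq_mult'.
    + apply is_lim_seq_sqrt_0, is_lim_seq_saddle.
  - exists N1. intros N HN. destruct (H N HN) as (Hs4 & HP & HR). clear H.
    specialize (HR (m N)). cbv zeta in HR. destruct HR as [_ HR].
    eapply Rle_trans; [exact HR|]. apply Rmult_le_compat_l; [lra|].
    pose proof (saddle_pos N ltac:(lia)) as Hp. pose proof (saddle_le N ltac:(lia)) as Hle.
    assert (HN0 : 1 <= INR N) by (change 1 with (INR 1); apply le_INR; lia).
    set (t := saddle N) in *. set (s := sqrt t) in *. set (y := IZR (Z.abs (m N))) in *.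
    assert (Hy : 0 <= y) by (apply IZR_le; lia).
    assert (Hs : 0 < s) by (now apply sqrt_lt_R0).
    assert (Hss : s * s = t) by (apply sqrt_sqrt; lra).
    set (Q := Rpower (INR N) (3/8)) in *. assert (HQ : 0 < Q) by apply exp_pos.
    assert (Hyw : y = w N * Q) by (unfold w; fold y Q; field; lra).
    assert (Hw : 0 <= w N) by (unfold w; fold y Q; apply Rmult_le_pos; [auto|apply Rlt_le, Rinv_0_lt_compat; auto]).
    assert (Hr : 0 < sqrt (INR N)) by (apply sqrt_lt_R0; lra).
    assert (Hrr : sqrt (INR N) * sqrt (INR N) = INR N) by (apply sqrt_sqrt; lra).
    assert (HQr : Q <= sqrt (INR N)).
    { rewrite <- Rpower_sqrt by lra. unfold Q. destruct HN0 as [HN0|HN0].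
      - apply Rle_Rpower; lra.
      - rewrite <- HN0. unfold Rpower. rewrite ln_1, !Rmult_0_r. lra. }
    assert (HQ4 : Q * Q * (Q * Q) = INR N * sqrt (INR N)).
    { unfold Q. rewrite <- !Rpower_plus, <- Rpower_sqrt by lra.
      rewrite <- (Rpower_1 (INR N)) at 2 by lra. rewrite <- Rpower_plus. f_equal. field. }
    assert (Htr : t * sqrt (INR N) <= 2).
    { apply (Rmult_le_compat_r (sqrt (INR N))) in Hle; [|lra].
      rewrite Rmult_assoc, Rinv_l in Hle by lra. lra. }
    assert (B1 : t * Q <= 2) by nra.
    (* With [t <= 2 N^(-1/2)] and [Q^4 = N^(3/2)] the square is [t^3 Q^4 <= 8]. *)
    assert (B2 : t * s * (Q * Q) <= 4).
    { apply Rsqr_incr_0_var; [|lra]. unfold Rsqr.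
      replace (t * s * (Q * Q) * (t * s * (Q * Q))) with (t * t * (s * s) * (Q * Q * (Q * Q))) by ring.
      rewrite Hss, HQ4. rewrite <- Hrr at 1. set (r := sqrt (INR N)) in *.
      replace (t * t * t * (r * r * r)) with ((t * r) * (t * r) * (t * r)) by ring.
      assert (0 <= t * r) by nra. assert ((t * r) * (t * r) <= 4) by nra. nra. }
    rewrite Hyw.
    replace (t * (w N * Q)) with (w N * (t * Q)) by ring.
    replace (w N * Q * (w N * Q) * (t * s)) with (w N * w N * (t * s * (Q * Q))) by ring.
    assert (w N * (t * Q) <= w N * 2) by (apply Rmult_le_compat_l; lra).
    assert (w N * w N * (t * s * (Q * Q)) <= w N * w N * 4) by (apply Rmult_le_compat_l; nra).
    lra.
Qed.

Theorem theorem1 :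
  (exists C N0 : R, forall (N : nat) (l : Z), N0 <= INR N ->
     let a := Z.abs_nat l in
     let main := INR (part N) * F (PI * IZR (Z.abs l) / sqrt (6 * INR N)) in
     Rabs (INR (Vd_rank l (N + a * (a + 1) / 2)%nat) - main)
       <= C * Rpower (INR N) (-1/10) * main) /\
  (forall m : nat -> Z,
     Un_cv (fun N => IZR (Z.abs (m N)) / Rpower (INR N) (3/8)) 0 ->
     Un_cv (fun N =>
        (INR (Vd_rank (m N) N) / INR (Vd N)) /
        (/ Rpower (24 * INR N) (1/4) *
         exp (- (PI * IZR (m N) ^ 2) / sqrt (24 * INR N)))) 1).
Proof.
  split; [exact uniform_asymptotics|].
  intros m Hm. apply is_lim_seq_Reals. apply is_lim_seq_Reals in Hm.
  pose proof (is_lim_seq_rank m Hm) as HV. pose proof is_lim_seq_total as HT.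
  destruct rank_estimates as (C & N1 & HC & HN1 & H).
  pose proof PI_RGT_0 as Hpi.
  assert (Hq : 0 < sqrt (2 * PI)) by (apply sqrt_lt_R0; lra).
  set (a := 2 / 3 * sqrt (2 * PI)) in *.
  assert (Ha : 0 < a) by (unfold a; lra).
  (* The limit is positive, so the total count is eventually nonzero and the quotient can be
     rearranged. *)
  assert (Hpos : Hierarchy.eventually (fun N => 0 < sqrt (saddle N) * INR (Vd N) / INR (part N))).
  { destruct (proj2 (is_lim_seq_spec _ a) HT (mkposreal a Ha)) as [N2 HN2]. exists N2.
    intros N HN. specialize (HN2 N HN). simpl in HN2. apply Rabs_lt_between in HN2. lra. }
  apply (is_lim_seq_ext_loc (fun N =>
     INR (Vd_rank (m N) N) / (INR (part N) * exp (- (saddle N / 2 * (IZR (m N) * IZR (m N)))))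
     / (sqrt (saddle N) * INR (Vd N) / INR (part N)) * sqrt (2 * PI))).
  - destruct Hpos as [N2 HN2]. exists (max N1 N2). intros N HN.
    specialize (HN2 N ltac:(lia)). destruct (H N ltac:(lia)) as (_ & HP & _).
    pose proof (saddle_pos N ltac:(lia)) as Hp.
    assert (HN0 : 1 <= INR N) by (change 1 with (INR 1); apply le_INR; lia).
    assert (Hs : 0 < sqrt (saddle N)) by (now apply sqrt_lt_R0).
    assert (H6 : 0 < sqrt (6 * INR N)) by (apply sqrt_lt_R0; lra).
    assert (HV0 : 0 < INR (Vd N)).
    { destruct (pos_INR (Vd N)) as [Hv|Hv]; auto. rewrite <- Hv in HN2.
      unfold Rdiv in HN2. rewrite Rmult_0_r, Rmult_0_l in HN2. lra. }
    assert (E24 : sqrt (24 * INR N) = 2 * sqrt (6 * INR N)).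
    { replace (24 * INR N) with (2 * 2 * (6 * INR N)) by ring.
      rewrite sqrt_mult by lra. now rewrite sqrt_square by lra. }
    assert (ER : Rpower (24 * INR N) (1/4) = sqrt (sqrt (24 * INR N))).
    { rewrite <- !Rpower_sqrt by (try lra; apply exp_pos || (apply sqrt_lt_R0; lra)).
      rewrite Rpower_mult. f_equal. field. }
    (* Because [t sqrt(24N) = 2 PI] for the saddle value [t]; this is where the normalisation
       [(24N)^(1/4)] comes from. *)
    assert (EQ : sqrt (2 * PI) = sqrt (saddle N) * Rpower (24 * INR N) (1/4)).
    { rewrite ER, <- sqrt_mult by (try lra; apply sqrt_pos). f_equal. rewrite E24.
      unfold saddle. field. lra. }
    assert (EG : exp (- (PI * IZR (m N) ^ 2) / sqrt (24 * INR N))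
       = exp (- (saddle N / 2 * (IZR (m N) * IZR (m N))))).
    { apply f_equal. rewrite E24. unfold saddle. field. lra. }
    rewrite EG, EQ. pose proof (exp_pos (- (saddle N / 2 * (IZR (m N) * IZR (m N))))) as HG.
    assert (HR4 : 0 < Rpower (24 * INR N) (1/4)) by apply exp_pos.
    field. repeat split; lra.
  - replace (Finite 1) with (Finite (2 / 3 / a * sqrt (2 * PI))) by (f_equal; unfold a; field; lra).
    apply is_lim_seq_mult'; [|apply is_lim_seq_const].
    apply is_lim_seq_div'; auto. lra.
Qed.
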